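(* Suppose $\Phi=(\Phi^{(j)})_{j\in\mathbb{N}}$ is an analytic NIFS on $(U,X)$ such that, for some integer $n>1$, the set $\overline{J^{(n)}}$ is uniformly perfect. Suppose also that the family of maps $\widetilde{\Phi}^{(1)}=\Phi^{(1)}\circ\cdots\circ\Phi^{(n-1)}=\{f_1\circ\cdots\circ f_{n-1}: f_i\in\Phi^{(i)}\}$ is finite. Then $\overline{J(\Phi)}$ is uniformly perfect.
   Context: NIFS. Let $U\subseteq\mathbb{C}$ be non-empty, open and connected and let $X\subset U$ be compact. A non-autonomous iterated function system (NIFS) $\Phi$ on $(U,X)$ is a sequence $\Phi^{(1)},\Phi^{(2)},\dots$, where each $\Phi^{(j)}=(\varphi^{(j)}_i:U\to X)_{i\in I^{(j)}}$ is a collection of non-constant functions indexed by a non-empty set $I^{(j)}$ (of arbitrary cardinality), such that there exist $0<s<1$ and a metric $d$ on $U$, inducing the Euclidean topology on $X$, with $d(\varphi(z),\varphi(w))\le s\,d(z,w)$ for all $z,w\in X$ and all $\varphi\in\bigcup_j\Phi^{(j)}$. The NIFS is analytic if all its maps are complex analytic on $U$. Limit sets. For $j,k\in\mathbb{N}$ let $X^{(j)}_k$ be the union of the sets $\varphi^{(j)}_{\omega_1}\circ\varphi^{(j+1)}_{\omega_2}\circ\cdots\circ\varphi^{(j+k-1)}_{\omega_k}(X)$ over all $(\omega_1,\dots,\omega_k)\in I^{(j)}\times\cdots\times I^{(j+k-1)}$, and let $J^{(j)}=\bigcap_{k=1}^\infty X^{(j)}_k$. The limit set of $\Phi$ is $J(\Phi)=J^{(1)}$.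 Closures are Euclidean. Annuli. A conformal annulus is a doubly connected domain $A\subset\mathbb{C}$ that can be mapped conformally onto a round annulus $\{z:r<|z-w|<R\}$ with $0<r<R<\infty$; its modulus is $\mathrm{mod}\,A=\log(R/r)$. It separates a set $F\subset\mathbb{C}$ if $F\cap A=\emptyset$ and $F$ meets both components of $\mathbb{C}\setminus A$. A compact set $F\subset\mathbb{C}$ with at least two points is uniformly perfect if there is a uniform upper bound on the moduli of all conformal annuli which separate $F$. *)

(* Defs.v *)
From mathcomp Require Import all_boot all_order all_algebra.
From mathcomp Require Import all_classical all_reals all_analysis.
From mathcomp Require Import complex.

Set Implicit Arguments.
Unset Strict Implicit.
Unset Printing Implicit Defensive.

Import Order.TTheory GRing.Theory Num.Theory.
Import numFieldNormedType.Exports.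

Local Open Scope classical_set_scope.
Local Open Scope complex_scope.
Local Open Scope ring_scope.

(* The topology on the complex numbers is that of the field [R[i]] viewed as a
   normed module over itself, which is only declared on the alias [R[i]^o]. *)
Notation plane R := (R[i]^o).

Section Holomorphy.
Variable R : realType.

(* [derivable f z 1] over the field [R[i]] is complex differentiability. *)
Definition holomorphic_on (U : set (plane R)) (f : plane R -> plane R) : Prop :=
  forall z, U z -> derivable f z 1.

End Holomorphy.

Section NIFS.
Variable R : realType.

Record is_metric_on (U : set (plane R)) (d : plane R -> plane R -> R) : Prop := {
  metric_ge0 : forall z w, U z -> U w -> 0 <= d z w;
  metric_eq0 : forall z w, U z -> U w -> d z w = 0 <-> z = w;
  metric_sym : forall z w, U z -> U w -> d z w = d w z;
  metric_triangle : forall z w v, U z -> U w -> U v ->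
    d z v <= d z w + d w v
}.

Definition induces_euclidean_topology
    (X : set (plane R)) (d : plane R -> plane R -> R) : Prop :=
  forall S : set (plane R), S `<=` X ->
    (exists2 V : set (plane R), open V & S = X `&` V) <->
    (forall z, S z ->
      exists2 e : R, 0 < e & forall w, X w -> d z w < e -> S w).

(* The stages are numbered from 1, so [I 0] and [phi 0] are never used.
   A map U -> X is represented by a total function of which only the
   restriction to U matters. *)
Record is_nifs (U X : set (plane R)) (I : nat -> Type)
    (phi : forall j, I j -> plane R -> plane R) : Prop := {
  nifs_domain_nonempty : U !=set0;
  nifs_domain_open : open U;
  nifs_domain_connected : connected U;
  nifs_compact : compact X;
  nifs_sub : X `<=` U;
  nifs_index_nonempty : forall j, (0 < j)%N -> inhabited (I j);
  nifs_maps : forall j (i : I j), (0 < j)%N ->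
    forall z, U z -> X (phi j i z);
  nifs_nonconstant : forall j (i : I j), (0 < j)%N ->
    exists z w, [/\ U z, U w & phi j i z <> phi j i w];
  nifs_contracting : exists (s : R) (d : plane R -> plane R -> R),
    [/\ 0 < s < 1, is_metric_on U d, induces_euclidean_topology X d &
      forall j (i : I j), (0 < j)%N ->
        forall z w, X z -> X w -> d (phi j i z) (phi j i w) <= s * d z w]
}.

Definition is_analytic (U : set (plane R)) (I : nat -> Type)
    (phi : forall j, I j -> plane R -> plane R) : Prop :=
  forall j (i : I j), (0 < j)%N -> holomorphic_on U (phi j i).

(* The family Phi^(j) o Phi^(j+1) o ... o Phi^(j+k-1). *)
Fixpoint composites (I : nat -> Type) (phi : forall j, I j -> plane R -> plane R)
    (j k : nat) : set (plane R -> plane R) :=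
  if k is k'.+1 then
    [set phi j i \o g | i in [set: I j] & g in composites phi j.+1 k']
  else [set idfun].

Definition stage_set (X : set (plane R)) (I : nat -> Type)
    (phi : forall j, I j -> plane R -> plane R) (j k : nat) : set (plane R) :=
  \bigcup_(g in composites phi j k) (g @` X).

Definition limit_set_from (X : set (plane R)) (I : nat -> Type)
    (phi : forall j, I j -> plane R -> plane R) (j : nat) : set (plane R) :=
  \bigcap_(k in [set k | (0 < k)%N]) stage_set X phi j k.

Definition limit_set (X : set (plane R)) (I : nat -> Type)
    (phi : forall j, I j -> plane R -> plane R) : set (plane R) :=
  limit_set_from X phi 1.

End NIFS.

Section UniformPerfectness.
Variable R : realType.

Definition components (B : set (plane R)) : set (set (plane R)) :=
  [set connected_component B z | z in B].

(* Components of the complement are taken in the plane, not in the sphere.  The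
   two conventions differ only for some unbounded A, and give the same notion
   of uniform perfectness: shrinking such an A slightly through its conformal
   map yields bounded annuli separating the same set, of moduli tending to
   that of A. *)
Definition doubly_connected_domain (A : set (plane R)) : Prop :=
  [/\ open A, connected A & (components (~` A) #= `I_2)%card].

Definition round_annulus (w : plane R) (r s : R) : set (plane R) :=
  [set z | r%:C < `|z - w| < s%:C].

Definition conformal_map (A B : set (plane R)) (f : plane R -> plane R) : Prop :=
  holomorphic_on A f /\ set_bij A B f.

(* A is a conformal annulus of modulus m.  The modulus is a relation here; it
   is a function of A because s / r is a conformal invariant. *)
Definition conformal_annulus (A : set (plane R)) (m : R) : Prop :=
  doubly_connected_domain A /\
  exists (w : plane R) (r s : R) (f : plane R -> plane R),
    [/\ 0 < r, r < s, conformal_map A (round_annulus w r s) f &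
        m = ln (s / r)].

Definition separates (A F : set (plane R)) : Prop :=
  F `&` A = set0 /\ forall E, components (~` A) E -> F `&` E !=set0.

Definition uniformly_perfect (F : set (plane R)) : Prop :=
  [/\ compact F,
      exists z w, [/\ F z, F w & z <> w] &
      exists M : R, forall (A : set (plane R)) (m : R),
        conformal_annulus A m -> separates A F -> m <= M].

End UniformPerfectness.

(* Main.v *)
Require Import Defs.
From mathcomp Require Import all_boot all_order all_algebra.
From mathcomp Require Import all_classical all_reals all_analysis.
From mathcomp Require Import complex.
From mathcomp Require Import ring lra zify.

(** Why the theorem is true.

    Uniform perfectness is equivalent to a metric condition, [scale_perfect]:
    there is [c > 0] such that around each point of the set every annulus with
    radii [c * rho] and [rho], [rho] up to the distance to another point of the
    set, contains a point of the set. A uniformly perfect set satisfies it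
    because a round annulus that misses the set separates it
    ([uniformly_perfect_scale]). The converse has to bound the modulus of an
    arbitrary conformal annulus ([conformal_modulus], see below).

    The closure of the limit set is the union of the images of the closure of
    [limit_set_from X phi n] under the finitely many maps of the composed
    family ([closure_limit_set]): the fibres of a non-constant analytic map are
    discrete, so by compactness the images commute with the decreasing
    intersection of the stages. Near each point such a map is, up to
    a nonvanishing factor, a power of the distance to that point
    ([local_form]); hence it carries points at all scales to points at all
    scales, with constants that compactness makes uniform
    ([finite_images_perfect]). So the metric condition passes to the limit set.

    For the converse implication let [h] map the round annulus
    [r < cabs z < s] conformally onto a ring domain that separates [F], and let
    [a] and [b] be points of [F] in the two components of the complement. On the
    strip [ln r < Re z < ln s] the function [log ((h (exp z) - a) /
    (h (exp z) - b))] omits all the values of [log ((k - a) / (k - b))] for [k]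
    in [F], and by the metric condition these values form a net of the plane
    whose mesh depends on [c] only. An argument of Bloch ([bloch]) then bounds
    the derivative on the middle line by a constant over [ln (s / r)]. But its
    mean over a period is the difference of the winding numbers around [a] and
    [b] of the image of a circle, which is a nonzero integer ([winding_jump]).
    So [ln (s / r)] is bounded.

    That the two winding numbers differ is the topological point. The winding
    number of the image of a circle around a point of the ring domain drops by 1
    when the circle shrinks past the point, so around a component of the
    complement it has one of two consecutive values. Were it the same for both
    components, both would be at the same end of the ring domain, against the
    connectedness of the thin subrings at that end ([one_ended_ring_absurd]).

    The function theory rests on primitives. Goursat's dyadic argument, which
    tolerates isolated points of mere continuity, gives primitives on vertical
    strips ([strip_primitive]); the mean of [f] over circles around [c] is the
    period of a primitive of [f (c + exp z)], divided by 2 pi i ([cmean]), and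
    Cauchy's formula, removable singularities and the analyticity of derivatives
    follow by comparing such means. *)

Set Implicit Arguments.
Unset Strict Implicit.
Unset Printing Implicit Defensive.

Import Order.TTheory GRing.Theory Num.Theory.
Import numFieldNormedType.Exports.

Local Open Scope classical_set_scope.
Local Open Scope complex_scope.
Local Open Scope ring_scope.

Local Notation Re := (@complex.Re _).
Local Notation Im := (@complex.Im _).

(** * Modulus and complex derivative *)

Section Modulus.
Variable R : realType.
Local Notation C := (plane R).
Implicit Types (z w : C) (x y : R).

(** The norm of [R[i]] takes its values in [R[i]]; estimates are made in the
    ordered field [R]. *)
Definition cabs z : R := Re `|z|.

Lemma normcabs z : `|z| = (cabs z)%:C.
Proof. by rewrite /cabs normc_def. Qed.

Lemma cabsE z : cabs z = Num.sqrt (Re z ^+ 2 + Im z ^+ 2).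
Proof. by rewrite /cabs normc_def. Qed.

Lemma cabs_ge0 z : 0 <= cabs z.
Proof. by rewrite cabsE sqrtr_ge0. Qed.

Lemma cabsM z w : cabs (z * w) = cabs z * cabs w.
Proof.
have /complexI -> // : (cabs (z * w))%:C = (cabs z * cabs w)%:C.
by rewrite rmorphM /= -!normcabs normrM.
Qed.

Lemma cabs_triangle z w : cabs (z + w) <= cabs z + cabs w.
Proof.
by rewrite -lecR rmorphD /= -!normcabs ler_normD.
Qed.

Lemma cabsN z : cabs (- z) = cabs z.
Proof. by rewrite /cabs normrN. Qed.

Lemma cabs0 : cabs 0 = 0.
Proof. by rewrite /cabs normr0. Qed.

Lemma cabs1 : cabs 1 = 1.
Proof. by rewrite /cabs normr1. Qed.

Lemma cabsi : cabs 'i = 1.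
Proof. by rewrite cabsE /= expr0n /= add0r expr1n sqrtr1. Qed.

Lemma cabsR x : cabs x%:C = `|x|.
Proof. by rewrite cabsE /= expr0n /= addr0 sqrtr_sqr. Qed.

Lemma cabs_eq0 z : (cabs z == 0) = (z == 0).
Proof.
apply/eqP/eqP => [h|->]; last exact: cabs0.
by apply/eqP; rewrite -normr_eq0 normcabs h.
Qed.

Lemma cabs_gt0 z : (0 < cabs z) = (z != 0).
Proof. by rewrite lt_neqAle cabs_ge0 andbT eq_sym cabs_eq0. Qed.

Lemma cabsV z : cabs z^-1 = (cabs z)^-1.
Proof.
have [->|z0] := eqVneq z 0; first by rewrite invr0 cabs0 invr0.
have cz : cabs z != 0 by rewrite cabs_eq0.
by apply: (mulIf cz); rewrite mulVf // -cabsM mulVf // cabs1.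
Qed.

Lemma cabs_div z w : cabs (z / w) = cabs z / cabs w.
Proof. by rewrite cabsM cabsV. Qed.

Lemma cabsX z n : cabs (z ^+ n) = cabs z ^+ n.
Proof.
by elim: n => [|n IH]; rewrite ?expr0 ?cabs1 // !exprS cabsM IH.
Qed.

Lemma cabsB z w : cabs (z - w) = cabs (w - z).
Proof. by rewrite -cabsN opprB. Qed.

Lemma cabs_dist z w : cabs z - cabs w <= cabs (z - w).
Proof. by rewrite lerBlDr (le_trans _ (cabs_triangle _ _)) // subrK. Qed.

Lemma cabs_trianB z w t : cabs (z - t) <= cabs (z - w) + cabs (w - t).
Proof. by apply: le_trans (cabs_triangle _ _); rewrite addrA subrK. Qed.

Lemma ReD z w : Re (z + w) = Re z + Re w. Proof. by case: z w => ? ? []. Qed.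
Lemma ImD z w : Im (z + w) = Im z + Im w. Proof. by case: z w => ? ? []. Qed.
Lemma ReN z : Re (- z) = - Re z. Proof. by case: z. Qed.
Lemma ImN z : Im (- z) = - Im z. Proof. by case: z. Qed.
Lemma ReM z w : Re (z * w) = Re z * Re w - Im z * Im w.
Proof. by case: z w => ? ? []. Qed.
Lemma ImM z w : Im (z * w) = Re z * Im w + Im z * Re w.
Proof. by case: z w => ? ? []. Qed.
Lemma ReC x : Re (x%:C) = x. Proof. by []. Qed.
Lemma ImC x : Im (x%:C) = 0. Proof. by []. Qed.
Lemma Rei : Re ('i : R[i]) = 0. Proof. by []. Qed.
Lemma Imi : Im ('i : R[i]) = 1. Proof. by []. Qed.
Definition ReImE := (ReD, ImD, ReN, ImN, ReM, ImM, ReC, ImC, Rei, Imi).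

Lemma plane_eq z w : Re z = Re w -> Im z = Im w -> z = w.
Proof. by case: z w => ? ? [? ?] /= -> ->. Qed.

Lemma Re_le_cabs z : `|Re z| <= cabs z.
Proof. by rewrite cabsE -sqrtr_sqr ler_wsqrtr // lerDl sqr_ge0. Qed.

Lemma Im_le_cabs z : `|Im z| <= cabs z.
Proof. by rewrite cabsE -sqrtr_sqr ler_wsqrtr // lerDr sqr_ge0. Qed.

Lemma cabs_le_ReIm z : cabs z <= `|Re z| + `|Im z|.
Proof.
have -> : z = (Re z)%:C + (Im z)%:C * 'i.
  by apply: plane_eq; rewrite !ReImE; ring.
rewrite (le_trans (cabs_triangle _ _)) // cabsM cabsi mulr1 !cabsR !ReImE.
by rewrite !(mulr0, mulr1, mul0r, subr0, addr0, add0r).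
Qed.

Lemma near_plane z (P : set C) :
  (\forall w \near z, P w) <->
  exists2 e : R, 0 < e & forall w, cabs (w - z) < e -> P w.
Proof.
split=> [/nbhs_normP[e /= e0 he]|[e e0 he]].
  exists (Re e); first by move: e0; rewrite ltcE => /andP[].
  move=> w hw; apply: he => /=; rewrite normcabs.
  move: e0; rewrite ltcE => /andP[/eqP /= ei _].
  by rewrite ltcE /= ei eqxx /= cabsB.
apply/nbhs_normP; exists e%:C; first by rewrite /= ltcR.
by move=> w /= ; rewrite normcabs ltcR cabsB; exact: he.
Qed.

Lemma openP_plane (A : set C) :
  open A <-> forall z, A z -> exists2 e : R, 0 < e & forall w, cabs (w - z) < e -> A w.
Proof.
rewrite openE; split => h z /h; first by move/near_plane.
by move=> hz; apply/near_plane.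
Qed.

Lemma cts_plane (f : C -> C) z : {for z, continuous f} <->
  forall e : R, 0 < e -> exists2 d : R, 0 < d &
    forall w, cabs (w - z) < d -> cabs (f w - f z) < e.
Proof.
split=> [/cvgrPdist_lt h e e0|h].
  have /h /near_plane[d d0 hd] : 0 < e%:C by rewrite ltcR.
  by exists d => // w /hd; rewrite normcabs ltcR cabsB.
apply: (iffRL (@cvgrPdist_lt _ _ _ (nbhs _) _ _ _)) => e e0; apply/near_plane.
have : 0 < Re e by move: e0; rewrite ltcE => /andP[].
move=> /h[d d0 hd]; exists d => // w /hd.
move: e0; rewrite ltcE => /andP[/eqP /= ei _] hw.
by rewrite normcabs ltcE /= ei eqxx /= cabsB.
Qed.

Lemma cts_planeR (f : C -> R) z : {for z, continuous f} <->
  forall e : R, 0 < e -> exists2 d : R, 0 < d &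
    forall w, cabs (w - z) < d -> `|f w - f z| < e.
Proof.
split=> [/cvgrPdist_lt h e e0|h].
  by have /near_plane[d d0 hd] := h _ e0; exists d => // w /hd; rewrite distrC.
apply: (iffRL (@cvgrPdist_lt _ _ _ (nbhs _) _ _ _)) => e /h[d d0 hd]; apply/near_plane.
by exists d => // w /hd; rewrite distrC.
Qed.

Lemma cts_Rplane (f : R -> C) x : {for x, continuous f} <->
  forall e : R, 0 < e -> exists2 d : R, 0 < d &
    forall y, `|y - x| < d -> cabs (f y - f x) < e.
Proof.
split=> [/cvgrPdist_lt h e e0|h].
  have /h /nbhs_normP[d d0 hd] : 0 < e%:C by rewrite ltcR.
  exists d => // w hw; rewrite cabsB -ltcR -normcabs; apply: hd.
  by rewrite /= distrC.
apply: (iffRL (@cvgrPdist_lt _ _ _ (nbhs _) _ _ _)) => e e0; apply/nbhs_normP.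
have : 0 < Re e by move: e0; rewrite ltcE => /andP[].
move=> /h[d d0 hd]; exists d => // w /=; rewrite distrC => /hd.
move: e0; rewrite ltcE => /andP[/eqP /= ei _] hw.
by rewrite normcabs ltcE /= ei eqxx /= cabsB.
Qed.

Lemma cts_cabs : continuous cabs.
Proof.
move=> z; apply/cts_planeR => e e0; exists e => // w hw.
apply: le_lt_trans hw; rewrite ler_norml cabs_dist andbT.
by rewrite lerNl opprB cabsB cabs_dist.
Qed.

Lemma cts_Re : continuous (@complex.Re R : C -> R).
Proof.
move=> z; apply/cts_planeR => e e0; exists e => // w hw.
by apply: le_lt_trans hw; rewrite -ReN -ReD Re_le_cabs.
Qed.

Lemma cts_Im : continuous (@complex.Im R : C -> R).
Proof.
move=> z; apply/cts_planeR => e e0; exists e => // w hw.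
by apply: le_lt_trans hw; rewrite -ImN -ImD Im_le_cabs.
Qed.

(** The complex derivative with a real modulus of continuity: a form of
    differentiability that real inequalities can use directly. *)
Definition cderiv (f : C -> C) z (l : C) := forall e : R, 0 < e ->
  exists2 d : R, 0 < d & forall h : C, cabs h < d ->
    cabs (f (z + h) - f z - l * h) <= e * cabs h.

Lemma derivable_cderiv (f : C -> C) z : derivable f z 1 ->
  cderiv f z ('D_1 f z).
Proof.
move=> /derivable_nbhsP/eqaddoP h e e0.
have e0' : 0 < e%:C by rewrite ltcR.
have /near_plane[d d0 hd] := h _ e0'.
exists d => // k hk.
have /= := hd k; rewrite subr0 => /(_ hk).
rewrite !normcabs -rmorphM /= lecR; congr (_ <= _); congr cabs.
rewrite /cst /= !fctE /GRing.scale /= mulr1 [k + z]addrC.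
by rewrite opprD addrA [k * _]mulrC.
Qed.

Lemma cderiv_cvg (f : C -> C) z l : cderiv f z l ->
  h^-1 *: ((f \o shift z) (h *: (1 : C)) - f z) @[h --> (0 : C)^'] --> l.
Proof.
move=> h; apply/cvgrPdist_lt => e e0.
have e1 : 0 < Re e / 2 by move: e0; rewrite ltcE => /andP[_ /= ?]; lra.
have [d d0 hd] := h _ e1.
apply/near_plane; exists d => // k; rewrite subr0 => kd k0.
have /= := hd _ kd => {}hd.
rewrite /GRing.scale /= mulr1 [k + z]addrC.
have -> : l - k^-1 * (f (z + k) - f z) = - (k^-1 * (f (z + k) - f z - l * k)).
  by field.
rewrite normrN normcabs cabsM cabsV.
move: e0; rewrite !ltcE => /andP[/eqP /= ei er]; rewrite ei eqxx /=.
have k1 : 0 < cabs k by rewrite cabs_gt0.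
rewrite mulrC ltr_pdivrMr //; apply: le_lt_trans hd _.
by rewrite ltr_pM2r //; lra.
Qed.

Lemma cderiv_derivable (f : C -> C) z l : cderiv f z l -> derivable f z 1.
Proof. by move=> /cderiv_cvg h; apply/cvg_ex; exists l. Qed.

Lemma cderivE (f : C -> C) z l : cderiv f z l -> 'D_1 f z = l.
Proof. by move=> /cderiv_cvg h; apply: cvg_lim => //. Qed.

Lemma cderiv_uniq (f : C -> C) z l l' : cderiv f z l -> cderiv f z l' -> l = l'.
Proof. by move=> /cderivE <- /cderivE <-. Qed.

Lemma cderiv_eq (f : C -> C) z l l' : cderiv f z l -> l = l' -> cderiv f z l'.
Proof. by move=> h <-. Qed.

Lemma cderiv_near (f g : C -> C) z l :
  (\forall w \near z, f w = g w) -> cderiv f z l -> cderiv g z l.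
Proof.
move=> /near_plane[r r0 hr] h e /h[d d0 hd].
exists (Num.min d r); first by rewrite lt_min d0.
move=> k; rewrite lt_min => /andP[kd kr].
rewrite -!hr; first exact: hd.
  by rewrite subrr cabs0.
by rewrite [z + k]addrC addrK.
Qed.

Lemma cderiv_ext (f g : C -> C) z l : f =1 g -> cderiv f z l -> cderiv g z l.
Proof. by move=> /funext ->. Qed.

Lemma cderiv_cts (f : C -> C) z l : cderiv f z l -> {for z, continuous f}.
Proof.
move=> h; apply/cts_plane => e e0.
have [d d0 hd] := h _ ltr01.
have B0 : 0 < 1 + cabs l by have := cabs_ge0 l; lra.
exists (Num.min d (e / (1 + cabs l))); first by rewrite lt_min d0 divr_gt0.
move=> w; rewrite lt_min => /andP[/hd]; rewrite [z + _]addrC subrK mul1r.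
move=> h1; rewrite ltr_pdivlMr // => h2; apply: le_lt_trans h2.
have -> : f w - f z = (f w - f z - l * (w - z)) + l * (w - z) by ring.
apply: le_trans (cabs_triangle _ _) _; rewrite cabsM; lra.
Qed.

Lemma cderiv_cst (k z : C) : cderiv (fun=> k) z 0.
Proof.
by move=> e e0; exists 1 => // h _; rewrite subrr mul0r subr0 cabs0 mulr_ge0 ?cabs_ge0 ?ltW.
Qed.

Lemma cderiv_id z : cderiv id z 1.
Proof.
move=> e e0; exists 1 => // h _; rewrite [z + h]addrC addrK mul1r subrr cabs0.
by rewrite mulr_ge0 ?cabs_ge0 ?ltW.
Qed.

Lemma cderiv_is (f : C -> C) z l : cderiv f z l <-> is_derive z (1:C) f l.
Proof.
split=> [h|[d <-]]; last exact: derivable_cderiv.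
by apply: DeriveDef; [exact: cderiv_derivable h|exact: cderivE].
Qed.

Lemma cderivD (f g : C -> C) z l m : cderiv f z l -> cderiv g z m ->
  cderiv (fun w => f w + g w) z (l + m).
Proof. by rewrite !cderiv_is => hf hg; apply: is_deriveD. Qed.

Lemma cderivN (f : C -> C) z l : cderiv f z l -> cderiv (fun w => - f w) z (- l).
Proof. by rewrite !cderiv_is => hf; apply: is_deriveN. Qed.

Lemma cderivB (f g : C -> C) z l m : cderiv f z l -> cderiv g z m ->
  cderiv (fun w => f w - g w) z (l - m).
Proof. by move=> hf hg; apply: cderivD => //; apply: cderivN. Qed.

Lemma cderivM (f g : C -> C) z l m : cderiv f z l -> cderiv g z m ->
  cderiv (fun w => f w * g w) z (f z * m + g z * l).
Proof. by rewrite !cderiv_is => hf hg; apply: is_deriveM. Qed.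

Lemma cderivZ (f : C -> C) (k z l : C) : cderiv f z l ->
  cderiv (fun w => k * f w) z (k * l).
Proof.
move=> h; apply: cderiv_eq (cderivM (cderiv_cst k z) h) _.
by rewrite mulr0 addr0.
Qed.

Lemma cderivV (f : C -> C) z l : f z != 0 -> cderiv f z l ->
  cderiv (fun w => (f w)^-1) z (- l / f z ^+ 2).
Proof.
move=> fz h; apply: (@cderiv_eq _ _ (- f z ^- 2 *: l)).
  apply/cderiv_is; apply: DeriveDef; last first.
    by rewrite deriveV ?(cderivE h) //; exact: cderiv_derivable h.
  by apply: derivableV => //; apply: cderiv_derivable h.
by rewrite /GRing.scale /= !mulNr mulrC.
Qed.

Lemma cderiv_comp (f g : C -> C) z l m : cderiv f z l -> cderiv g (f z) m ->
  cderiv (fun w => g (f w)) z (m * l).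
Proof.
move=> hf hg e e0.
pose B := 1 + cabs l; have B0 : 0 < B by have := cabs_ge0 l; rewrite /B; lra.
have m0 : 0 < 1 + cabs m by have := cabs_ge0 m; lra.
have e1 : 0 < e / 2 / B by rewrite !divr_gt0.
have [d1 d10 h1] := hg _ e1.
have e2 : 0 < Num.min 1 (e / 2 / (1 + cabs m)) by rewrite lt_min ltr01 !divr_gt0.
have [d2 d20 h2] := hf _ e2.
exists (Num.min d2 (d1 / B)); first by rewrite lt_min d20 divr_gt0.
move=> k; rewrite lt_min ltr_pdivlMr // => /andP[k2 k1].
have {}h2 := h2 _ k2.
have k0 := cabs_ge0 k.
pose q := f (z + k) - f z.
have hq : cabs q <= B * cabs k.
  have -> : q = (q - l * k) + l * k by ring.
  apply: le_trans (cabs_triangle _ _) _.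
  rewrite cabsM /B mulrDl mul1r lerD2r; apply: le_trans h2 _.
  by rewrite ler_piMl // ge_min lexx.
have /h1 : cabs q < d1 by apply: le_lt_trans hq _; rewrite mulrC.
have -> : f z + q = f (z + k) by rewrite /q addrC subrK.
move=> h3.
have -> : g (f (z + k)) - g (f z) - m * l * k =
  (g (f (z + k)) - g (f z) - m * q) + m * (q - l * k) by ring.
apply: le_trans (cabs_triangle _ _) _; rewrite cabsM.
have a1 : e / 2 / B * cabs q <= e / 2 * cabs k.
  apply: le_trans (ler_wpM2l (ltW e1) hq) _.
  by rewrite mulrA divfK ?gt_eqF.
have a2 : cabs m * cabs (q - l * k) <= e / 2 * cabs k.
  apply: le_trans (ler_wpM2l (cabs_ge0 m) h2) _; rewrite mulrA ler_wpM2r //.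
  apply: (@le_trans _ _ ((1 + cabs m) * (e / 2 / (1 + cabs m)))); last first.
    by rewrite mulrC divfK // gt_eqF.
  apply: ler_pM; rewrite ?cabs_ge0 ?(ltW e2) ?lerDr ?ler01 //.
  by rewrite ge_min lexx orbT.
lra.
Qed.

Lemma cderivX (f : C -> C) z l n : cderiv f z l ->
  cderiv (fun w => f w ^+ n) z (n%:R * f z ^+ n.-1 * l).
Proof.
move=> h; elim: n => [|n IH].
  by apply: cderiv_eq (cderiv_cst 1 z) _; rewrite !mul0r.
apply: cderiv_eq.
  apply: cderiv_ext (cderivM h IH) => w; by rewrite exprS.
case: n {IH} => [|n] /=; first by rewrite expr0; ring.
by rewrite exprS -[in RHS](natr1 n.+1); ring.
Qed.

End Modulus.

(** * The complex exponential *)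

Section ComplexExponential.
Variable R : realType.
Local Notation C := (plane R).
Implicit Types (z w : C) (x y : R).

Lemma is_derive_eps (f : R -> R) x l : is_derive x (1:R) f l ->
  forall e : R, 0 < e -> exists2 d : R, 0 < d & forall h : R, `|h| < d ->
    `|f (x + h) - f x - l * h| <= e * `|h|.
Proof.
move=> [/derivable_nbhsP/eqaddoP h <-] e e0.
have /nbhs_normP[d d0 hd] := h _ e0.
exists d => // k hk.
have /= := hd k; rewrite sub0r normrN => /(_ hk).
rewrite /cst /= !fctE /GRing.scale /= mulr1 [k + x]addrC.
by rewrite opprD addrA [k * _]mulrC.
Qed.

Definition cexp z : C := (expR (Re z))%:C * (cos (Im z) +i* sin (Im z)).

Lemma Re_cexp z : Re (cexp z) = expR (Re z) * cos (Im z).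
Proof. by rewrite /cexp !ReImE /=; ring. Qed.

Lemma Im_cexp z : Im (cexp z) = expR (Re z) * sin (Im z).
Proof. by rewrite /cexp !ReImE /=; ring. Qed.

Lemma cexpD z w : cexp (z + w) = cexp z * cexp w.
Proof.
apply: plane_eq; rewrite !(Re_cexp, Im_cexp, ReImE) expRD ?cosD ?sinD;
  ring.
Qed.

Lemma cexp0 : cexp 0 = 1.
Proof.
by apply: plane_eq; rewrite ?Re_cexp ?Im_cexp /= expR0 ?cos0 ?sin0 mul1r.
Qed.

Lemma cabs_cexp z : cabs (cexp z) = expR (Re z).
Proof.
rewrite /cexp cabsM cabsR ger0_norm ?expR_ge0 // cabsE /= cos2Dsin2 sqrtr1.
exact: mulr1.
Qed.

Lemma cexp_neq0 z : cexp z != 0.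
Proof. by rewrite -cabs_gt0 cabs_cexp expR_gt0. Qed.

Lemma cexpN z : cexp (- z) = (cexp z)^-1.
Proof.
by apply: (mulIf (cexp_neq0 z)); rewrite -cexpD addNr cexp0 mulVf ?cexp_neq0.
Qed.

Lemma cexpB z w : cexp (z - w) = cexp z / cexp w.
Proof. by rewrite cexpD cexpN. Qed.

(** The real and imaginary parts of [cexp h - 1 - h] are expanded with the
    derivatives at 0 of the exponential, the cosine and the sine. *)
Lemma cderiv_cexp0 : cderiv cexp 0 1.
Proof.
move=> e e0.
(* The two parts below contribute at most 5 and 6 times [e / 16 * cabs h]. *)
pose e1 := Num.min 1 (e / 16).
have e10 : 0 < e1 by rewrite lt_min ltr01 divr_gt0.
have e1e : e1 <= e / 16 by rewrite ge_min lexx orbT.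
have e11 : e1 <= 1 by rewrite ge_min lexx.
clearbody e1.
have [d1 d10 h1] := is_derive_eps (is_derive_expR (0:R)) e10.
have [d2 d20 h2] := is_derive_eps (is_derive_cos (0:R)) e10.
have [d3 d30 h3] := is_derive_eps (is_derive_sin (0:R)) e10.
exists (Num.min (Num.min d1 e1) (Num.min d2 d3)).
  by rewrite !lt_min d10 d20 d30 e10.
move=> h; rewrite !lt_min => /andP[/andP[hd1 he1] /andP[hd2 hd3]].
rewrite add0r cexp0 mul1r.
have rh := Re_le_cabs h; have ih := Im_le_cabs h.
set x := Re h in rh; set y := Im h in ih.
have := h1 x (le_lt_trans rh hd1).
have := h2 y (le_lt_trans ih hd2).
have := h3 y (le_lt_trans ih hd3).
rewrite !add0r expR0 cos0 sin0 !mul1r oppr0 mul0r !subr0 addr0 => b3 b2 b1.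
have c0 := cabs_ge0 h.
have x1 : `|x| < 1 by lra.
have ex : `|expR x| <= 4.
  have -> : expR x = (expR x - 1 - x) + (1 + x) by ring.
  apply: le_trans (ler_normD _ _) _.
  have : `|1 + x| <= 1 + `|x| by rewrite (le_trans (ler_normD _ _)) // normr1.
  have : e1 * `|x| <= 1 * `|x| by rewrite ler_wpM2r.
  lra.
have exm : `|expR x - 1| <= 2 * `|x|.
  have -> : expR x - 1 = (expR x - 1 - x) + x by ring.
  apply: le_trans (ler_normD _ _) _.
  have : e1 * `|x| <= 1 * `|x| by rewrite ler_wpM2r.
  lra.
have bx : e1 * `|x| <= e / 16 * cabs h by apply: ler_pM => //; lra.
have by_ : e1 * `|y| <= e / 16 * cabs h by apply: ler_pM => //; lra.
apply: le_trans (cabs_le_ReIm _) _; rewrite !(Re_cexp, Im_cexp, ReImE) -/x -/y.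
rewrite subr0.
clear h1 h2 h3 d1 d2 d3 d10 d20 d30 hd1 hd2 hd3.
have r1 : `|expR x * cos y - 1 - x| <= 5 * (e / 16 * cabs h).
  have -> : expR x * cos y - 1 - x = (expR x - 1 - x) + expR x * (cos y - 1).
    by ring.
  apply: le_trans (ler_normD _ _) _; rewrite normrM.
  have : `|expR x| * `|cos y - 1| <= 4 * (e / 16 * cabs h).
    by apply: ler_pM => //; lra.
  lra.
have r2 : `|expR x * sin y - y| <= 6 * (e / 16 * cabs h).
  have -> : expR x * sin y - y = expR x * (sin y - y) + (expR x - 1) * y by ring.
  apply: le_trans (ler_normD _ _) _; rewrite !normrM.
  have a1 : `|expR x| * `|sin y - y| <= 4 * (e / 16 * cabs h).
    by apply: ler_pM => //; lra.
  have a2 : `|expR x - 1| * `|y| <= 2 * (e / 16) * cabs h.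
    by apply: ler_pM => //; lra.
  lra.
have := mulr_ge0 (ltW e0) c0; lra.
Qed.

Lemma cderiv_cexp z : cderiv cexp z (cexp z).
Proof.
move=> e e0.
have ez : 0 < cabs (cexp z) by rewrite cabs_gt0 cexp_neq0.
have [d d0 hd] := cderiv_cexp0 (divr_gt0 e0 ez).
exists d => // h /hd; rewrite add0r cexp0 mul1r => {}hd.
have -> : cexp (z + h) - cexp z - cexp z * h = cexp z * (cexp h - 1 - h).
  by rewrite cexpD; ring.
by rewrite cabsM mulrC -ler_pdivlMr // mulrAC.
Qed.

Definition tpi : C := (pi *+ 2)%:C * 'i.

Lemma Re_tpi : Re tpi = 0. Proof. by rewrite /tpi !ReImE; ring. Qed.
Lemma Im_tpi : Im tpi = pi *+ 2. Proof. by rewrite /tpi !ReImE; ring. Qed.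

Lemma pi2_gt0 : 0 < pi *+ 2 :> R. Proof. by rewrite pmulrn_lgt0 // pi_gt0. Qed.

Lemma tpi_neq0 : tpi != 0.
Proof.
apply/negP => /eqP/(congr1 (@complex.Im R)); rewrite Im_tpi => /eqP.
by rewrite gt_eqF //= pi2_gt0.
Qed.

Lemma cexp_tpi : cexp tpi = 1.
Proof.
by apply: plane_eq; rewrite ?Re_cexp ?Im_cexp Re_tpi Im_tpi expR0
  ?cos2pi ?sin2pi mul1r.
Qed.

Lemma cexp_period z : cexp (z + tpi) = cexp z.
Proof. by rewrite cexpD cexp_tpi mulr1. Qed.

Lemma cexp_periodz z (k : int) : cexp (z + k%:~R * tpi) = cexp z.
Proof.
have hn n : cexp (z + n%:R * tpi) = cexp z.
  elim: n => [|n IH]; first by rewrite mul0r addr0.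
  by rewrite -natr1 mulrDl mul1r addrA cexp_period.
case: k => n; first exact: hn.
rewrite NegzE mulrNz mulNr cexpB.
have := hn n.+1; rewrite cexpD => /(canRL (mulfK (cexp_neq0 _))) h.
by rewrite [in RHS]h.
Qed.

Lemma polar z : z != 0 -> exists w, z = cexp w.
Proof.
move=> z0; have r0 : 0 < cabs z by rewrite cabs_gt0.
pose c := Re z / cabs z; pose s := Im z / cabs z.
have cs : c ^+ 2 + s ^+ 2 = 1.
  rewrite /c /s !expr_div_n -mulrDl cabsE sqr_sqrtr ?addr_ge0 ?sqr_ge0 //.
  rewrite {1}cabsE in r0; rewrite sqrtr_gt0 in r0.
  by rewrite divff // gt_eqF.
have c1 : -1 <= c <= 1.
  rewrite -ler_norml -(@ler_sqr _ _ 1) ?nnegrE //.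
  by rewrite real_normK ?num_real // expr1n -cs lerDl sqr_ge0.
have sa := sin_acos c1.
have [s0|s0] := leP 0 s.
  exists ((ln (cabs z))%:C + (acos c)%:C * 'i).
  apply: plane_eq; rewrite ?Re_cexp ?Im_cexp !ReImE mulr0 mul0r subr0 addr0 mulr1 mul0r addr0 add0r.
    by rewrite lnK // acosK ?in_itv //= /c mulrC divfK // gt_eqF.
  rewrite lnK // sa -cs [c ^+ 2 + _]addrC addrK sqrtr_sqr ger0_norm //.
  by rewrite /s mulrC divfK // gt_eqF.
exists ((ln (cabs z))%:C + (- acos c)%:C * 'i).
apply: plane_eq; rewrite ?Re_cexp ?Im_cexp !ReImE mulr0 mul0r subr0 addr0 mulr1 mul0r addr0 add0r.
  by rewrite cosN lnK // acosK ?in_itv //= /c mulrC divfK // gt_eqF.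
rewrite sinN lnK // sa -cs [c ^+ 2 + _]addrC addrK sqrtr_sqr ltr0_norm //.
by rewrite opprK /s mulrC divfK // gt_eqF.
Qed.

(** Subtracting periods brings the imaginary part between 0 and 2 pi, where
    the cosine takes the value 1 only at the two ends. *)
Lemma cexp_eq1 z : cexp z = 1 -> exists k : int, z = k%:~R * tpi.
Proof.
move=> h.
have x0 : Re z = 0.
  by apply: (@expR_inj R); rewrite -cabs_cexp h cabs1 expR0.
have p0 := pi2_gt0.
pose k := Num.floor (Im z / (pi *+ 2)).
exists k; pose w : C := z + (- k)%:~R * tpi.
have hw : cexp w = 1 by rewrite /w cexp_periodz.
have kR : (k%:~R : C) = (k%:~R)%:C by rewrite rmorph_int.
have rw : Re w = 0.
  by rewrite /w mulrNz kR !(Re_tpi, ReImE) x0; ring.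
have iw : Im w = Im z - k%:~R * (pi *+ 2).
  by rewrite /w mulrNz kR !(Re_tpi, Im_tpi, ReImE); ring.
suff w0 : Im w = 0.
  have -> : z = w + k%:~R * tpi by rewrite /w mulrNz; ring.
  suff -> : w = 0 by rewrite add0r.
  exact: plane_eq.
have cw : cos (Im w) = 1.
  by have := congr1 (@complex.Re R) hw; rewrite Re_cexp rw expR0 mul1r.
have /andP[k1 k2] := floor_itv (Im z / (pi *+ 2)).
rewrite -/k ler_pdivlMr // in k1.
rewrite -/k ltr_pdivrMr // intrD mulrDl mul1r in k2.
have pp := pi_gt0 R.
have [wp|wp] := leP (Im w) pi.
  apply: (@cos_inj R); rewrite ?in_itv /= ?cos0 ?wp ?lexx ?(ltW pp) ?andbT //.
  by rewrite iw; lra.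
have : pi *+ 2 - Im w = 0.
  apply: (@cos_inj R); rewrite ?in_itv /= ?cos0 ?lexx ?(ltW pp) //.
    by apply/andP; split; rewrite iw in wp *; lra.
  by rewrite -[LHS]cosN opprB -[LHS]cosD2pi subrK.
rewrite iw; lra.
Qed.

End ComplexExponential.

(** * Curves in the plane *)

Section Curves.
Variable R : realType.
Local Notation C := (plane R).
Implicit Types (z w : C) (x y : R).

Definition open_interval (J : set R) :=
  (forall x, J x -> exists2 e : R, 0 < e & forall y, `|y - x| < e -> J y) /\
  (forall x y t, J x -> J y -> x <= t <= y -> J t).

Lemma near_real x (P : set R) :
  (\forall y \near x, P y) <->
  exists2 e : R, 0 < e & forall y, `|y - x| < e -> P y.
Proof.
split=> [/nbhs_normP[e e0 he]|[e e0 he]].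
  by exists e => // y; rewrite distrC => h; exact: he.
by apply/nbhs_normP; exists e => // y /=; rewrite distrC; exact: he.
Qed.

(** The integral from a base point [x0] of [J]. Around each [x] the fundamental
    theorem of calculus is applied on a compact interval that contains [x] and
    [x0] in its interior; there the two integrals differ by a constant. *)
Lemma real_primitive (J : set R) (u : R -> R) : open_interval J ->
  (forall x, J x -> {for x, continuous u}) ->
  exists P : R -> R, forall x, J x -> is_derive x (1:R) P (u x).
Proof.
move=> [oJ iJ] cu.
have [[x0 J0]|nJ] := pselect (J !=set0); last first.
  by exists (cst 0) => x Jx; exfalso; apply: nJ; exists x.
pose mu := @lebesgue_measure R.
pose P y := if x0 <= y then \int[mu]_(t in `]x0, y]) u t
            else - \int[mu]_(t in `]y, x0]) u t.
exists P => x Jx.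
have [a [Ja ax ax0]] : exists a, [/\ J a, a < x & a < x0].
  have [e e0 he] := oJ _ Jx; have [d d0 hd] := oJ _ J0.
  have [xx|xx] := leP x x0.
    exists (x - e / 2); split; [apply: he|lra|lra].
    by rewrite addrC addKr normrN ger0_norm; lra.
  exists (x0 - d / 2); split; [apply: hd|lra|lra].
  by rewrite addrC addKr normrN ger0_norm; lra.
have [b [Jb xb x0b]] : exists b, [/\ J b, x < b & x0 < b].
  have [e e0 he] := oJ _ Jx; have [d d0 hd] := oJ _ J0.
  have [xx|xx] := leP x x0.
    exists (x0 + d / 2); split; [apply: hd|lra|lra].
    by rewrite [x0 + _]addrC addrK ger0_norm; lra.
  exists (x + e / 2); split; [apply: he|lra|lra].
  by rewrite [x + _]addrC addrK ger0_norm; lra.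
have intu c d : J c -> J d -> mu.-integrable `[c, d] (EFin \o u).
  move=> Jc Jd; apply: continuous_compact_integrable; first exact: segment_compact.
  apply: continuous_in_subspaceT => t /set_mem /=; rewrite in_itv /= => tcd.
  by apply: cu; apply: iJ Jc Jd tcd.
have [dF eF] : derivable (fun y => \int[mu]_(t in `[a, y]) u t) x 1 /\
    derive1 (fun y => \int[mu]_(t in `[a, y]) u t) x = u x.
  by apply: (continuous_FTC1_closed xb) => //; [exact: intu|exact: cu].
have h : is_derive x (1:R) (fun y => \int[mu]_(t in `[a, y]) u t
    - \int[mu]_(t in `[a, x0]) u t) (u x).
  rewrite -[u x]subr0; apply: is_deriveB.
  by apply: DeriveDef; [exact: dF|rewrite -derive1E; exact: eF].
apply: near_eq_is_derive h.
have [e e0 he] : exists2 e : R, 0 < e & forall y, `|y - x| < e -> a < y < b.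
  exists (Num.min (x - a) (b - x)); first by rewrite lt_min !subr_gt0 ax xb.
  move=> y; rewrite lt_min !ltr_norml => /andP[/andP[h1 h2] /andP[h3 h4]].
  by apply/andP; split; lra.
apply/near_real; exists e => // y /he /andP[ay yb].
have Jy : J y by apply: iJ Ja Jb _; rewrite !ltW.
rewrite /P; case: ifPn => [xy|]; last rewrite -ltNge => xy.
  rewrite -(Rintegral_itvB (a := BLeft a)) //.
  - exact: intu.
  - by rewrite bnd_simp ltW.
rewrite -(Rintegral_itvB (a := BLeft a)) ?opprB //.
- exact: intu.
- by rewrite bnd_simp ltW.
- by rewrite bnd_simp ltW.
Qed.

Definition rderiv (P : R -> C) x (l : C) := forall e : R, 0 < e ->
  exists2 d : R, 0 < d & forall h : R, `|h| < d ->
    cabs (P (x + h) - P x - l * h%:C) <= e * `|h|.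

Lemma cderiv_rderiv (G : C -> C) z v x l : cderiv G (z + x%:C * v) l ->
  rderiv (fun t => G (z + t%:C * v)) x (l * v).
Proof.
move=> hG e e0.
have v0 : 0 < 1 + cabs v by have := cabs_ge0 v; lra.
have [d d0 hd] := hG _ (divr_gt0 e0 v0).
exists (d / (1 + cabs v)); first by rewrite divr_gt0.
move=> h; rewrite ltr_pdivlMr // => hh.
have n0 := normr_ge0 h.
have n1 := mulr_ge0 n0 (cabs_ge0 v).
have /hd : cabs (h%:C * v) < d by rewrite cabsM cabsR; lra.
rewrite rmorphD /= mulrDl addrA.
have -> : l * (h%:C * v) = l * v * h%:C by ring.
move=> /le_trans -> //; rewrite cabsM cabsR mulrAC ler_pdivrMr //.
by rewrite -mulrA ler_pM2l //; lra.
Qed.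

Lemma rderiv_Re (P : R -> C) x l (u : C) : rderiv P x l ->
  is_derive x (1:R) (fun t => Re (u * P t)) (Re (u * l)).
Proof.
move=> hP; apply/is_derive1_caratheodory.
pose q t := if t == x then Re (u * l) else (Re (u * P t) - Re (u * P x)) / (t - x).
exists q; split; last by rewrite /q eqxx.
  move=> t; rewrite /q; case: eqVneq => [->|tx]; first by rewrite !subrr mulr0.
  by rewrite divfK // subr_eq0.
apply/cvgrPdist_lt => e e0.
have u0 : 0 < 1 + cabs u by have := cabs_ge0 u; lra.
have [d d0 hd] := hP _ (divr_gt0 e0 u0).
apply/near_real; exists d => // t /hd.
rewrite [x + _]addrC subrK => ht; rewrite /q eqxx; case: eqVneq => [_|tx].
  by rewrite subrr normr0.
have t0 : 0 < `|t - x| by rewrite normr_gt0 subr_eq0.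
rewrite -(@ltr_pM2r _ `|t - x|) // -normrM mulrBl divfK ?subr_eq0 //.
have -> : Re (u * l) * (t - x) - (Re (u * P t) - Re (u * P x)) =
   - Re (u * (P t - P x - l * (t - x)%:C)).
  by rewrite !ReImE; ring.
rewrite normrN; apply: le_lt_trans (Re_le_cabs _) _; rewrite cabsM.
have := cabs_ge0 u => cu.
apply: (@le_lt_trans _ _ (cabs u * (e / (1 + cabs u) * `|t - x|))).
  exact: ler_wpM2l.
rewrite !mulrA ltr_pM2r // [_ * e]mulrC -mulrA -[ltRHS]mulr1 ltr_pM2l //.
by rewrite ltr_pdivrMr // mul1r; lra.
Qed.

Lemma rderivD (P Q : R -> C) x l m : rderiv P x l -> rderiv Q x m ->
  rderiv (fun t => P t + Q t) x (l + m).
Proof.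
move=> hP hQ e e0; have e2 : 0 < e / 2 by lra.
have [d d0 hd] := hP _ e2; have [d' d'0 hd'] := hQ _ e2.
exists (Num.min d d'); first by rewrite lt_min d0.
move=> h; rewrite lt_min => /andP[/hd h1 /hd' h2].
have -> : P (x + h) + Q (x + h) - (P x + Q x) - (l + m) * h%:C =
  (P (x + h) - P x - l * h%:C) + (Q (x + h) - Q x - m * h%:C) by ring.
by apply: le_trans (cabs_triangle _ _) _; lra.
Qed.

Lemma rderivMl (P : R -> C) x l u : rderiv P x l ->
  rderiv (fun t => u * P t) x (u * l).
Proof.
move=> hP e e0.
have u0 : 0 < 1 + cabs u by have := cabs_ge0 u; lra.
have [d d0 hd] := hP _ (divr_gt0 e0 u0).
exists d => // h /hd hh.
have -> : u * P (x + h) - u * P x - u * l * h%:C = u * (P (x + h) - P x - l * h%:C).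
  by ring.
rewrite cabsM; apply: le_trans (ler_wpM2l (cabs_ge0 u) hh) _.
rewrite mulrA ler_wpM2r // [cabs u * _]mulrC -mulrA -[leRHS]mulr1 ler_pM2l //.
by rewrite mulrC ler_pdivrMr // mul1r; lra.
Qed.

Lemma rderiv_real (f : R -> R) x l : is_derive x (1:R) f l ->
  rderiv (fun t => (f t)%:C) x l%:C.
Proof.
move=> /is_derive_eps hf e /hf[d d0 hd]; exists d => // h /hd.
by rewrite -rmorphM -!rmorphB /= cabsR.
Qed.

Lemma rderiv_eq (P : R -> C) x l m : rderiv P x l -> l = m -> rderiv P x m.
Proof. by move=> h <-. Qed.

Lemma rderiv_ext (P Q : R -> C) x l : P =1 Q -> rderiv P x l -> rderiv Q x l.
Proof. by move=> /funext ->. Qed.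

(** Multiplication by the conjugate of [P b - P a] and projection to the real
    axis reduce the inequality to the mean value theorem. *)
Lemma curve_mvt (P p : R -> C) (a b B : R) : a <= b ->
  (forall x, a <= x <= b -> rderiv P x (p x)) ->
  (forall x, a <= x <= b -> cabs (p x) <= B) ->
  cabs (P b - P a) <= B * (b - a).
Proof.
move=> ab dP bp.
set D := P b - P a.
pose u : C := (D^*)%C.
have uD v : Re (u * v) = Re D * Re v + Im D * Im v.
  by rewrite /u; case: (D) v => d1 d2 [v1 v2] /=; ring.
have cu : cabs u = cabs D.
  by rewrite !cabsE /u; case: (D) => d1 d2 /=; rewrite sqrrN.
have D2 : Re (u * D) = cabs D ^+ 2.
  rewrite uD cabsE sqr_sqrtr ?addr_ge0 ?sqr_ge0 //; ring.
have dphi x : a <= x <= b -> is_derive x (1:R) (fun t => Re (u * P t)) (Re (u * p x)).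
  by move=> /dP h; exact: rderiv_Re.
have [||c cab hc] := @MVT_segment R (fun t => Re (u * P t)) (fun t => Re (u * p t)) a b ab.
- by move=> x; rewrite in_itv /= => /andP[xa xb]; apply: dphi; rewrite !ltW.
- apply: derivable_within_continuous => x; rewrite in_itv /= => /dphi.
  by case.
have cab' : a <= c <= b by move: cab; rewrite in_itv.
have : cabs D ^+ 2 <= cabs D * B * (b - a).
  rewrite -D2.
  have -> : Re (u * D) = Re (u * P b) - Re (u * P a) by rewrite /D !ReImE; ring.
  rewrite hc ler_wpM2r ?subr_ge0 //.
  apply: le_trans (ler_norm _) _; apply: le_trans (Re_le_cabs _) _.
  by rewrite cabsM cu ler_wpM2l ?cabs_ge0 // bp.
have [D0|D0] := eqVneq (cabs D) 0.
  move=> _; rewrite D0 mulr_ge0 ?subr_ge0 //.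
  by apply: le_trans (bp _ cab'); exact: cabs_ge0.
by rewrite expr2 -mulrA ler_pM2l // lt_neqAle eq_sym D0 cabs_ge0.
Qed.

Lemma segment_mvt (G G' : C -> C) z w B :
  (forall t, 0 <= t <= 1 -> cderiv G (z + t%:C * (w - z)) (G' (z + t%:C * (w - z)))) ->
  (forall t, 0 <= t <= 1 -> cabs (G' (z + t%:C * (w - z))) <= B) ->
  cabs (G w - G z) <= B * cabs (w - z).
Proof.
move=> dG bG.
have := @curve_mvt (fun t => G (z + t%:C * (w - z)))
  (fun t => G' (z + t%:C * (w - z)) * (w - z)) 0 1 (B * cabs (w - z)) ler01.
rewrite subr0 mulr1 mul1r mul0r addr0 [z + _]addrC subrK; apply.
  by move=> x /dG h; apply: cderiv_rderiv.
by move=> x /bG h; rewrite cabsM ler_wpM2r ?cabs_ge0.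
Qed.

Lemma curve_primitive (J : set R) (f : R -> C) : open_interval J ->
  (forall x, J x -> {for x, continuous f}) ->
  exists P : R -> C, forall x, J x -> rderiv P x (f x).
Proof.
move=> oJ cf.
have [|P hP] := @real_primitive J (fun t => Re (f t)) oJ.
  by move=> x Jx; apply: continuous_comp; [exact: cf|exact: cts_Re].
have [|Q hQ] := @real_primitive J (fun t => Im (f t)) oJ.
  by move=> x Jx; apply: continuous_comp; [exact: cf|exact: cts_Im].
exists (fun t => (P t)%:C + 'i * (Q t)%:C) => x Jx.
have := rderivD (rderiv_real (hP _ Jx)) (rderivMl 'i (rderiv_real (hQ _ Jx))).
move=> /rderiv_eq; apply.
by apply: plane_eq; rewrite !ReImE; ring.
Qed.

End Curves.

(** * Goursat's theorem on a vertical strip *)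

Section Goursat.
Variable R : realType.
Local Notation C := (plane R).
Implicit Types (z w : C) (x y a b c d : R).

Lemma half_pow_small (M e : R) : 0 < e -> exists n, M * 2^-1 ^+ n < e.
Proof.
move=> e0.
have h : (fun n : nat => M * 2^-1 ^+ n) @ \oo --> (0 : R).
  rewrite -[X in _ --> X](mulr0 M); apply: cvgMr.
  by apply: cvg_expr; rewrite ger0_norm; lra.
have /cvgrPdist_lt /(_ _ e0)[N _ hN] := h.
exists N; have /= := hN N (leqnn N).
by rewrite sub0r normrN; apply: le_lt_trans; exact: ler_norm.
Qed.

Lemma itv_dist a k x y : a <= x <= a + k -> a <= y <= a + k -> `|x - y| <= k.
Proof. by move=> /andP[? ?] /andP[? ?]; rewrite ler_norml; lra. Qed.

Lemma itv_sub a b a' k x : a <= a' <= x -> x <= a' + k <= b ->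
  [/\ a <= a' <= b, a <= a' + k <= b, a' <= x <= a' + k & a' <= a' + k].
Proof. by move=> /andP[? ?] /andP[? ?]; split; lra. Qed.

(** If the inequality fails on a rectangle, additivity makes it fail on one of
    its four quarters. The nested bad rectangles, all similar to the first one,
    shrink to a point at which the local hypothesis is violated. *)
Lemma dyadic_local_global (Phi : R -> R -> R -> R -> C)
    (mu : R -> R -> R -> R -> R) (x0 y0 p q : R) :
  0 < p -> 0 < q ->
  (forall a m b c d, Phi a b c d = Phi a m c d + Phi m b c d) ->
  (forall a b c m d, Phi a b c d = Phi a b c m + Phi a b m d) ->
  (forall a m b c d, mu a b c d = mu a m c d + mu m b c d) ->
  (forall a b c m d, mu a b c d = mu a b c m + mu a b m d) ->
  (forall x y, x0 <= x <= x0 + p -> y0 <= y <= y0 + q ->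
    exists2 e : R, 0 < e & forall a c k, 0 < k ->
      x0 <= a <= x -> x <= a + p * k <= x0 + p ->
      y0 <= c <= y -> y <= c + q * k <= y0 + q -> (p + q) * k < e ->
      cabs (Phi a (a + p * k) c (c + q * k)) <= mu a (a + p * k) c (c + q * k)) ->
  cabs (Phi x0 (x0 + p) y0 (y0 + q)) <= mu x0 (x0 + p) y0 (y0 + q).
Proof.
move=> p0 q0 Px Py mx my loc; rewrite leNgt; apply/negP => bad0.
pose k n : R := 2^-1 ^+ n.
have kS n : k n = k n.+1 + k n.+1 by rewrite /k exprS; lra.
have k0 n : 0 < k n by rewrite exprn_gt0 // invr_gt0.
pose bad n (ac : R * R) :=
  mu ac.1 (ac.1 + p * k n) ac.2 (ac.2 + q * k n)
  < cabs (Phi ac.1 (ac.1 + p * k n) ac.2 (ac.2 + q * k n)).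
have step (nac : nat * (R * R)) : exists ac' : R * R, bad nac.1 nac.2 ->
   [/\ ac'.1 = nac.2.1 \/ ac'.1 = nac.2.1 + p * k nac.1.+1,
       ac'.2 = nac.2.2 \/ ac'.2 = nac.2.2 + q * k nac.1.+1 & bad nac.1.+1 ac'].
  case: nac => n [a c] /=.
  have [B|nB] := pselect (bad n (a, c)); last by exists (a, c).
  set r := p * k n.+1; set s := q * k n.+1.
  have ea : a + p * k n = a + r + r by rewrite kS /r; ring.
  have ec : c + q * k n = c + s + s by rewrite kS /s; ring.
  have [b1|/negP n1] := boolP (bad n.+1 (a, c)).
    by exists (a, c) => _; split=> //=; left.
  have [b2|/negP n2] := boolP (bad n.+1 (a + r, c)).
    by exists (a + r, c) => _; split=> //=; [right|left].
  have [b3|/negP n3] := boolP (bad n.+1 (a, c + s)).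
    by exists (a, c + s) => _; split=> //=; [left|right].
  have [b4|/negP n4] := boolP (bad n.+1 (a + r, c + s)).
    by exists (a + r, c + s) => _; split=> //=; right.
  exfalso; move: B n1 n2 n3 n4; rewrite /bad /= -/r -/s ea ec.
  rewrite (Px a (a + r)) (Py a (a + r) c (c + s)) (Py (a + r) _ c (c + s)).
  rewrite (mx a (a + r)) (my a (a + r) c (c + s)) (my (a + r) _ c (c + s)).
  move=> B /negP; rewrite -leNgt => n1 /negP; rewrite -leNgt => n2.
  move=> /negP; rewrite -leNgt => n3 /negP; rewrite -leNgt => n4.
  move: B; rewrite ltNge => /negP; apply.
  apply: le_trans (cabs_triangle _ _) _.
  by apply: lerD; (apply: le_trans (cabs_triangle _ _) _); apply: lerD.
have [f hf] := choice step.
pose s := fix s n : R * R := if n is m.+1 then f (m, s m) else (x0, y0).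
have sbad n : bad n (s n).
  elim: n => [|n IH]; first by rewrite /bad /k /= expr0 !mulr1.
  by have [] := hf (n, s n) IH.
have mono (g : R * R -> R) (r : R) (g0 : R) : 0 < r ->
    (forall n, g (s n.+1) = g (s n) \/ g (s n.+1) = g (s n) + r * k n.+1) ->
    g (s 0%N) = g0 ->
    exists x, forall n, [/\ g0 <= g (s n), g (s n) <= x, x <= g (s n) + r * k n
      & g (s n) + r * k n <= g0 + r].
  move=> r0 hs h0.
  have up n m : (n <= m)%N -> g (s n) <= g (s m) /\
      g (s m) + r * k m <= g (s n) + r * k n.
    move=> /subnK <-; elim: (m - n)%N => [//|j [h1 h2]]; rewrite addSn.
    have kp := mulr_gt0 r0 (k0 (j + n).+1).
    have kk := kS (j + n).
    by case: (hs (j + n)%N) => ->; rewrite kk mulrDr in h2; split; lra.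
  have bd n m : g (s n) <= g (s m) + r * k m.
    have [h|h] := leqP n m.
      by have [h1 _] := up _ _ h; have := mulr_gt0 r0 (k0 m); lra.
    by have [_ h1] := up _ _ (ltnW h); have := mulr_gt0 r0 (k0 n); lra.
  pose E := [set g (s n) | n in [set: nat]].
  have hE : has_sup E.
    by split; [exists (g (s 0%N)); exists 0%N|exists (g (s 0%N) + r * k 0%N) => _ [n _ <-]].
  exists (sup E) => n; split.
  - by rewrite -h0; have [] := up 0%N n (leq0n n).
  - by apply: sup_upper_bound => //; exists n.
  - by apply: ge_sup; [exists (g (s 0%N)); exists 0%N|move=> _ [m _ <-]].
  - by have [_] := up 0%N n (leq0n n); rewrite h0 {2}/k expr0 mulr1.
have [x hx] : exists x, forall n, [/\ x0 <= (s n).1, (s n).1 <= x,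
    x <= (s n).1 + p * k n & (s n).1 + p * k n <= x0 + p].
  by apply: (mono fst p x0) => // n; have [] := hf (n, s n) (sbad n).
have [y hy] : exists y, forall n, [/\ y0 <= (s n).2, (s n).2 <= y,
    y <= (s n).2 + q * k n & (s n).2 + q * k n <= y0 + q].
  by apply: (mono snd q y0) => // n; have [] := hf (n, s n) (sbad n).
have [||e e0 he] := loc x y.
- by have [h1 h2 h3 h4] := hx 0%N; apply/andP; split; lra.
- by have [h1 h2 h3 h4] := hy 0%N; apply/andP; split; lra.
have [n hn] := half_pow_small (p + q) e0.
have [h1 h2 h3 h4] := hx n; have [h5 h6 h7 h8] := hy n.
have := he (s n).1 (s n).2 (k n) (k0 n).
rewrite h1 h2 h3 h4 h5 h6 h7 h8 => /(_ isT isT isT isT hn).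
by move=> h; have := sbad n; rewrite /bad ltNge h.
Qed.

Definition pt x y : C := x%:C + y%:C * 'i.

Lemma Re_pt x y : Re (pt x y) = x. Proof. by rewrite /pt !ReImE; ring. Qed.
Lemma Im_pt x y : Im (pt x y) = y. Proof. by rewrite /pt !ReImE; ring. Qed.
Lemma ptE z : pt (Re z) (Im z) = z.
Proof. by apply: plane_eq; rewrite ?Re_pt ?Im_pt. Qed.

Lemma cabs_ptB x y x' y' : cabs (pt x y - pt x' y') <= `|x - x'| + `|y - y'|.
Proof.
by apply: le_trans (cabs_le_ReIm _) _; rewrite !(Re_pt, Im_pt, ReImE).
Qed.

(** Analyticity near [z], except that at [z] itself only continuity is asked.
    Such an isolated exception is removable ([holo_derivable]), but it has to be
    carried through Cauchy's theory, which is applied to divided differences. *)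
Definition holo (F : C -> C) z := {for z, continuous F} /\
  exists2 e : R, 0 < e &
    forall w, w != z -> cabs (w - z) < e -> exists l, cderiv F w l.

Lemma cabs_triangle4 (z1 z2 z3 z4 : C) :
  cabs (z1 + z2 + - z3 + - z4) <= cabs z1 + cabs z2 + cabs z3 + cabs z4.
Proof.
have h1 := cabs_triangle (z1 + z2 + - z3) (- z4).
have h2 := cabs_triangle (z1 + z2) (- z3).
by have h3 := cabs_triangle z1 z2; rewrite !cabsN in h1 h2; lra.
Qed.

(** The signed square root is monotone, so its increments give an additive
    function of intervals; unlike the length, this function is of order
    [sqrt k] on intervals of length [k] that contain 0. *)
Definition ssqrt (t : R) : R := if 0 <= t then Num.sqrt t else - Num.sqrt (- t).

Lemma ssqrt_homo a b : a <= b -> ssqrt a <= ssqrt b.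
Proof.
rewrite /ssqrt => ab; case: ifPn => [a0|]; last rewrite -ltNge => a0.
  by rewrite (le_trans a0 ab) ler_wsqrtr.
case: ifPn => [b0|_]; last by rewrite lerN2 ler_wsqrtr // lerN2.
by apply: (@le_trans _ _ 0); rewrite ?oppr_le0 sqrtr_ge0.
Qed.

Lemma ssqrt_gap a b : a <= 0 -> 0 <= b -> Num.sqrt (b - a) <= ssqrt b - ssqrt a.
Proof.
move=> a0 b0; rewrite /ssqrt b0.
have -> : (if 0 <= a then Num.sqrt a else - Num.sqrt (- a)) = - Num.sqrt (- a).
  by case: ifPn => // a0'; rewrite (@le_anti _ _ a 0) ?a0 ?a0' // oppr0 sqrtr0 oppr0.
rewrite opprK.
have sb := sqrtr_ge0 b; have sa := sqrtr_ge0 (- a).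
apply: (@le_trans _ _ (Num.sqrt ((Num.sqrt b + Num.sqrt (- a)) ^+ 2))).
  apply: ler_wsqrtr; rewrite sqrrD !sqr_sqrtr ?oppr_ge0 //.
  by have := mulr_ge0 sb sa; lra.
by rewrite sqrtr_sqr ger0_norm // addr_ge0.
Qed.

Section Rectangles.
Variables (F : C -> C) (J : set R) (H V : R -> R -> C).
Hypothesis oJ : open_interval J.
Hypothesis dH : forall y x, J x -> rderiv (H y) x (F (pt x y)).
Hypothesis dV : forall x y, J x -> rderiv (V x) y (F (pt x y)).

(** The integral of [F] around the boundary of a rectangle, in terms of its
    primitives [H y] and [V x] along horizontal and vertical lines. *)
Definition rect_int a b c d : C :=
  (H c b - H c a) + 'i * (V b d - V b c) - (H d b - H d a)
  - 'i * (V a d - V a c).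

Lemma rect_int_addx a m b c d :
  rect_int a b c d = rect_int a m c d + rect_int m b c d.
Proof. by rewrite /rect_int; ring. Qed.

Lemma rect_int_addy a b c m d :
  rect_int a b c d = rect_int a b c m + rect_int a b m d.
Proof. by rewrite /rect_int; ring. Qed.

(** An affine function has a primitive [A] on the plane, so it contributes
    nothing to the integral around the rectangle. *)
Lemma rect_int_affine a b c d (k l : C) (eta : R) :
  J a -> J b -> a <= b -> c <= d ->
  (forall x y, a <= x <= b -> c <= y <= d ->
    cabs (F (pt x y) - (k + l * pt x y)) <= eta) ->
  cabs (rect_int a b c d) <= 2 * (eta * ((b - a) + (d - c))).
Proof.
move=> Ja Jb ab cd hF.
have Jx x : a <= x <= b -> J x by apply: oJ.2.
pose A z : C := k * z + l / 2 * (z * z).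
have dA z : cderiv A z (k + l * z).
  have h : cderiv A z (k * 1 + l / 2 * (z * 1 + z * 1)).
    apply: cderivD; apply: cderivZ; first exact: cderiv_id.
    by apply: (cderivM (f := id) (g := id)); exact: cderiv_id.
  by apply: cderiv_eq h _; field.
have eh y : c <= y <= d ->
    cabs (H y b - H y a - (A (pt b y) - A (pt a y))) <= eta * (b - a).
  move=> yy.
  have -> : H y b - H y a - (A (pt b y) - A (pt a y)) =
    (H y b - A (pt b y)) - (H y a - A (pt a y)) by ring.
  apply: (@curve_mvt R (fun t => H y t - A (pt t y))
     (fun t => F (pt t y) - (k + l * pt t y))) => // x xx.
    have dA1 : rderiv (fun t => -1 * A (y%:C * 'i + t%:C * 1)) x
        (-1 * ((k + l * pt x y) * 1)).
      apply: rderivMl; apply: cderiv_rderiv.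
      by rewrite mulr1 addrC; exact: dA.
    apply: rderiv_ext (rderiv_eq (rderivD (dH y (Jx _ xx)) dA1) _).
      by move=> t; rewrite /pt mulr1 mulN1r [y%:C * _ + _]addrC.
    by ring.
  exact: hF.
have ev x : a <= x <= b ->
    cabs ('i * (V x d - V x c) - (A (pt x d) - A (pt x c))) <= eta * (d - c).
  move=> xx.
  have -> : 'i * (V x d - V x c) - (A (pt x d) - A (pt x c)) =
    ('i * V x d - A (pt x d)) - ('i * V x c - A (pt x c)) by ring.
  apply: (@curve_mvt R (fun t => 'i * V x t - A (pt x t))
     (fun t => 'i * (F (pt x t) - (k + l * pt x t)))) => // y yy.
    have dA1 : rderiv (fun t => -1 * A (x%:C + t%:C * 'i)) y
        (-1 * ((k + l * pt x y) * 'i)).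
      by apply: rderivMl; apply: cderiv_rderiv; exact: dA.
    apply: rderiv_ext (rderiv_eq (rderivD (rderivMl 'i (dV y (Jx _ xx))) dA1) _).
      by move=> t; rewrite /pt mulN1r.
    by ring.
  by rewrite cabsM cabsi mul1r; exact: hF.
have -> : rect_int a b c d =
  (H c b - H c a - (A (pt b c) - A (pt a c)))
  + ('i * (V b d - V b c) - (A (pt b d) - A (pt b c)))
  + - (H d b - H d a - (A (pt b d) - A (pt a d)))
  + - ('i * (V a d - V a c) - (A (pt a d) - A (pt a c))).
  by rewrite /rect_int; ring.
have e1 := eh c; have e2 := eh d; have e3 := ev a; have e4 := ev b.
rewrite !lexx ?ab ?cd in e1 e2 e3 e4.
move: (e1 isT) (e2 isT) (e3 isT) (e4 isT) => {}e1 {}e2 {}e3 {}e4.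
apply: le_trans (cabs_triangle4 _ _ _ _) _; lra.
Qed.

(** For every [n] the integral is compared with [n] times an additive function
    [mu]. Where [F] is differentiable its integral is small compared with the
    area. At the exceptional point continuity only makes it small compared with
    the perimeter, and the product of signed square roots, centred at [z],
    dominates the perimeter of rectangles around [z]. *)
Lemma rect_int_local z : J (Re z) -> holo F z ->
  exists2 e : R, 0 < e & forall a c p q, 0 < p -> 0 < q -> J a -> J (a + p) ->
    a <= Re z <= a + p -> c <= Im z <= c + q -> p + q < e ->
    rect_int a (a + p) c (c + q) = 0.
Proof.
move=> Jz [/cts_plane cF [e e0 he]]; exists e => // a c p q p0 q0 Ja Jap za zc pqe.
apply/eqP; rewrite -cabs_eq0 eq_le cabs_ge0 andbT.
(* Normalizations: the subrectangles have sides [p * k] and [q * k], so [K] times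
   the area is the square of [(p + q) * k], and [L] times the product of the
   square roots of the sides is [(p + q) * k]. *)
pose K : R := (p + q) ^+ 2 / (p * q).
pose L : R := (p + q) / (Num.sqrt p * Num.sqrt q).
have sp : 0 < Num.sqrt p by rewrite sqrtr_gt0.
have sq : 0 < Num.sqrt q by rewrite sqrtr_gt0.
have K0 : 0 < K by rewrite divr_gt0 ?exprn_gt0 ?mulr_gt0 // addr_gt0.
have L0 : 0 < L by rewrite divr_gt0 ?mulr_gt0 // addr_gt0.
have hK : K * (p * q) = (p + q) ^+ 2 by rewrite /K divfK // mulf_neq0 ?gt_eqF.
have hL : L * (Num.sqrt p * Num.sqrt q) = p + q.
  by rewrite /L divfK // mulf_neq0 ?gt_eqF.
clearbody K L.
pose mu a b c d : R := K * ((b - a) * (d - c)) +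
  L * ((ssqrt (b - Re z) - ssqrt (a - Re z)) *
       (ssqrt (d - Im z) - ssqrt (c - Im z))).
have mu0 a' b c' d : a' <= b -> c' <= d ->
   0 <= (ssqrt (b - Re z) - ssqrt (a' - Re z)) *
       (ssqrt (d - Im z) - ssqrt (c' - Im z)).
  move=> h1 h2; apply: mulr_ge0; rewrite subr_ge0 ssqrt_homo //; lra.
suff h (n : R) : 0 < n ->
    cabs (rect_int a (a + p) c (c + q)) <= n * (2 * mu a (a + p) c (c + q)).
  have M0 : 0 < 1 + 2 * mu a (a + p) c (c + q).
    rewrite /mu; have := mu0 a (a + p) c (c + q).
    have -> : a + p - a = p by ring.
    have -> : c + q - c = q by ring.
    move=> h'; have /h' h1 : a <= a + p by lra.
    have /h1 h2 : c <= c + q by lra.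
    have := mulr_ge0 (ltW L0) h2; have := mulr_gt0 K0 (mulr_gt0 p0 q0); lra.
  rewrite leNgt; apply/negP => c0.
  have := h _ (divr_gt0 c0 M0).
  rewrite mulrAC ler_pdivlMr // ler_pM2l //; lra.
move=> n0; rewrite mulrA.
apply: (@dyadic_local_global rect_int (fun a b c d => n * 2 * mu a b c d)) => //.
- exact: rect_int_addx.
- exact: rect_int_addy.
- by move=> *; rewrite /mu; ring.
- by move=> *; rewrite /mu; ring.
move=> x y xa yc.
have [zxy|zxy] := eqVneq (pt x y) z.
  have zx : Re z = x by rewrite -zxy Re_pt.
  have zy : Im z = y by rewrite -zxy Im_pt.
  have [d d0 hd] := cF _ n0.
  exists d => // a' c' k k0 a1 a2 c1 c2 kd.
  have [ia ib iax iab] := itv_sub a1 a2; have [_ _ icy icd] := itv_sub c1 c2.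
  apply: le_trans (@rect_int_affine _ _ _ _ (F z) 0 n _ _ iab icd _) _.
  - exact: oJ.2 Ja Jap ia.
  - exact: oJ.2 Ja Jap ib.
  - move=> x' y' xx yy; rewrite mul0r addr0; apply/ltW/hd.
    rewrite -zxy; apply: le_lt_trans (cabs_ptB _ _ _ _) _.
    apply: le_lt_trans kd; rewrite mulrDl.
    exact: lerD (itv_dist xx iax) (itv_dist yy icy).
  have -> : a' + p * k - a' + (c' + q * k - c') = (p + q) * k by ring.
  rewrite [leRHS](_ : _ = 2 * (n * mu a' (a' + p * k) c' (c' + q * k))); last by ring.
  rewrite ler_pM2l // ler_pM2l // /mu.
  apply: (@le_trans _ _ (L * (Num.sqrt (p * k) * Num.sqrt (q * k)))).
    rewrite sqrtrM ?(ltW p0) // [Num.sqrt (q * k)]sqrtrM ?(ltW q0) //.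
    by rewrite mulrACA -expr2 sqr_sqrtr ?(ltW k0) // mulrA hL.
  apply: (@le_trans _ _ (L * ((ssqrt (a' + p * k - Re z) - ssqrt (a' - Re z)) *
       (ssqrt (c' + q * k - Im z) - ssqrt (c' - Im z))))); last first.
    by rewrite lerDr (mulr_ge0 (ltW K0)) // mulr_ge0 // subr_ge0.
  move: iax icy => /andP[a3 a4] /andP[c3 c4].
  rewrite ler_pM2l //; apply: ler_pM; rewrite ?sqrtr_ge0 //.
    have := @ssqrt_gap (a' - Re z) (a' + p * k - Re z).
    have -> : a' + p * k - Re z - (a' - Re z) = p * k by ring.
    by apply; rewrite zx ?subr_le0 ?subr_ge0.
  have := @ssqrt_gap (c' - Im z) (c' + q * k - Im z).
  have -> : c' + q * k - Im z - (c' - Im z) = q * k by ring.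
  by apply; rewrite zy ?subr_le0 ?subr_ge0.
have [|l dl] := he _ zxy.
  rewrite -[z]ptE; apply: le_lt_trans (cabs_ptB _ _ _ _) _.
  by apply: le_lt_trans pqe; exact: lerD (itv_dist xa za) (itv_dist yc zc).
have [d d0 hd] := dl _ n0.
exists d => // a' c' k k0 a1 a2 c1 c2 kd.
have [ia ib iax iab] := itv_sub a1 a2; have [_ _ icy icd] := itv_sub c1 c2.
have pqk : 0 < (p + q) * k by rewrite mulr_gt0 // addr_gt0.
apply: le_trans (@rect_int_affine _ _ _ _ (F (pt x y) - l * pt x y) l
   (n * ((p + q) * k)) _ _ iab icd _) _.
- exact: oJ.2 Ja Jap ia.
- exact: oJ.2 Ja Jap ib.
- move=> x' y' xx yy.
  have ww : cabs (pt x' y' - pt x y) <= (p + q) * k.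
    apply: le_trans (cabs_ptB _ _ _ _) _; rewrite mulrDl.
    exact: lerD (itv_dist xx iax) (itv_dist yy icy).
  have := hd _ (le_lt_trans ww kd); rewrite [pt x y + _]addrC subrK.
  have -> : F (pt x' y') - F (pt x y) - l * (pt x' y' - pt x y) =
    F (pt x' y') - (F (pt x y) - l * pt x y + l * pt x' y') by ring.
  by move=> /le_trans; apply; rewrite ler_pM2l.
have -> : a' + p * k - a' + (c' + q * k - c') = (p + q) * k by ring.
rewrite [leRHS](_ : _ = 2 * (n * mu a' (a' + p * k) c' (c' + q * k))); last by ring.
rewrite -mulrA ler_pM2l // ler_pM2l // /mu.
apply: (@le_trans _ _ (K * ((a' + p * k - a') * (c' + q * k - c')))).
  have -> : K * ((a' + p * k - a') * (c' + q * k - c')) = K * (p * q) * (k * k).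
    by ring.
  by rewrite hK (_ : _ * _ * (_ * _) = (p + q) ^+ 2 * (k * k)) //; ring.
by rewrite lerDl (mulr_ge0 (ltW L0)) // mu0.
Qed.

(** The integral vanishes on small rectangles around each point, and the zero
    function is additive. *)
Lemma rect_int_eq0 a b c d : (forall z, J (Re z) -> holo F z) ->
  J a -> J b -> rect_int a b c d = 0.
Proof.
move=> nF.
have pos a' p c' q : 0 < p -> 0 < q -> J a' -> J (a' + p) ->
    rect_int a' (a' + p) c' (c' + q) = 0.
  move=> p0 q0 Ja Jap; apply/eqP; rewrite -cabs_eq0 eq_le cabs_ge0 andbT.
  apply: (@dyadic_local_global rect_int (fun=> fun=> fun=> fun=> 0)) => //.
  - exact: rect_int_addx.
  - exact: rect_int_addy.
  - by move=> *; rewrite addr0.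
  - by move=> *; rewrite addr0.
  move=> x y xa yc.
  have Jx : J x by apply: oJ.2 xa.
  have [||e e0 he] := @rect_int_local (pt x y); rewrite ?Re_pt ?Im_pt //.
    by apply: nF; rewrite Re_pt.
  exists e => // a1 c1 k k0 h1 h2 h3 h4 kd.
  have [ia ib iax _] := itv_sub h1 h2; have [_ _ icy _] := itv_sub h3 h4.
  rewrite Re_pt Im_pt in he.
  rewrite he ?cabs0 ?mulr_gt0 //.
  - exact: oJ.2 Ja Jap ia.
  - exact: oJ.2 Ja Jap ib.
  - by rewrite -mulrDl.
have posy a' b' c' q : a' <= b' -> 0 < q -> J a' -> J b' ->
    rect_int a' b' c' (c' + q) = 0.
  rewrite le_eqVlt => /orP[/eqP <-|ab] q0 Ja Jb; first by rewrite /rect_int; ring.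
  have eb : b' = a' + (b' - a') by rewrite addrC subrK.
  by rewrite eb; apply: pos; rewrite ?subr_gt0 -?eb.
have posx a' b' c' d' : a' <= b' -> J a' -> J b' -> rect_int a' b' c' d' = 0.
  move=> ab Ja Jb.
  have [cd|cd] := ltP c' d'.
    have -> : d' = c' + (d' - c') by rewrite addrC subrK.
    by apply: posy; rewrite // subr_gt0.
  have [->|ne] := eqVneq c' d'; first by rewrite /rect_int; ring.
  have -> : rect_int a' b' c' d' = - rect_int a' b' d' c'.
    by rewrite /rect_int; ring.
  have -> : c' = d' + (c' - d') by rewrite addrC subrK.
  by rewrite posy ?oppr0 // subr_gt0 lt_neqAle eq_sym ne.
move=> Ja Jb; have [ab|ab] := leP a b; first exact: posx.
have -> : rect_int a b c d = - rect_int b a c d by rewrite /rect_int; ring.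
by rewrite posx ?oppr0 // ltW.
Qed.

End Rectangles.
Lemma curve_mvt_ball (P p : R -> C) (k : C) a b B :
  (forall x, `|x - a| <= `|b - a| -> rderiv P x (p x)) ->
  (forall x, `|x - a| <= `|b - a| -> cabs (p x - k) <= B) ->
  cabs (P b - P a - k * (b - a)%:C) <= B * `|b - a|.
Proof.
move=> dP bP.
have dQ x : `|x - a| <= `|b - a| -> rderiv (fun t => P t + (- k) * t%:C) x (p x - k).
  move=> /dP h; apply: rderiv_eq (rderivD h (rderivMl (- k)
    (rderiv_real (is_derive_id x (1:R))))) _.
  by rewrite mulr1.
have -> : P b - P a - k * (b - a)%:C = (P b + (- k) * b%:C) - (P a + (- k) * a%:C).
  by rewrite rmorphB /=; ring.
have [ab|ab] := leP a b.
  rewrite ger0_norm ?subr_ge0 //.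
  apply: (@curve_mvt _ (fun t => P t + (- k) * t%:C) (fun x => p x - k)) => // x xab.
    by apply: dQ; rewrite ler_norml ger0_norm; lra.
  by apply: bP; rewrite ler_norml ger0_norm; lra.
rewrite cabsB distrC ger0_norm ?subr_ge0 ?(ltW ab) //.
apply: (@curve_mvt _ (fun t => P t + (- k) * t%:C) (fun x => p x - k)).
- exact: ltW.
- by move=> x xab; apply: dQ; rewrite ler_norml ltr0_norm; lra.
- by move=> x xab; apply: bP; rewrite ler_norml ltr0_norm; lra.
Qed.

(** The primitive is the integral along a horizontal and then a vertical
    segment. By the vanishing of integrals around rectangles the two segments
    may be taken in the other order as well, so both partial derivatives are
    known and the function is complex differentiable. *)
Lemma strip_primitive (J : set R) (F : C -> C) : open_interval J ->
  (forall z, J (Re z) -> holo F z) ->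
  exists G : C -> C, forall z, J (Re z) -> cderiv G z (F z).
Proof.
move=> oJ nF.
have ptx y x : {for x, continuous (fun t => pt t y)}.
  apply/cts_Rplane => e e0; exists e => // t te.
  by apply: le_lt_trans te; rewrite (le_trans (cabs_ptB _ _ _ _)) // subrr normr0 addr0.
have pty x y : {for y, continuous (fun t => pt x t)}.
  apply/cts_Rplane => e e0; exists e => // t te.
  by apply: le_lt_trans te; rewrite (le_trans (cabs_ptB _ _ _ _)) // subrr normr0 add0r.
have cF x y : J x -> {for pt x y, continuous F}.
  by move=> Jx; have [] := nF (pt x y); rewrite ?Re_pt.
have /choice[H dH] : forall y, exists P, forall x, J x -> rderiv P x (F (pt x y)).
  move=> y; apply: (@curve_primitive _ _ (fun t => F (pt t y))) => // x Jx.
  by apply: continuous_comp; [exact: ptx|exact: cF].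
have /choice[V dV] : forall x, exists P, J x -> forall y, rderiv P y (F (pt x y)).
  move=> x; have [Jx|nJ] := pselect (J x); last by exists (fun=> 0) => /nJ.
  have [||P hP] := @curve_primitive _ setT (fun t => F (pt x t)).
  - by split=> // t _; exists 1.
  - by move=> y _; apply: continuous_comp; [exact: pty|exact: cF].
  - by exists P => _ y; exact: hP.
have dV' x y : J x -> rderiv (V x) y (F (pt x y)) by move=> /dV; apply.
have R0 := rect_int_eq0 (oJ) dH dV' _ _ nF.
exists (fun z => H 0 (Re z) + 'i * (V (Re z) (Im z) - V (Re z) 0)).
move=> z Jz e e0.
have [cz _] := nF z Jz.
have e2 : 0 < e / 2 by lra.
move/cts_plane: cz => /(_ _ e2)[d d0 hd].
have [d' d'0 hd'] := oJ.1 _ Jz.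
exists (Num.min d d'); first by rewrite lt_min d0.
move=> h; rewrite lt_min => /andP[hhd hhd'].
rewrite ReD ImD; set x := Re z in Jz hd' *; set y := Im z.
have rh := Re_le_cabs h; have ih := Im_le_cabs h.
have Jx' : J (x + Re h) by apply: hd'; rewrite addrC addKr; apply: le_lt_trans hhd'.
have := R0 x (x + Re h) 0 y Jz Jx'.
set x' := x + Re h; rewrite /rect_int => r0.
have -> : H 0 x' + 'i * (V x' (y + Im h) - V x' 0) - (H 0 x + 'i * (V x y - V x 0))
   - F z * h = (H y x' - H y x - F z * (x' - x)%:C)
   + 'i * (V x' (y + Im h) - V x' y - F z * (y + Im h - y)%:C).
  have -> : (x' - x) = Re h by rewrite /x'; ring.
  have -> : (y + Im h - y) = Im h by ring.
  have -> : F z * h = F z * (Re h)%:C + 'i * (F z * (Im h)%:C).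
    by rewrite -[h in LHS]ptE /pt; ring.
  by apply/eqP; rewrite -subr_eq0 -r0; apply/eqP; ring.
apply: le_trans (cabs_triangle _ _) _; rewrite cabsM cabsi mul1r.
have -> : e * cabs h = e / 2 * cabs h + e / 2 * cabs h by lra.
apply: lerD.
  apply: (@le_trans _ _ (e / 2 * `|x' - x|)); last first.
    by rewrite ler_pM2l // /x' addrC addKr.
  have xx t : `|t - x| <= `|x' - x| -> `|t - x| <= cabs h.
    by move=> /le_trans; apply; rewrite /x' addrC addKr.
  apply: (curve_mvt_ball (p := fun t => F (pt t y))) => t /xx tx.
    by apply: dH; apply: hd'; apply: le_lt_trans hhd'.
  apply/ltW/hd; rewrite -[z]ptE; apply: le_lt_trans (cabs_ptB _ _ _ _) _.
  by rewrite subrr normr0 addr0; apply: le_lt_trans hhd.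
apply: (@le_trans _ _ (e / 2 * `|y + Im h - y|)); last first.
  by rewrite ler_pM2l // addrC addKr.
have yy t : `|t - y| <= `|y + Im h - y| -> `|t - y| <= `|Im h|.
  by move=> /le_trans; apply; rewrite addrC addKr.
apply: (curve_mvt_ball (p := fun t => F (pt x' t))) => t /yy ty; first exact: dV'.
apply/ltW/hd; apply: le_lt_trans hhd.
have -> : pt x' t - z = pt (Re h) (t - y).
  by rewrite -[z in LHS]ptE /pt /x' rmorphD rmorphB /=; ring.
by rewrite !cabsE !(Re_pt, Im_pt) ler_wsqrtr // lerD2l -real_normK ?num_real //
   -[leRHS]real_normK ?num_real // lerXn2r ?nnegrE.
Qed.

End Goursat.

(** * Mean values over circles and Cauchy's formula *)

Section Cauchy.
Variable R : realType.
Local Notation C := (plane R).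
Implicit Types (z w b c : C) (f g : C -> C).

Lemma cderiv_isolated f z l : cderiv f z l -> l != 0 ->
  exists2 e : R, 0 < e & forall w, w != z -> cabs (w - z) < e -> f w != f z.
Proof.
move=> df l0; have l1 : 0 < cabs l by rewrite cabs_gt0.
have l2 : 0 < cabs l / 2 by lra.
have [d d0 hd] := df _ l2; exists d => // w wz /hd.
rewrite [z + _]addrC subrK => h; apply/negP => /eqP fwz.
have w0 : 0 < cabs (w - z) by rewrite cabs_gt0 subr_eq0.
move: h; rewrite fwz subrr sub0r cabsN cabsM ler_pM2r //; lra.
Qed.

Lemma cts_comp (u f : C -> C) z : {for z, continuous u} ->
  {for u z, continuous f} -> {for z, continuous (fun w => f (u w))}.
Proof.
move=> /cts_plane cu /cts_plane cf; apply/cts_plane => e /cf[d /cu[k k0 hk] hd].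
by exists k => // w /hk /hd.
Qed.

Lemma cts_ext f g z : f =1 g -> {for z, continuous f} -> {for z, continuous g}.
Proof. by move=> /funext ->. Qed.

Lemma holo_near f g z : holo f z ->
  (exists2 e : R, 0 < e & forall w, cabs (w - z) < e -> f w = g w) -> holo g z.
Proof.
move=> [/cts_plane cf [e e0 he]] [d d0 hd]; split.
  apply/cts_plane => n /cf[k k0 hk]; exists (Num.min k d); first by rewrite lt_min k0.
  move=> w; rewrite lt_min => /andP[/hk h1 /hd <-].
  by rewrite -hd // subrr cabs0.
exists (Num.min e d); first by rewrite lt_min e0.
move=> w wz; rewrite lt_min => /andP[we wd].
have [l hl] := he _ wz we; exists l; apply: cderiv_near hl.
apply/near_plane; exists (d - cabs (w - z)); first by rewrite subr_gt0.
move=> u; rewrite ltrBrDr => /(le_lt_trans (cabs_trianB u w z)); exact: hd.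
Qed.

Lemma holo_ext f g z : f =1 g -> holo f z -> holo g z.
Proof. by move=> /funext ->. Qed.

Lemma holo_of_derivable f z :
  (exists2 e : R, 0 < e & forall w, cabs (w - z) < e -> exists l, cderiv f w l) ->
  holo f z.
Proof.
move=> [e e0 he]; split; last by exists e => // w _; exact: he.
have [|l hl] := he z; first by rewrite subrr cabs0.
exact: cderiv_cts hl.
Qed.

Lemma holo_cst (k : C) z : holo (fun=> k) z.
Proof.
by apply: holo_of_derivable; exists 1 => // w _; exists 0; exact: cderiv_cst.
Qed.

Lemma holo_id z : holo id z.
Proof.
by apply: holo_of_derivable; exists 1 => // w _; exists 1; exact: cderiv_id.
Qed.

Lemma holo2 (op : C -> C -> C) f g z :
  {for z, continuous (fun w => op (f w) (g w))} ->
  (forall w l m, cderiv f w l -> cderiv g w m ->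
     exists k, cderiv (fun w => op (f w) (g w)) w k) ->
  holo f z -> holo g z -> holo (fun w => op (f w) (g w)) z.
Proof.
move=> cop dop [_ [e e0 he]] [_ [d d0 hd]]; split => //.
exists (Num.min e d); first by rewrite lt_min e0.
move=> w wz; rewrite lt_min => /andP[/(he _ wz)[l hl] /(hd _ wz)[m hm]].
exact: dop hl hm.
Qed.

Lemma holoD f g z : holo f z -> holo g z -> holo (fun w => f w + g w) z.
Proof.
move=> hf hg; apply: (holo2 (op := fun x y => x + y)) => //.
  by apply: continuousD; [case: hf|case: hg].
by move=> w l m hl hm; exists (l + m); exact: cderivD.
Qed.

Lemma holoM f g z : holo f z -> holo g z -> holo (fun w => f w * g w) z.
Proof.
move=> hf hg; apply: (holo2 (op := fun x y => x * y)) => //.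
  by apply: continuousM; [case: hf|case: hg].
by move=> w l m hl hm; eexists; exact: cderivM hl hm.
Qed.

Lemma holoZ (k : C) f z : holo f z -> holo (fun w => k * f w) z.
Proof. by move=> hf; apply: holoM => //; exact: holo_cst. Qed.

Lemma holoN f z : holo f z -> holo (fun w => - f w) z.
Proof. by move=> /(holoZ (-1)); apply: holo_ext => w; rewrite mulN1r. Qed.

Lemma holoB f g z : holo f z -> holo g z -> holo (fun w => f w - g w) z.
Proof. by move=> hf hg; exact: holoD hf (holoN hg). Qed.

Lemma cts_neq0 f z : {for z, continuous f} -> f z != 0 ->
  exists2 e : R, 0 < e & forall w, cabs (w - z) < e -> f w != 0.
Proof.
move=> /cts_plane cf fz; have /cf[e e0 he] : 0 < cabs (f z) by rewrite cabs_gt0.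
exists e => // w /he h; apply/negP => /eqP fw.
by move: h; rewrite fw sub0r cabsN ltxx.
Qed.

Lemma holoV f z : f z != 0 -> holo f z -> holo (fun w => (f w)^-1) z.
Proof.
move=> fz [cf [e e0 he]]; split; first exact: continuousV.
have [d d0 hd] := cts_neq0 cf fz.
exists (Num.min e d); first by rewrite lt_min e0.
move=> w wz; rewrite lt_min => /andP[/(he _ wz)[l hl] /hd fw].
by eexists; exact: cderivV hl.
Qed.

Lemma holoF f g z : g z != 0 -> holo f z -> holo g z -> holo (fun w => f w / g w) z.
Proof. by move=> gz hf hg; apply: holoM => //; exact: holoV. Qed.

(** As [cexp] is locally injective, it pulls an isolated exceptional point back
    to an isolated one. *)
Lemma holo_comp_cexp f c z : holo f (c + cexp z) -> holo (fun u => f (c + cexp u)) z.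
Proof.
have dc : forall u, cderiv (fun u : C => c + cexp u) u (cexp u).
  move=> u; apply: cderiv_eq (cderivD (cderiv_cst c u) (cderiv_cexp u)) _.
  by rewrite add0r.
move=> [cf [e e0 he]]; split.
  exact: cts_comp (cderiv_cts (dc z)) cf.
have /cts_plane /(_ _ e0)[d d0 hd] := cderiv_cts (dc z).
have [k k0 hk] := cderiv_isolated (dc z) (cexp_neq0 z).
exists (Num.min d k); first by rewrite lt_min d0.
move=> w wz; rewrite lt_min => /andP[/hd h1 /(hk _ wz) h2].
have [l hl] := he _ h2 h1.
by eexists; exact: cderiv_comp (dc w) hl.
Qed.

Lemma radii_interval (r s : R) : open_interval [set x | r < expR x < s].
Proof.
split=> [x /= /andP[h1 h2]|x y t /= /andP[h1 h2] /andP[h3 h4] /andP[h5 h6]].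
  have /near_real[e e0 he] : \forall y \near x, r < expR y.
    exact: cvgr_gt (@continuous_expR R x) _ h1.
  have /near_real[d d0 hd] : \forall y \near x, expR y < s.
    exact: cvgr_lt (@continuous_expR R x) _ h2.
  exists (Num.min e d); first by rewrite lt_min e0.
  by move=> y; rewrite lt_min => /andP[/he -> /hd ->].
rewrite (lt_le_trans h1) ?ler_expR //=.
by rewrite (le_lt_trans _ h4) ?ler_expR.
Qed.

(** The mean value of [f] over the circles with centre [c] and radius
    between [r] and [s]: it is the increment over one period, divided by the
    period, of a primitive of [f (c + cexp z)] on a strip. The radius being free, the
    definition includes the invariance of the mean under deformation. *)
Definition cmean c (r s : R) f (m : C) := exists G : C -> C, forall z,
  r < expR (Re z) < s -> cderiv G z (f (c + cexp z)) /\ G (z + tpi R) = G z + tpi R * m.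

Lemma cabs_cexpc c z : cabs (c + cexp z - c) = expR (Re z).
Proof. by rewrite addrC addKr cabs_cexp. Qed.

Lemma strip_cst (r s : R) (D : C -> C) z w :
  (forall u, r < expR (Re u) < s -> cderiv D u 0) ->
  r < expR (Re z) < s -> r < expR (Re w) < s -> D z = D w.
Proof.
move=> dD hz hw; apply/eqP.
rewrite -subr_eq0 -cabs_eq0 eq_le cabs_ge0 andbT -(mul0r (cabs (z - w))).
have [_ iJ] := radii_interval r s.
apply: (segment_mvt (G' := fun=> 0)) => t /andP[t0 t1]; last by rewrite cabs0.
apply: dD; rewrite !ReImE mul0r subr0.
have [zx|zx] := leP (Re w) (Re z).
  apply: (iJ (Re w) (Re z)) => //; rewrite lerDl mulr_ge0 ?subr_ge0 //=.
  by rewrite -lerBrDl ler_piMl ?subr_ge0.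
apply: (iJ (Re z) (Re w)) => //; rewrite gerDl -opprB mulrN oppr_le0.
rewrite mulr_ge0 ?subr_ge0 ?(ltW zx) // andbT lerBrDl -lerBrDr.
by rewrite ler_piMl // subr_ge0 ltW.
Qed.

(** The increment of a primitive over a period has derivative 0. *)
Lemma cmean_ex c r s f :
  (forall z, r < cabs (z - c) < s -> holo f z) -> exists m, cmean c r s f m.
Proof.
move=> nf.
have [||G hG] := @strip_primitive _ [set x | r < expR x < s] (fun z => f (c + cexp z)).
- exact: radii_interval.
- by move=> z /= hz; apply/holo_comp_cexp/nf; rewrite cabs_cexpc.
have [[x0 /= hx0]|nJ] := pselect ([set x | r < expR x < s] !=set0); last first.
  by exists 0, G => z hz; exfalso; apply: nJ; exists (Re z).
pose D z := G (z + tpi R) - G z.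
exists (D x0%:C / tpi R), G => z hz; split; first exact: hG.
rewrite mulrC divfK ?tpi_neq0 //.
suff -> : D x0%:C = D z by rewrite /D [G z + _]addrC subrK.
apply: strip_cst hz => // u hu; apply: cderiv_eq.
  apply: cderivB (hG _ hu).
  apply: (@cderiv_comp _ (fun u => u + tpi R) G _ (1 + 0)).
    by apply: cderivD; [exact: cderiv_id|exact: cderiv_cst].
  by apply: hG => /=; rewrite !(Re_tpi, ReImE) addr0.
by rewrite /= cexp_period addr0 mulr1 subrr.
Qed.

Lemma cmean_bound c r s f m (rho B : R) : cmean c r s f m ->
  0 < rho -> r < rho < s ->
  (forall z, cabs (z - c) = rho -> cabs (f z) <= B) -> cabs m <= B.
Proof.
move=> [G hG] rho0 hrho hf.
pose z0 : C := (ln rho)%:C.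
have e0 t : expR (Re (z0 + t%:C * (z0 + tpi R - z0))) = rho.
  rewrite [z0 + tpi R]addrC addrK !(Re_tpi, Im_tpi, ReImE) !mul0r mulr0 subr0 addr0.
  by rewrite lnK.
have := @segment_mvt _ G (fun z => f (c + cexp z)) z0 (z0 + tpi R) B.
have [_ ->] : cderiv G z0 (f (c + cexp z0)) /\ G (z0 + tpi R) = G z0 + tpi R * m.
  by apply: hG; rewrite ReC lnK.
rewrite [G z0 + _]addrC addrK [z0 + tpi R]addrC addrK cabsM.
rewrite mulrC ler_pM2r ?cabs_gt0 ?tpi_neq0 //; apply.
  move=> t _; have := e0 t; rewrite [z0 + tpi R]addrC addrK => et.
  by have [|] := hG (z0 + t%:C * tpi R); first by rewrite et.
move=> t _; have := e0 t; rewrite [z0 + tpi R]addrC addrK => et.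
by apply: hf; rewrite cabs_cexpc et.
Qed.

Lemma cmeanD c r s f g m n : cmean c r s f m -> cmean c r s g n ->
  cmean c r s (fun z => f z + g z) (m + n).
Proof.
move=> [G hG] [H hH]; exists (fun z => G z + H z) => z hz.
have [d1 e1] := hG _ hz; have [d2 e2] := hH _ hz; split; first exact: cderivD.
by rewrite e1 e2; ring.
Qed.

Lemma cmeanZ c r s f k m : cmean c r s f m -> cmean c r s (fun z => k * f z) (k * m).
Proof.
move=> [G hG]; exists (fun z => k * G z) => z hz.
have [d1 e1] := hG _ hz; split; first exact: cderivZ.
by rewrite e1; ring.
Qed.

Lemma cmeanB c r s f g m n : cmean c r s f m -> cmean c r s g n ->
  cmean c r s (fun z => f z - g z) (m - n).
Proof.
move=> [G hG] [H hH]; exists (fun z => G z - H z) => z hz.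
have [d1 e1] := hG _ hz; have [d2 e2] := hH _ hz; split; first exact: cderivB.
by rewrite e1 e2; ring.
Qed.

Lemma cmean_cst c r s k : cmean c r s (fun=> k) k.
Proof.
exists (fun z => k * z) => z _; split; last by ring.
by apply: cderiv_eq (cderivZ k (cderiv_id z)) _; rewrite mulr1.
Qed.

Lemma cmean_sub c r s r' s' f m : cmean c r s f m -> r <= r' -> s' <= s ->
  cmean c r' s' f m.
Proof.
move=> [G hG] rr ss; exists G => z /andP[h1 h2]; apply: hG.
by rewrite (le_lt_trans rr h1) (lt_le_trans h2 ss).
Qed.

Lemma cmean_eq c r s f g m : cmean c r s f m ->
  (forall z, r < cabs (z - c) < s -> f z = g z) -> cmean c r s g m.
Proof.
move=> [G hG] fg; exists G => z hz; rewrite -fg; first exact: hG.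
by rewrite cabs_cexpc.
Qed.

Lemma cmean_uniq c r s f m n rho : 0 < rho -> r < rho < s ->
  cmean c r s f m -> cmean c r s f n -> m = n.
Proof.
move=> rho0 hrho hm hn; apply/eqP; rewrite -subr_eq0 -cabs_eq0 eq_le cabs_ge0 andbT.
by apply: (cmean_bound (cmeanB hm hn) rho0 hrho) => z _; rewrite subrr cabs0.
Qed.

(** The function [k (c + cexp z)] is a periodic primitive. *)
Lemma cmean_exact c r s (k k' : C -> C) :
  (forall z, r < cabs (z - c) < s -> cderiv k z (k' z)) ->
  cmean c r s (fun z => (z - c) * k' z) 0.
Proof.
move=> dk; exists (fun z => k (c + cexp z)) => z hz.
rewrite cexp_period mulr0 addr0; split=> //.
apply: cderiv_eq.
  apply: (@cderiv_comp _ (fun u => c + cexp u) k).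
    exact: cderivD (cderiv_cst c z) (cderiv_cexp z).
  by apply: dk; rewrite cabs_cexpc.
by rewrite add0r mulrC [c + _]addrC addrK.
Qed.

(** The circles may be shrunk to [c]. *)
Lemma cmean_center c s f m : 0 < s ->
  {for c, continuous f} -> cmean c 0 s f m -> m = f c.
Proof.
move=> s0 /cts_plane cf hm.
apply/eqP; rewrite -subr_eq0 -cabs_eq0 eq_le cabs_ge0 andbT leNgt; apply/negP => h.
have h2 : 0 < cabs (m - f c) / 2 by lra.
have [d d0 hd] := cf _ h2.
have [rho [rho0 rhos rhod]] : exists rho : R, [/\ 0 < rho, rho < s & rho < d].
  have mm : 0 < Num.min s d by rewrite lt_min s0.
  exists (Num.min s d / 2); split; first by lra.
  - by apply: (@lt_le_trans _ _ (Num.min s d)); [lra|rewrite ge_min lexx].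
  - by apply: (@lt_le_trans _ _ (Num.min s d)); [lra|rewrite ge_min lexx orbT].
have := cmean_bound (B := cabs (m - f c) / 2) (cmeanB hm (cmean_cst c 0 s (f c))) rho0.
rewrite rho0 rhos => /(_ isT); suff H : forall z, cabs (z - c) = rho ->
   cabs (f z - f c) <= cabs (m - f c) / 2 by move=> /(_ H); lra.
by move=> z zr; apply/ltW/hd; rewrite zr.
Qed.

(** Write [(z - c) / (z - b) = 1 + (b - c) / (z - b)]; the mean of the second
    term is seen to vanish by letting the radius tend to infinity. *)
Lemma cmean_kernel c b s : cabs (b - c) < s ->
  cmean c (cabs (b - c)) s (fun z => (z - c) / (z - b)) 1.
Proof.
move=> bs; set r := cabs (b - c) in bs *.
have r0 : 0 <= r := cabs_ge0 _.
have nb S z : r < cabs (z - c) < S -> z != b.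
  by move=> /andP[h _]; apply/negP => /eqP zb; move: h; rewrite zb ltxx.
have ex S : exists m, cmean c r S (fun z => (b - c) / (z - b)) m.
  apply: cmean_ex => z hz; apply: holoF.
  - by rewrite subr_eq0; apply: nb hz.
  - exact: holo_cst.
  - by apply: holoB; [exact: holo_id|exact: holo_cst].
have [m hm] := ex s.
suff m0 : m = 0.
  have := cmeanD (cmean_cst c r s 1) hm; rewrite m0 addr0 => /cmean_eq; apply.
  by move=> z /nb; rewrite -subr_eq0 => zb; field.
apply/eqP; rewrite -cabs_eq0 eq_le cabs_ge0 andbT leNgt; apply/negP => c0.
pose rho := s + r + r / cabs m.
have q0 : 0 <= r / cabs m by rewrite divr_ge0 // ltW.
have [n hn] := ex (rho + 1).
have nm : n = m.
  have h1 : 0 < (r + s) / 2 by lra.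
  have h2 : r < (r + s) / 2 < s by lra.
  apply: (cmean_uniq h1 h2 _ hm); apply: cmean_sub hn _ _ => //.
  by rewrite /rho; lra.
have rho0 : 0 < rho by rewrite /rho; lra.
have rr : r < rho < rho + 1 by rewrite /rho; lra.
have rhor : 0 < rho - r by lra.
have := cmean_bound (B := r / (rho - r)) hn rho0 rr.
suff H : forall z, cabs (z - c) = rho -> cabs ((b - c) / (z - b)) <= r / (rho - r).
  move=> /(_ H); rewrite nm ler_pdivlMr //; apply/negP; rewrite -ltNge.
  have -> : rho - r = s + r / cabs m by rewrite /rho; ring.
  rewrite mulrDr [_ * (r / _)]mulrC divfK ?gt_eqF //.
  have := mulr_gt0 c0 (le_lt_trans r0 bs); lra.
move=> z zr; rewrite cabs_div.
rewrite ler_wpM2l ?cabs_ge0 // lef_pV2 ?posrE //.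
  by rewrite -zr; have := cabs_trianB z b c; rewrite -/r; lra.
by have := cabs_trianB z b c; rewrite -/r zr; lra.
Qed.

(** [(z - c) * (f z - f b) / (z - b)] is continuous at [b], so it has a mean over
    all circles around [c], and shrinking them shows that it is its value at
    [c], which is 0. The exceptional point of [f] may be [c] itself. *)
Lemma cauchy_formula c s f b : (forall z, cabs (z - c) < s -> holo f z) ->
  cabs (b - c) < s -> b = c \/ (exists l, cderiv f b l) ->
  cmean c (cabs (b - c)) s (fun z => (z - c) * f z / (z - b)) (f b).
Proof.
move=> nf bs hb.
have s0 : 0 < s by apply: le_lt_trans bs; exact: cabs_ge0.
have [bc|bc] := eqVneq b c.
  rewrite bc subrr cabs0.
  have [m hm] : exists m, cmean c 0 s f m.
    by apply: cmean_ex => z /andP[_]; exact: nf.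
  have -> : f c = m.
    by apply/esym/(cmean_center s0 _ hm); have [] := nf c; rewrite ?subrr ?cabs0.
  apply: cmean_eq hm _ => z /andP[z0 _].
  by rewrite mulrC mulKf // -cabs_gt0.
case: hb => [/eqP|[l dl]]; first by rewrite (negbTE bc).
pose g z := if z == b then (b - c) * l else (z - c) * ((f z - f b) / (z - b)).
have ng z : cabs (z - c) < s -> holo g z.
  move=> zs; have [->|zb] := eqVneq z b; last first.
    apply: (@holo_near (fun z => (z - c) * ((f z - f b) / (z - b)))).
      apply: holoM; first by apply: holoB; [exact: holo_id|exact: holo_cst].
      apply: holoF; first by rewrite subr_eq0.
        by apply: holoB; [exact: nf|exact: holo_cst].
      by apply: holoB; [exact: holo_id|exact: holo_cst].
    exists (cabs (z - b)); first by rewrite cabs_gt0 subr_eq0.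
    move=> w wz; rewrite /g; case: eqVneq => // wb.
    by move: wz; rewrite wb cabsB ltxx.
  have nk w : holo (fun w => w - c) w by apply: holoB; [exact: holo_id|exact: holo_cst].
  split.
    apply: (@cts_ext (fun z => (z - c) * (if z == b then l else (f z - f b) / (z - b)))).
      by move=> w; rewrite /g; case: eqVneq => // ->.
    apply: continuousM; first by case: (nk b).
    apply/cts_plane => e e0; have e2 : 0 < e / 2 by lra.
    have [d d0 hd] := dl _ e2; exists d => // w /hd.
    rewrite [b + _]addrC subrK eqxx; case: eqVneq => [_ _|wb h].
      by rewrite subrr cabs0.
    have wb0 : 0 < cabs (w - b) by rewrite cabs_gt0 subr_eq0.
    have -> : (f w - f b) / (w - b) - l = (f w - f b - l * (w - b)) / (w - b).
      by field; rewrite subr_eq0.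
    rewrite cabs_div ltr_pdivrMr //; apply: le_lt_trans h _.
    by rewrite ltr_pM2r //; lra.
  have [_ [e e0 he]] := nf b bs.
  exists e => // w wb we; have [m hm] := he w wb we.
  have wb' : w - b != 0 by rewrite subr_eq0.
  eexists; apply: (@cderiv_near _ (fun z => (z - c) * ((f z - f b) / (z - b)))).
    apply/near_plane; exists (cabs (w - b)); first by rewrite cabs_gt0.
    move=> u uw; rewrite /g; case: eqVneq => // ub.
    by move: uw; rewrite ub cabsB ltxx.
  apply: cderivM; first exact: cderivB (cderiv_id w) (cderiv_cst c w).
  apply: cderivM; first exact: cderivB hm (cderiv_cst (f b) w).
  exact: (@cderivV _ (fun w0 => w0 - b)) wb' (cderivB (cderiv_id w) (cderiv_cst b w)).
have [m hm] : exists m, cmean c 0 s g m.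
  by apply: cmean_ex => z /andP[_]; exact: ng.
have m0 : m = 0.
  have cg : {for c, continuous g} by have [] := ng c; rewrite ?subrr ?cabs0.
  rewrite (cmean_center s0 cg hm) /g eq_sym (negbTE bc).
  by rewrite subrr mul0r.
rewrite m0 in hm.
have := cmeanD (cmean_sub hm (cabs_ge0 (b - c)) (lexx s)) (cmeanZ (f b) (cmean_kernel bs)).
rewrite add0r mulr1 => /cmean_eq; apply => z /andP[zb _].
rewrite /g; case: eqVneq => [zb'|zb']; first by rewrite zb' ltxx in zb.
by field; rewrite subr_eq0.
Qed.

End Cauchy.

(** * Removable singularities and derivatives *)

Section Analytic.
Variable R : realType.
Local Notation C := (plane R).
Implicit Types (z w b c : C) (f g : C -> C).

(** Locked, to keep the limit that defines a derivative out of conversion. *)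
Definition cder : (C -> C) -> C -> C := locked (fun f z => 'D_1 f z).

Lemma cderE f z l : cderiv f z l -> cder f z = l.
Proof. by rewrite /cder -lock => /cderivE. Qed.

Lemma holo_ball f c : holo f c -> exists e B : R, [/\ 0 < e, 0 < B &
  forall w, cabs (w - c) < e -> [/\ holo f w, cabs (f w) <= B &
    w = c \/ (exists l, cderiv f w l)]].
Proof.
move=> nf; have [/cts_plane /(_ _ ltr01)[d d0 hd] [e e0 he]] := nf.
exists (Num.min e d), (1 + cabs (f c)); split.
- by rewrite lt_min e0.
- by have := cabs_ge0 (f c); lra.
move=> w; rewrite lt_min => /andP[we wd]; split.
- have [->//|wc] := eqVneq w c.
  have wc0 : 0 < cabs (w - c) by rewrite cabs_gt0 subr_eq0.
  apply: holo_of_derivable.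
  exists (Num.min (cabs (w - c)) (e - cabs (w - c))); first by rewrite lt_min wc0 subr_gt0.
  move=> u; rewrite lt_min ltrBrDr => /andP[u1 u2]; apply: he.
    by apply/negP => /eqP uc; move: u1; rewrite uc cabsB ltxx.
  exact: le_lt_trans (cabs_trianB u w c) u2.
- have := hd _ wd; have := cabs_dist (f w) (f c); lra.
- by have [->|wc] := eqVneq w c; [left|right; exact: he].
Qed.

(** Removable singularity. Cauchy's formula holds with [c] as an exceptional
    point, and expanding the kernel to first order in [h] gives [f (c + h)] up
    to O(h^2). *)
Lemma holo_derivable f c : holo f c -> exists l, cderiv f c l.
Proof.
move=> nf; have [e [B [e0 B0 hB]]] := holo_ball nf.
have nf' z : cabs (z - c) < e -> holo f z by move=> /hB[].
have [l hl] : exists l, cmean c 0 e (fun z => f z / (z - c)) l.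
  apply: cmean_ex => z /andP[z0 ze]; apply: holoF (nf' _ ze) _.
    by rewrite -cabs_gt0.
  by apply: holoB; [exact: holo_id|exact: holo_cst].
exists l => n n0.
have M0 : 0 < 8 * B / e ^+ 2 by rewrite divr_gt0 ?exprn_gt0 // mulr_gt0.
exists (Num.min (e / 4) (n / (8 * B / e ^+ 2))).
  by rewrite lt_min (divr_gt0 n0 M0) andbT; lra.
move=> h; rewrite lt_min (ltr_pdivlMr _ _ M0) => /andP[he hn].
have [h0|h0] := eqVneq h 0.
  by rewrite h0 addr0 subrr mulr0 subr0 cabs0 mulr0.
have ech : cabs (c + h - c) = cabs h by rewrite addrC addKr.
have hE : cabs (c + h - c) < e by rewrite ech; lra.
have [_ _ hd] := hB _ hE.
have h1 := cauchy_formula nf' hE hd; rewrite ech in h1.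
have [m0 hm0] : exists m, cmean c 0 e f m.
  by apply: cmean_ex => z /andP[_]; exact: nf'.
have m0E : m0 = f c.
  by apply: (cmean_center e0 _ hm0); case: nf.
have hm := cmeanB (cmeanB h1 (cmean_sub hm0 (cabs_ge0 h) (lexx e)))
  (cmeanZ h (cmean_sub hl (cabs_ge0 h) (lexx e))).
rewrite m0E [h * l]mulrC in hm.
have e20 : 0 < e / 2 by lra.
have he2 : cabs h < e / 2 < e by lra.
apply: le_trans (cmean_bound (B := (8 * B / e ^+ 2) * cabs h * cabs h) hm e20 he2 _) _; last first.
  by apply: ler_wpM2r; [exact: cabs_ge0|rewrite [leLHS]mulrC; exact: ltW].
move=> z zc.
have zc0 : z - c != 0 by rewrite -cabs_gt0 zc.
have zch : e / 4 <= cabs (z - (c + h)).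
  by have := cabs_trianB z (c + h) c; rewrite ech zc; lra.
have zch0 : z - (c + h) != 0 by rewrite -cabs_gt0; lra.
have -> : (z - c) * f z / (z - (c + h)) - f z - h * (f z / (z - c)) =
   f z * h * h / ((z - (c + h)) * (z - c)).
  by field; rewrite zc0.
rewrite cabs_div !cabsM zc.
have fB : cabs (f z) <= B by have [|_ ->//] := hB z; rewrite zc; lra.
have c0 := cabs_ge0 h.
have p0 : 0 < cabs (z - (c + h)) * (e / 2) by rewrite mulr_gt0 // cabs_gt0.
rewrite ler_pdivrMr //.
have -> : 8 * B / e ^+ 2 * cabs h * cabs h * (cabs (z - (c + h)) * (e / 2)) =
  B * cabs h * cabs h * (cabs (z - (c + h)) * (4 / e)).
  by field; lra.
apply: (@le_trans _ _ (B * cabs h * cabs h)); first by rewrite !ler_wpM2r.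
rewrite ler_peMr ?mulr_ge0 ?(ltW B0) //.
by rewrite mulrA ler_pdivlMr // mul1r; lra.
Qed.

Lemma cderiv_cder f c : holo f c -> cderiv f c (cder f c).
Proof. by move=> /holo_derivable[l hl]; rewrite (cderE hl). Qed.

Lemma holo_disc f c : holo f c -> exists e B : R, [/\ 0 < e, 0 < B &
  forall w, cabs (w - c) < e -> holo f w /\ cabs (f w) <= B].
Proof. by move=> /holo_ball[e [B [e0 B0 h]]]; exists e, B; split=> // w /h[]. Qed.

Lemma cauchy c s f b : (forall z, cabs (z - c) < s -> holo f z) ->
  cabs (b - c) < s ->
  cmean c (cabs (b - c)) s (fun z => (z - c) * f z / (z - b)) (f b).
Proof.
by move=> nf bs; apply: cauchy_formula => //; right; apply/holo_derivable/nf.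
Qed.

Lemma holo_subr c z : holo (fun w => w - c) z.
Proof. by apply: holoB; [exact: holo_id|exact: holo_cst]. Qed.

(** The divided difference of [f] at [c], extended across [c]; it is analytic
    there by continuity. *)
Definition dquot f c z := if z == c then cder f c else (f z - f c) / (z - c).

Lemma dquotE f c z : f z = f c + (z - c) * dquot f c z.
Proof.
rewrite /dquot; case: eqVneq => [->|zc]; first by rewrite subrr mul0r addr0.
by field; rewrite subr_eq0.
Qed.

Lemma holo_dquot f c z : holo f c -> holo f z -> holo (dquot f c) z.
Proof.
move=> nc nz; have [->|zc] := eqVneq z c; last first.
  apply: (@holo_near _ (fun z => (f z - f c) / (z - c))).
    by apply: holoF (holo_subr _ _); rewrite ?subr_eq0 //; apply: holoB (holo_cst _ _).
  exists (cabs (z - c)); first by rewrite cabs_gt0 subr_eq0.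
  move=> w wz; rewrite /dquot; case: eqVneq => // wc.
  by move: wz; rewrite wc cabsB ltxx.
split.
  apply/cts_plane => e e0; have e2 : 0 < e / 2 by lra.
  have [d d0 hd] := cderiv_cder nc e2; exists d => // w /hd.
  rewrite [c + _]addrC subrK /dquot eqxx; case: eqVneq => [_ _|wb h].
    by rewrite subrr cabs0.
  have wb0 : 0 < cabs (w - c) by rewrite cabs_gt0 subr_eq0.
  have -> : (f w - f c) / (w - c) - cder f c = (f w - f c - cder f c * (w - c)) / (w - c).
    by field; rewrite subr_eq0.
  rewrite cabs_div ltr_pdivrMr //; apply: le_lt_trans h _.
  by rewrite ltr_pM2r //; lra.
have [e [B [e0 B0 he]]] := holo_disc nc.
exists e => // w wb /he[nw _].
have wb' : w - c != 0 by rewrite subr_eq0.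
eexists; apply: (@cderiv_near _ (fun z => (f z - f c) / (z - c))).
  apply/near_plane; exists (cabs (w - c)); first by rewrite cabs_gt0.
  move=> u uw; rewrite /dquot; case: eqVneq => // ub.
  by move: uw; rewrite ub cabsB ltxx.
apply: cderivM; first exact: cderivB (cderiv_cder nw) (cderiv_cst (f c) w).
exact: (@cderivV _ (fun w0 => w0 - c)) wb' (cderivB (cderiv_id w) (cderiv_cst c w)).
Qed.

(** Cauchy's formula for the divided difference at [b]; the extra term
    [f b * (z - c) / (z - b) ^+ 2] is exact. *)
Lemma cder_mean c e f b : (forall z, cabs (z - c) < e -> holo f z) ->
  cabs (b - c) < e ->
  cmean c (cabs (b - c)) e (fun z => (z - c) * f z / (z - b) ^+ 2) (cder f b).
Proof.
move=> nf be.
have nb : holo f b by exact: nf.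
have h : forall z, cabs (z - c) < e -> holo (dquot f b) z.
  by move=> z /nf; exact: holo_dquot.
have := cauchy h be; rewrite {2}/dquot eqxx => hq.
have [m hm] : exists m, cmean c (cabs (b - c)) e (fun z => (z - c) / (z - b) ^+ 2) m.
  apply: cmean_ex => z /andP[zb _].
  have zb0 : z - b != 0.
    by apply/negP; rewrite subr_eq0 => /eqP zb'; move: zb; rewrite zb' ltxx.
  apply: holoF (holo_subr _ _) _; first by rewrite expf_neq0.
  apply: holo_ext (holoM (holo_subr b z) (holo_subr b z)) => w.
  by rewrite expr2.
have m0 : m = 0.
  have ex := @cmean_exact _ c (cabs (b - c)) e (fun z => - (z - b)^-1)
     (fun z => 1 / (z - b) ^+ 2).
  have rho0 : 0 < (cabs (b - c) + e) / 2 by have := cabs_ge0 (b - c); lra.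
  have rho1 : cabs (b - c) < (cabs (b - c) + e) / 2 < e by lra.
  apply: (cmean_uniq rho0 rho1 hm); apply: cmean_eq (ex _) _ => [z /andP[zb _]|z _].
    have zb0 : z - b != 0.
      by apply/negP; rewrite subr_eq0 => /eqP zb'; move: zb; rewrite zb' ltxx.
    apply: cderiv_eq (cderivN ((@cderivV _ (fun w0 => w0 - b)) _ _ zb0
      (cderivB (cderiv_id z) (cderiv_cst b z)))) _.
    by rewrite subr0 mulNr opprK.
  by rewrite mul1r.
rewrite m0 in hm.
have := cmeanD hq (cmeanZ (f b) hm); rewrite mulr0 addr0 => /cmean_eq; apply.
move=> z /andP[zb _].
have zb0 : z - b != 0.
  by apply/negP; rewrite subr_eq0 => /eqP zb'; move: zb; rewrite zb' ltxx.
by rewrite (dquotE f b z); field.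
Qed.

(** Differentiation under the mean in the formula for the derivative. *)
Lemma holo_cder f c : holo f c -> holo (cder f) c.
Proof.
suff H d : holo f d -> exists l, cderiv (cder f) d l.
  move=> /holo_disc[e [B [e0 _ he]]]; apply: holo_of_derivable.
  by exists e => // w /he[nw _]; exact: H.
move=> nf; have [e [B [e0 B0 hB]]] := holo_disc nf.
have nf' z : cabs (z - d) < e -> holo f z by move=> /hB[].
have [l hl] : exists l, cmean d 0 e (fun z => f z / (z - d) ^+ 2) l.
  apply: cmean_ex => z /andP[z0 ze]; apply: holoF (nf' _ ze) _.
    by rewrite expf_neq0 // -cabs_gt0.
  apply: holo_ext (holoM (holo_subr d z) (holo_subr d z)) => w.
  by rewrite expr2.
exists (2 * l) => n n0.
pose M := B * (2 * e) / (e / 4) ^+ 2 / (e / 2) ^+ 2.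
have M0 : 0 < M by rewrite /M !divr_gt0 // mulr_gt0 //; lra.
exists (Num.min (e / 4) (n / M)); first by rewrite lt_min (divr_gt0 n0 M0) andbT; lra.
move=> h; rewrite lt_min (ltr_pdivlMr _ _ M0) => /andP[he hn].
have ech : cabs (d + h - d) = cabs h by rewrite addrC addKr.
have hE : cabs (d + h - d) < e by rewrite ech; lra.
have h1 := cder_mean nf' hE; rewrite ech in h1.
have h2 : cmean d 0 e (fun z => (z - d) * f z / (z - d) ^+ 2) (cder f d).
  have d0 : cabs (d - d) < e by rewrite subrr cabs0.
  by move: (cder_mean nf' d0); rewrite subrr cabs0.
have hm := cmeanB (cmeanB h1 (cmean_sub h2 (cabs_ge0 h) (lexx e)))
  (cmeanZ (2 * h) (cmean_sub hl (cabs_ge0 h) (lexx e))).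
have e20 : 0 < e / 2 by lra.
have he2 : cabs h < e / 2 < e by lra.
have -> : 2 * l * h = 2 * h * l by ring.
apply: le_trans (cmean_bound (B := M * cabs h * cabs h) hm e20 he2 _) _; last first.
  by apply: ler_wpM2r; [exact: cabs_ge0|rewrite [leLHS]mulrC; exact: ltW].
move=> z zc.
have zc0 : z - d != 0 by rewrite -cabs_gt0 zc.
have zch : e / 4 <= cabs (z - (d + h)).
  by have := cabs_trianB z (d + h) d; rewrite ech zc; lra.
have zch0 : z - (d + h) != 0 by rewrite -cabs_gt0; lra.
have -> : (z - d) * f z / (z - (d + h)) ^+ 2 - (z - d) * f z / (z - d) ^+ 2
   - 2 * h * (f z / (z - d) ^+ 2) =
   f z * (3 * (z - d) - 2 * h) * h * h / (z - (d + h)) ^+ 2 / (z - d) ^+ 2.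
  by field; rewrite zc0.
rewrite 2!cabs_div !cabsX !cabsM zc.
have fB : cabs (f z) <= B by have [|_ ->//] := hB z; rewrite zc; lra.
have c0 := cabs_ge0 h.
have hb : cabs (3 * (z - d) - 2 * h) <= 2 * e.
  apply: le_trans (cabs_triangle _ _) _; rewrite cabsN !cabsM zc.
  have -> : cabs (3 : C) = 3 by rewrite -(rmorph_nat (real_complex R)) cabsR normr_nat.
  have -> : cabs (2 : C) = 2 by rewrite -(rmorph_nat (real_complex R)) cabsR normr_nat.
  lra.
have -> : M * cabs h * cabs h = B * (2 * e) * cabs h * cabs h / (e / 4) ^+ 2 / (e / 2) ^+ 2.
  by rewrite /M; ring.
rewrite ler_wpM2r ?invr_ge0 ?sqr_ge0 //.
apply: ler_pM; rewrite ?invr_ge0 ?sqr_ge0 ?mulr_ge0 ?cabs_ge0 //.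
  rewrite !ler_wpM2r //; apply: ler_pM; rewrite ?cabs_ge0 //.
rewrite lef_pV2 ?posrE ?exprn_gt0 ?cabs_gt0 //; last by lra.
by rewrite lerXn2r ?nnegrE ?cabs_ge0 //; lra.
Qed.

End Analytic.

(** * Local behaviour of analytic maps *)

Section Mapping.
Variable R : realType.
Local Notation C := (plane R).
Implicit Types (z w b c : C) (f g h u : C -> C).

(** The points of [A] where [P] holds, and those where it fails, are the traces
    on [A] of open sets. *)
Lemma connected_ind (A P : set C) : connected A ->
  (forall x, A x -> exists2 e : R, 0 < e &
     forall y, A y -> cabs (y - x) < e -> (P x <-> P y)) ->
  forall a, A a -> P a -> forall x, A x -> P x.
Proof.
move=> cA loc a Aa Pa.
pose O (S : set C) := [set y | exists x, A x /\ S x /\ exists2 e : R, cabs (y - x) < e &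
     forall y', A y' -> cabs (y' - x) < e -> (P x <-> P y')].
have oO S : open (O S).
  apply/openP_plane => y [x [Ax [Px [e ye he]]]].
  exists (e - cabs (y - x)); first by rewrite subr_gt0.
  move=> w; rewrite ltrBrDr => hw; exists x; split=> //; split=> //.
  by exists e => //; apply: le_lt_trans (cabs_trianB _ _ _) hw.
have mem (S : set C) y : A y -> S y -> O S y.
  move=> Ay Sy; have [e e0 he] := loc y Ay; exists y; split=> //; split=> //.
  by exists e => //; rewrite subrr cabs0.
have PA : A `&` P = A.
  apply: cA.
  - by exists a.
  - exists (O P) => //; apply/seteqP; split=> [y [Ay Py]|y [Ay [x [Ax [Px [e ye he]]]]]].
      by split=> //; exact: mem.
    by split=> //; apply/he.
  - exists (~` O (~` P)); first by apply: open_closedC.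
    apply/seteqP; split=> [y [Ay Py]|y [Ay nO]]; split=> //.
      by move=> [x [Ax [nPx [e ye he]]]]; apply: nPx; apply/(he y).
    by apply: contrapT => nP; apply: nO; exact: mem.
by move=> x; rewrite -{1}PA => -[].
Qed.

Lemma disc_segment c e z t : cabs (z - c) < e -> 0 <= t <= 1 ->
  cabs (c + t%:C * (z - c) - c) < e.
Proof.
move=> ze /andP[t0 t1]; rewrite addrC addKr cabsM cabsR ger0_norm //.
by apply: le_lt_trans ze; rewrite ler_piMl ?cabs_ge0.
Qed.

Lemma cst_of_cder0 f c e : (forall z, cabs (z - c) < e -> cderiv f z 0) ->
  forall z, cabs (z - c) < e -> f z = f c.
Proof.
move=> df z ze; apply/eqP; rewrite -subr_eq0 -cabs_eq0 eq_le cabs_ge0 andbT.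
rewrite -(mul0r (cabs (z - c))).
apply: (segment_mvt (G' := fun=> 0)) => t t01; last by rewrite cabs0.
by apply: df; exact: disc_segment.
Qed.

(** On the circle of radius [rho] the kernel of Cauchy's formula is at most 2. *)
Lemma cauchy_bound c s rho f b B : (forall z, cabs (z - c) < s -> holo f z) ->
  0 < rho < s -> cabs (b - c) <= rho / 2 ->
  (forall z, cabs (z - c) = rho -> cabs (f z) <= B) -> cabs (f b) <= 2 * B.
Proof.
move=> nf /andP[r0 rs] br hf.
have B0 : 0 <= B.
  apply: le_trans (hf (c + rho%:C) _); first exact: cabs_ge0.
  by rewrite addrC addKr cabsR ger0_norm // ltW.
have bs : cabs (b - c) < s by lra.
apply: (cmean_bound (cauchy nf bs) r0) => [|z zr]; first by lra.
have zb : rho / 2 <= cabs (z - b) by have := cabs_trianB z b c; rewrite zr; lra.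
rewrite cabs_div cabsM zr ler_pdivrMr; last by lra.
have fB := hf z zr.
apply: (@le_trans _ _ (rho * B)); first by rewrite ler_wpM2l // ltW.
have -> : rho * B = 2 * B * (rho / 2) by lra.
by rewrite ler_wpM2l // mulr_ge0.
Qed.

Lemma center_bound c s rho f B : (forall z, cabs (z - c) < s -> holo f z) ->
  0 < rho < s -> (forall z, cabs (z - c) = rho -> cabs (f z) <= B) ->
  cabs (f c) <= B.
Proof.
move=> nf /andP[r0 rs] hf.
have s0 : 0 < s := lt_trans r0 rs.
have [m hm] : exists m, cmean c 0 s f m.
  by apply: cmean_ex => z /andP[_]; exact: nf.
have [cf _] : holo f c by apply: nf; rewrite subrr cabs0.
rewrite -(cmean_center s0 cf hm); apply: (cmean_bound hm r0) => //.
by rewrite r0 rs.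
Qed.

Definition locally_cst f c := exists2 e : R, 0 < e &
  forall w, cabs (w - c) < e -> f w = f c.

(** Divide by [z - c] repeatedly. If every divided difference vanished at [c],
    Cauchy's bound applied to the [n]-th one would give [f b - f c = O(2^-n)]
    near [c], and [f] would be locally constant. *)
Lemma local_form f c : holo f c -> ~ locally_cst f c ->
  exists m u, [/\ holo u c, u c != 0 & forall z, f z = f c + (z - c) ^+ m.+1 * u z].
Proof.
move=> nf nlc.
pose u k := iter k (fun g => dquot g c) f.
have fE n : (forall k, (k < n)%N -> u k.+1 c = 0) ->
    forall z, f z = f c + (z - c) ^+ n.+1 * u n.+1 z.
  elim: n => [|n IH] h z; first by rewrite expr1; exact: dquotE.
  rewrite IH; last by move=> k kn; apply: h; rewrite ltnW.
  by rewrite (dquotE (u n.+1) c z) (h n) // add0r mulrA -exprSr.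
have [e [B [e0 B0 he]]] := holo_disc nf.
have nu k z : cabs (z - c) < e -> holo (u k) z.
  elim: k z => [|k IH] z ze; first by have [] := he z ze.
  by apply: holo_dquot; apply: IH => //; rewrite subrr cabs0.
have [[k hk]|all0] := pselect (exists k, u k.+1 c != 0).
  have [n un min] := ex_minnP (ex_intro (fun k => u k.+1 c != 0) k hk).
  exists n, (u n.+1); split=> //; first by apply: nu; rewrite subrr cabs0.
  apply: fE => j jn; apply/eqP; apply: contraTT jn => /min; by rewrite -leqNgt.
exfalso; apply: nlc; exists (e / 4); first by lra.
move=> b be; apply/eqP; rewrite -subr_eq0 -cabs_eq0 eq_le cabs_ge0 andbT.
rewrite leNgt; apply/negP => c0.
have [n] := half_pow_small (4 * B) c0; apply/negP; rewrite -leNgt.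
have un : forall k, (k < n)%N -> u k.+1 c = 0.
  by move=> k _; apply: contrapT => /eqP h; apply: all0; exists k.
have fn := fE _ un.
have rho0 : 0 < (e / 2) ^+ n.+1 by rewrite exprn_gt0 //; lra.
have := @cauchy_bound c e (e / 2) (u n.+1) b (2 * B / (e / 2) ^+ n.+1) (nu _).
move=> H; have {}H : cabs (u n.+1 b) <= 2 * (2 * B / (e / 2) ^+ n.+1).
  apply: H; [lra|lra|] => z ze.
  have zc0 : 0 < cabs (z - c) ^+ n.+1 by rewrite ze.
  have -> : u n.+1 z = (f z - f c) / (z - c) ^+ n.+1.
    rewrite (fn z) [f c + _]addrC addrK mulrC mulKf //.
    by rewrite expf_neq0 // -cabs_gt0 ze; lra.
  rewrite cabs_div cabsX ze ler_pM2r ?invr_gt0 //.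
  have [|_ b1] := he z; first by rewrite ze; lra.
  have [|_ b2] := he c; first by rewrite subrr cabs0.
  by apply: le_trans (cabs_triangle _ _) _; rewrite cabsN; lra.
rewrite (fn b) [f c + _]addrC addrK cabsM cabsX.
have -> : 4 * B * 2^-1 ^+ n = 2 * 2^-1 ^+ n.+1 * (2 * (2 * B)) by rewrite exprS; field.
apply: (@le_trans _ _ ((e / 2 * 2^-1) ^+ n.+1 * (2 * (2 * B / (e / 2) ^+ n.+1)))).
  apply: ler_pM; rewrite ?exprn_ge0 ?cabs_ge0 //.
  by apply: lerXn2r; rewrite ?nnegrE ?cabs_ge0 //; lra.
have P0 : 0 < (2^-1 : R) ^+ n.+1 by rewrite exprn_gt0 ?invr_gt0.
have -> : (e / 2 * 2^-1) ^+ n.+1 * (2 * (2 * B / (e / 2) ^+ n.+1)) =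
   2^-1 ^+ n.+1 * (2 * (2 * B)).
  rewrite [in LHS]exprMn; move: ((e / 2) ^+ n.+1) rho0 => x x0.
  by field; rewrite gt_eqF.
rewrite ler_wpM2r; lra.
Qed.

Lemma isolated_value f c : holo f c -> ~ locally_cst f c ->
  exists2 e : R, 0 < e & forall w, w != c -> cabs (w - c) < e -> f w != f c.
Proof.
move=> nf nl; have [m [u [[cu _] uc fE]]] := local_form nf nl.
have [e e0 he] := cts_neq0 cu uc; exists e => // w wc /he uw.
rewrite fE -subr_eq0 [f c + _]addrC addrK.
by rewrite mulf_neq0 // expf_neq0 // subr_eq0.
Qed.

Lemma cder_cst f c : locally_cst f c -> cderiv f c 0.
Proof.
move=> [e e0 he]; apply: cderiv_near (cderiv_cst (f c) c).
by apply/near_plane; exists e => // w /he.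
Qed.

Lemma cder_neq0_near f c : holo f c -> ~ locally_cst f c ->
  exists2 e : R, 0 < e & forall w, w != c -> cabs (w - c) < e -> cder f w != 0.
Proof.
move=> nf nl; have ndf := holo_cder nf.
have [c0|c0] := eqVneq (cder f c) 0; last first.
  have [cd _] := ndf; have [e e0 he] := cts_neq0 cd c0.
  by exists e => // w _; exact: he.
have [lc|nlc] := pselect (locally_cst (cder f) c); last first.
  have [e e0 he] := isolated_value ndf nlc; exists e => // w wc wec.
  by rewrite -c0; exact: he.
exfalso; apply: nl; have [e e0 he] := lc; have [d [B [d0 _ hd]]] := holo_disc nf.
exists (Num.min e d); first by rewrite lt_min e0.
apply: cst_of_cder0 => z; rewrite lt_min => /andP[ze zd].
by have [nz _] := hd z zd; have := cderiv_cder nz; rewrite he // c0.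
Qed.

(** Identity theorem. The points around which [f] is constant form an open set,
    and also a closed one since [f'] has isolated zeros near the others. *)
Lemma nowhere_locally_cst (U : set C) f : connected U ->
  (forall z, U z -> holo f z) -> (exists z w, [/\ U z, U w & f z <> f w]) ->
  forall c, U c -> ~ locally_cst f c.
Proof.
move=> cU nf [z0 [w0 [Uz0 Uw0 zw]]] c Uc lc; apply: zw.
have all_lc : forall x, U x -> locally_cst f x.
  apply: (connected_ind cU _ Uc lc) => x Ux.
  have [lx|nlx] := pselect (locally_cst f x).
    have [e e0 he] := lx; exists e => // y Uy ye; split=> // _.
    exists (e - cabs (y - x)); first by rewrite subr_gt0.
    move=> w; rewrite ltrBrDr => wy; rewrite !he //.
    exact: le_lt_trans (cabs_trianB _ _ _) wy.
  have [e e0 he] := cder_neq0_near (nf x Ux) nlx.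
  exists e => // y Uy ye; split=> // ly.
  have [yx|yx] := eqVneq y x; first by rewrite yx in ly.
  have := he y yx ye; rewrite (cderE (cder_cst ly)).
  by rewrite eqxx.
apply: (connected_ind cU (P := fun x => f z0 = f x) _ Uz0) => // x Ux.
have [e e0 he] := all_lc x Ux.
by exists e => // y Uy /he ->.
Qed.

(** If [w] were omitted, [1 / (f - w)] would be larger at [c] than on a small
    circle around [c]. *)
Lemma open_mapping f c : holo f c -> ~ locally_cst f c ->
  forall e : R, 0 < e -> exists2 d : R, 0 < d &
    forall w, cabs (w - f c) < d -> exists2 z, cabs (z - c) < e & f z = w.
Proof.
move=> nf nl e e0; have [m [u [[/cts_plane cu _] uc fE]]] := local_form nf nl.
have [k [B [k0 _ hk]]] := holo_disc nf.
have uc0 : 0 < cabs (u c) / 2 by rewrite divr_gt0 // cabs_gt0.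
have [d d0 hd] := cu _ uc0.
pose s := Num.min e (Num.min k d).
have s0 : 0 < s by rewrite !lt_min e0 k0.
pose rho := s / 2; have rho0 : 0 < rho by rewrite /rho; lra.
pose eta := rho ^+ m.+1 * (cabs (u c) / 2).
have eta0 : 0 < eta by rewrite mulr_gt0 // exprn_gt0.
exists (eta / 2); first by lra.
move=> w we; apply: contrapT => nz.
have fw z : cabs (z - c) < s -> f z - w != 0.
  rewrite lt_min => /andP[ze _]; rewrite subr_eq0; apply/negP => /eqP fz.
  by apply: nz; exists z.
have ninv z : cabs (z - c) < s -> holo (fun z => (f z - w)^-1) z.
  move=> zs; apply: holoV; first exact: fw.
  apply: holoB (holo_cst _ _); move: zs; rewrite !lt_min => /andP[_ /andP[zk _]].
  by have [] := hk z zk.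
have rs : 0 < rho < s by rewrite rho0 /rho; lra.
have := center_bound (B := (eta / 2)^-1) ninv rs.
suff H : forall z, cabs (z - c) = rho -> cabs (f z - w)^-1 <= (eta / 2)^-1.
  move=> /(_ H); rewrite cabsV lef_pV2 ?posrE ?cabs_gt0 ?fw ?subrr ?cabs0 //; last lra.
  by rewrite cabsB; lra.
move=> z zr; have zs : cabs (z - c) < s by rewrite zr; lra.
rewrite cabsV lef_pV2 ?posrE ?cabs_gt0 ?fw //; last lra.
have : eta <= cabs (f z - f c).
  rewrite (fE z) [f c + _]addrC addrK cabsM cabsX zr /eta ler_pM2l ?exprn_gt0 //.
  move: zs; rewrite !lt_min => /andP[_ /andP[_ /hd]].
  by rewrite cabsB; have := cabs_dist (u c) (u z); lra.
by have := cabs_trianB (f z) w (f c); lra.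
Qed.

Lemma cderiv_inverse f h z l : cderiv f z l -> l != 0 -> h (f z) = z ->
  {for f z, continuous h} ->
  (exists2 e : R, 0 < e & forall v, cabs (v - f z) < e -> f (h v) = v) ->
  cderiv h (f z) l^-1.
Proof.
move=> df l0 hfz /cts_plane ch [e e0 he] n n0.
have l1 : 0 < cabs l by rewrite cabs_gt0.
pose n' := Num.min (cabs l / 2) (n * (cabs l ^+ 2 / 2)).
have n'0 : 0 < n' by rewrite lt_min !(divr_gt0, mulr_gt0, exprn_gt0).
have n'1 : n' <= cabs l / 2 by rewrite ge_min lexx.
have n'2 : n' <= n * (cabs l ^+ 2 / 2) by rewrite ge_min lexx orbT.
clearbody n'.
have [d d0 hd] := df _ n'0; have [k k0 hk] := ch _ d0.
exists (Num.min e k); first by rewrite lt_min e0.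
move=> v; rewrite lt_min => /andP[ve vk].
pose s := h (f z + v) - z.
have fs : f (z + s) = f z + v.
  by rewrite /s [z + _]addrC subrK he // [f z + v]addrC addrK.
have /hd : cabs s < d.
  by rewrite /s -{2}hfz; apply: hk; rewrite [f z + v]addrC addrK.
rewrite fs (_ : f z + v - f z = v); last by ring.
move=> h1.
have s0 := cabs_ge0 s.
have h2 : cabs s <= 2 / cabs l * cabs v.
  have : cabs l * cabs s <= cabs v + n' * cabs s.
    rewrite -cabsM; have -> : l * s = v - (v - l * s) by ring.
    by apply: le_trans (cabs_triangle _ _) _; rewrite cabsN lerD2l.
  have : n' * cabs s <= cabs l / 2 * cabs s by rewrite ler_wpM2r.
  move=> a1 a2; rewrite mulrAC ler_pdivlMr //; lra.
rewrite hfz -/s.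
have -> : s - l^-1 * v = - ((v - l * s) / l) by field.
rewrite cabsN cabs_div ler_pdivrMr //; apply: le_trans h1 _.
apply: (@le_trans _ _ (n * (cabs l ^+ 2 / 2) * (2 / cabs l * cabs v))).
  by apply: ler_pM => //; exact: ltW.
rewrite le_eqVlt; apply/orP; left; apply/eqP.
by field; rewrite gt_eqF.
Qed.

(** The inverse is continuous by the open mapping theorem, differentiable where
    [cder f] does not vanish, and so analytic up to isolated points, at which
    continuity suffices. *)
Lemma holo_inverse (A : set C) f h : open A -> (forall z, A z -> holo f z) ->
  (forall z, A z -> h (f z) = z) -> forall c, A c -> holo h (f c).
Proof.
move=> /openP_plane oA nf hf c Ac.
have inj z w : A z -> A w -> f z = f w -> z = w.
  by move=> Az Aw fzw; rewrite -(hf z) // fzw hf.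
have nl z : A z -> ~ locally_cst f z.
  move=> Az [e e0 he]; have [d d0 hd] := oA _ Az.
  pose r := Num.min e d / 2.
  have m0 : 0 < Num.min e d by rewrite lt_min e0.
  have r0 : 0 < r by rewrite /r; lra.
  have zr : cabs (z + r%:C - z) < Num.min e d.
    by rewrite addrC addKr cabsR ger0_norm ?(ltW r0) // /r; lra.
  move: zr; rewrite lt_min => /andP[/he fz /hd Azr].
  have /eqP := inj _ _ Azr Az fz; rewrite -subr_eq0 addrC addKr.
  by rewrite -cabs_eq0 cabsR ger0_norm ?(ltW r0) // gt_eqF.
have near_im z : A z -> forall e : R, 0 < e -> exists2 d : R, 0 < d &
   forall w, cabs (w - f z) < d -> exists x, [/\ A x, cabs (x - z) < e & f x = w].
  move=> Az e e0; have [d d0 hd] := oA _ Az.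
  have m0 : 0 < Num.min e d by rewrite lt_min e0.
  have [k k0 hk] := open_mapping (nf _ Az) (nl _ Az) m0.
  exists k => // w /hk[x]; rewrite lt_min => /andP[xe /hd Ax] fx.
  by exists x.
have ch z : A z -> {for f z, continuous h}.
  move=> Az; apply/cts_plane => e /(near_im z Az)[d d0 hd].
  by exists d => // w /hd[x [Ax xe <-]]; rewrite !hf.
split; first exact: ch.
have [e e0 he] := cder_neq0_near (nf _ Ac) (nl _ Ac).
have [d d0 hd] := near_im c Ac e e0.
exists d => // w wc /hd[x [Ax xe fx]].
have xc : x != c by apply: contraNneq wc => <-; rewrite fx.
exists (cder f x)^-1; rewrite -fx; apply: cderiv_inverse.
- exact: cderiv_cder (nf _ Ax).
- exact: he.
- exact: hf.
- exact: ch.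
- have [k k0 hk] := near_im x Ax 1 ltr01.
  by exists k => // v /hk[y [Ay _ <-]]; rewrite hf.
Qed.

End Mapping.

(** * A bound of Bloch type *)

Section Bloch.
Variable R : realType.
Local Notation C := (plane R).
Implicit Types (z w b c q : C) (f g V : C -> C).

(** The plane is the continuous image of the product of two real lines, where
    boxes are compact. *)
Lemma bounded_closed_compact_plane (A : set C) (M : R) : closed A ->
  (forall z, A z -> cabs z <= M) -> compact A.
Proof.
move=> cA bA.
pose B : set (R * R) := `[- M, M]%classic `*` `[- M, M]%classic.
pose p (x : R * R) : C := pt x.1 x.2.
have cC : continuous (fun x : R => x%:C : C).
  move=> x; apply/cts_Rplane => e e0; exists e => // y.
  by rewrite -rmorphB cabsR.
have cp : continuous p.
  move=> x.
  apply: (@continuousD _ _ _ (fun x : R * R => x.1%:C : C) (fun x : R * R => x.2%:C * 'i : C)).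
    exact: (continuous_comp (f := fst) (g := fun t : R => t%:C : C) cvg_fst (cC _)).
  apply: (@continuousM _ _ (fun x : R * R => x.2%:C : C) (fun=> 'i : C)); last exact: cst_continuous.
  exact: (continuous_comp (f := snd) (g := fun t : R => t%:C : C) cvg_snd (cC _)).
apply: (@subclosed_compact _ _ (p @` B)) => //.
  apply: continuous_compact; first exact: continuous_subspaceT.
  by apply: compact_setX; exact: segment_compact.
move=> z /bA zM; exists (Re z, Im z); last exact: ptE.
split; rewrite /= in_itv /= -ler_norml; apply: le_trans zM.
  exact: Re_le_cabs.
exact: Im_le_cabs.
Qed.

Lemma cts_cabs_comp f z : {for z, continuous f} ->
  {for z, continuous (fun w => cabs (f w))}.
Proof.
move=> /cts_plane cf; apply/cts_planeR => e /cf[d d0 hd]; exists d => // w /hd h.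
apply: le_lt_trans h; rewrite ler_norml cabs_dist andbT lerNl opprB cabsB.
exact: cabs_dist.
Qed.

Lemma cts_dist c : continuous (fun z => cabs (z - c)).
Proof.
move=> z; have [cz _] := holo_subr c z.
exact: (@cts_cabs_comp (fun w => w - c) z cz).
Qed.

Lemma closed_ballC c (r : R) : closed [set z : C | cabs (z - c) <= r].
Proof.
rewrite (_ : [set z | _] = (fun z => cabs (z - c)) @^-1` [set x | x <= r]) //.
by apply: closed_comp; [move=> z _; exact: cts_dist|exact: closed_le].
Qed.

Lemma compact_ballC c (r : R) : compact [set z : C | cabs (z - c) <= r].
Proof.
apply: (@bounded_closed_compact_plane _ (r + cabs c)) => [|z /= zr].
  exact: closed_ballC.
have -> : z = (z - c) + c by rewrite subrK.
by apply: le_trans (cabs_triangle _ _) _; rewrite lerD2r.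
Qed.

(** A bound on the derivative makes [V] almost linear on the disc of radius
    [rho / 24], so its values on the boundary are at distance at least
    [cabs (cder V c) * rho / 48] from [V c]. If [q] were closer to [V c] than
    half of that, [1 / (V - q)] would violate the maximum principle. *)
Lemma omitted_value c (rho : R) V q : 0 < rho ->
  (forall z, cabs (z - c) < rho -> holo V z) ->
  (forall z, cabs (z - c) < rho -> cabs (cder V z) <= 2 * cabs (cder V c)) ->
  (forall z, cabs (z - c) < rho -> V z != q) ->
  cabs (cder V c) * rho <= 96 * cabs (V c - q).
Proof.
move=> rho0 nV bV oV; set l := cabs (cder V c) in bV *.
have [l0|l0] := eqVneq l 0; first by rewrite l0 mul0r mulr_ge0 ?cabs_ge0.
have lp : 0 < l by rewrite lt_neqAle eq_sym l0 cabs_ge0.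
have c0 : cabs (c - c) < rho by rewrite subrr cabs0.
have nD z : cabs (z - c) < rho -> holo (cder V) z by move=> /nV /holo_cder.
have nQ z : cabs (z - c) < rho -> holo (dquot (cder V) c) z.
  by move=> /nD h; apply: holo_dquot h; exact: nD.
have r2 : 0 < rho / 2 < rho by lra.
have Q z : cabs (z - c) <= rho / 2 / 2 -> cabs (dquot (cder V) c z) <= 2 * (3 * l / (rho / 2)).
  move=> zr; apply: (cauchy_bound nQ r2 zr) => w wr.
  have wc : w != c by rewrite -subr_eq0 -cabs_gt0 wr; lra.
  rewrite /dquot (negbTE wc) cabs_div wr ler_pM2r ?invr_gt0; last lra.
  apply: le_trans (cabs_triangle _ _) _; rewrite cabsN -/l.
  have := bV w; rewrite wr => /(_ _); have : rho / 2 < rho by lra.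
  by move=> h /(_ h); lra.
(* The divided difference of [cder V] is at most [12 * l / rho]. *)
have D z : cabs (z - c) <= rho / 24 -> cabs (cder V z - cder V c) <= l / 2.
  move=> zr; rewrite (dquotE (cder V) c z) [cder V c + _]addrC addrK cabsM.
  have zr2 : cabs (z - c) <= rho / 2 / 2 by lra.
  apply: le_trans (ler_pM (cabs_ge0 _) (cabs_ge0 _) zr (Q _ zr2)) _.
  rewrite le_eqVlt; apply/orP; left; apply/eqP; field; lra.
have lin z : cabs (z - c) = rho / 24 -> l * (rho / 48) <= cabs (V z - V c).
  move=> zr.
  have : cabs ((V z - cder V c * z) - (V c - cder V c * c)) <= l / 2 * cabs (z - c).
    apply: (segment_mvt (G := fun w => V w - cder V c * w)
       (G' := fun w => cder V w - cder V c)) => t /andP[t0 t1].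
      have tc : cabs (c + t%:C * (z - c) - c) < rho.
        by apply: disc_segment; rewrite ?zr ?t0 ?t1 //; lra.
      apply: cderivB; first exact: cderiv_cder (nV _ tc).
      by apply: cderiv_eq (cderivZ _ (cderiv_id _)) _; rewrite mulr1.
    apply: D; rewrite addrC addKr cabsM cabsR ger0_norm // -zr.
    by rewrite ler_piMl // cabs_ge0.
  have -> : (V z - cder V c * z) - (V c - cder V c * c) =
     (V z - V c) - cder V c * (z - c) by ring.
  rewrite zr [leLHS]cabsB => h.
  have h2 := cabs_dist (cder V c * (z - c)) (V z - V c).
  by rewrite [X in X - _]cabsM -/l zr in h2; lra.
rewrite leNgt; apply/negP => qV.
have vq : 0 < cabs (V c - q) by rewrite cabs_gt0 subr_eq0; exact: oV.
have ninv z : cabs (z - c) < rho -> holo (fun z => (V z - q)^-1) z.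
  move=> zr; apply: holoV; first by rewrite subr_eq0; exact: oV.
  by apply: holoB (nV _ zr) (holo_cst _ _).
have r24 : 0 < rho / 24 < rho by lra.
have gap : 0 < l * (rho / 48) - cabs (V c - q) by lra.
have := center_bound (B := (l * (rho / 48) - cabs (V c - q))^-1) ninv r24.
suff H : forall z, cabs (z - c) = rho / 24 ->
    cabs (V z - q)^-1 <= (l * (rho / 48) - cabs (V c - q))^-1.
  by move=> /(_ H); rewrite cabsV lef_pV2 ?posrE //; lra.
move=> z zr; have h := lin z zr.
have h2 := cabs_trianB (V z) q (V c); rewrite (cabsB q) in h2.
have : l * (rho / 48) - cabs (V c - q) <= cabs (V z - q) by lra.
by move=> h3; rewrite cabsV lef_pV2 ?posrE //; lra.
Qed.

(** Bloch's argument: move the centre to a point [z1] that maximizes the product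
    of [cabs (cder V z)] and the distance to the boundary circle. On half of the
    disc around [z1] the derivative is at most doubled, and [omitted_value]
    applies. *)
Lemma bloch c (L K : R) V : 0 < L ->
  (forall z, cabs (z - c) <= L -> holo V z) ->
  (forall v : C, exists q, cabs (v - q) <= K /\
     forall z, cabs (z - c) <= L -> V z != q) ->
  cabs (cder V c) * L <= 192 * K.
Proof.
move=> L0 nV om.
have K0 : 0 <= K by have [q [h _]] := om 0; apply: le_trans h; exact: cabs_ge0.
pose Phi z := cabs (cder V z) * (L - cabs (z - c)).
have [||z1 /set_mem /= z1L z1max] :=
  @compact_EVT_max _ R Phi [set z | cabs (z - c) <= L] _ (@compact_ballC c L).
- by exists c; rewrite /= subrr cabs0 ltW.
- apply: continuous_in_subspaceT => z /set_mem /= zL.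
  apply: (@continuousM _ _ (fun z => cabs (cder V z)) (fun z => L - cabs (z - c))).
    have [cz _] := holo_cder (nV _ zL).
    exact: (@cts_cabs_comp (cder V) z cz).
  apply: (@continuousB _ _ _ (fun=> L) (fun z => cabs (z - c))).
    exact: cst_continuous.
  exact: cts_dist.
have Pc : cabs (cder V c) * L = Phi c by rewrite /Phi subrr cabs0 subr0.
have max z : cabs (z - c) <= L -> Phi z <= Phi z1.
  by move=> zL; apply: z1max; rewrite inE.
rewrite Pc; apply: le_trans (max c _) _; first by rewrite subrr cabs0 ltW.
pose rho := (L - cabs (z1 - c)) / 2.
have E : Phi z1 = 2 * (cabs (cder V z1) * rho) by rewrite /Phi /rho; lra.
have [r0|r0] := leP rho 0.
  rewrite E; apply: (@le_trans _ _ 0); last by rewrite mulr_ge0.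
  by rewrite pmulr_rle0 // mulr_ge0_le0 // cabs_ge0.
have zin z : cabs (z - z1) < rho -> cabs (z - c) <= L - rho.
  by move=> zr; have := cabs_trianB z z1 c; rewrite /rho in zr *; lra.
have zin' z : cabs (z - z1) < rho -> cabs (z - c) <= L.
  by move=> /zin; lra.
have [q [qK oq]] := om (V z1).
have := @omitted_value z1 rho V q r0.
rewrite E => H; suff : cabs (cder V z1) * rho <= 96 * cabs (V z1 - q) by lra.
apply: H => z zr; [by apply: nV; exact: zin'| |by apply: oq; exact: zin'].
have := max z (zin' _ zr); rewrite E /Phi => h.
rewrite -(ler_pM2r r0); apply: le_trans _ (_ : _ <= 2 * (cabs (cder V z1) * rho)) _ => //.
  apply: le_trans h; apply: ler_wpM2l; first exact: cabs_ge0.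
  by have := zin _ zr; lra.
by rewrite mulrA.
Qed.

End Bloch.

(** * Connected sets and ring domains *)

Section PlaneTopology.
Variable R : realType.
Local Notation C := (plane R).
Implicit Types (z w b c p q : C) (A E : set C).

Lemma segment_connected z w : connected [set z + t%:C * (w - z) | t in `[0:R, 1]%classic].
Proof.
apply: connected_continuous_connected.
  by apply/connected_intervalP; exact: interval_is_interval.
apply: continuous_subspaceT => x.
have d : cderiv (fun u : C => z + u * (w - z)) x%:C (0 + (x%:C * 0 + (w - z) * 1)).
  apply: cderivD; first exact: cderiv_cst.
  exact: (@cderivM _ id (fun=> w - z)) (cderiv_id _) (cderiv_cst _ _).
have /cts_plane cd := cderiv_cts d.
apply/cts_Rplane => e /cd[k k0 hk]; exists k => // y yx.
by apply: hk; rewrite -rmorphB cabsR.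
Qed.

Lemma starlike_connected A c : A c ->
  (forall z t, A z -> 0 <= t <= 1 -> A (c + t%:C * (z - c))) -> connected A.
Proof.
move=> Ac sA.
have -> : A = \bigcup_(z in A) [set c + t%:C * (z - c) | t in `[0:R, 1]%classic].
  apply/seteqP; split=> [z Az|z [w Aw [t t01 <-]]].
    exists z => //; exists 1; first by rewrite /= in_itv /= lexx ler01.
    by rewrite mul1r addrC subrK.
  by apply: sA => //; move: t01; rewrite /= in_itv.
apply: bigcup_connected; last by move=> z _; exact: segment_connected.
exists c => z _; exists 0; first by rewrite /= in_itv /= lexx ler01.
by rewrite mul0r addr0.
Qed.

Lemma connected_plane : connected [set: C].
Proof. by apply: (@starlike_connected _ 0). Qed.

Lemma image_connected (A : set C) (f : C -> C) : connected A ->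
  (forall z, A z -> {for z, continuous f}) -> connected (f @` A).
Proof.
move=> cA cf; apply: connected_continuous_connected => //.
by apply: continuous_in_subspaceT => z /set_mem /cf.
Qed.

(** The set is the image under the exponential of a set that is convex, its
    points being described by their real parts. *)
Lemma radii_connected c (P : R -> Prop) :
  (forall x y t, P (expR x) -> P (expR y) -> x <= t <= y -> P (expR t)) ->
  ~ P 0 -> (forall x, P x -> 0 <= x) ->
  connected [set z : C | P (cabs (z - c))].
Proof.
move=> iP P0 Pge.
have -> : [set z : C | P (cabs (z - c))] =
    (fun w => c + cexp w) @` [set w | P (expR (Re w))].
  apply/seteqP; split=> [z /= Pz|_ /= [w Pw <-]]; last by rewrite cabs_cexpc.
  have zc : z - c != 0.
    by apply/negP => /eqP z0; apply: P0; rewrite -(cabs0 R) -z0.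
  have [w hw] := polar zc.
  by exists w; rewrite -?hw 1?addrC ?subrK // -cabs_cexp -hw.
apply: image_connected; last first.
  move=> z _; apply: cderiv_cts.
  exact: cderivD (cderiv_cst c z) (cderiv_cexp z).
have [[c0 Pc0]|nP] := pselect (exists c0 : C, P (expR (Re c0))); last first.
  rewrite (_ : [set w | _] = set0); first exact: connected0.
  by apply/seteqP; split=> // w Pw; apply: nP; exists w.
apply: (@starlike_connected _ c0) => // z t /= Pz /andP[t0 t1].
rewrite !ReImE mul0r subr0.
have [zx|zx] := leP (Re c0) (Re z).
  apply: (iP (Re c0) (Re z)) => //; rewrite lerDl mulr_ge0 ?subr_ge0 //=.
  by rewrite -lerBrDl ler_piMl ?subr_ge0.
apply: (iP (Re z) (Re c0)) => //; rewrite gerDl -opprB mulrN oppr_le0.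
rewrite mulr_ge0 ?subr_ge0 ?(ltW zx) // andbT lerBrDl -lerBrDr.
by rewrite ler_piMl // subr_ge0 ltW.
Qed.

Lemma annulus_connected c (r s : R) : 0 <= r ->
  connected [set z : C | r < cabs (z - c) < s].
Proof.
move=> r0; apply: (@radii_connected c (fun x => r < x < s)) => //.
- by have [_] := radii_interval r s.
- by rewrite ltNge r0.
- by move=> x /andP[/ltW rx _]; exact: le_trans rx.
Qed.

Lemma closedP_plane A : closed A <->
  forall z, ~ A z -> exists2 e : R, 0 < e & forall w, cabs (w - z) < e -> ~ A w.
Proof.
by rewrite -openC openP_plane.
Qed.

(** Otherwise [E] would be open as well as closed in the connected plane. *)
Lemma frontier_point E : closed E -> E !=set0 -> (exists z, ~ E z) ->
  exists e, E e /\ forall d : R, 0 < d -> exists z, ~ E z /\ cabs (z - e) < d.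
Proof.
move=> /closedP_plane cE [e0 Ee0] [z0 nEz0]; apply: contrapT => nf; apply: nEz0.
apply: (connected_ind connected_plane (P := E) _ _ Ee0) => // x _.
have [Ex|nEx] := pselect (E x).
  have [d d0 hd] : exists2 d : R, 0 < d & forall z, cabs (z - x) < d -> E z.
    apply: contrapT => nd; apply: nf; exists x; split=> // d d0.
    apply: contrapT => nz; apply: nd; exists d => // z zx.
    by apply: contrapT => nEz; apply: nz; exists z.
  by exists d => // y _ /hd.
by have [d d0 hd] := cE x nEx; exists d => // y _ /hd.
Qed.

(** If every sublevel set of [T] on the ring domain [A] becomes open after adding
    the complement [E0 `|` E1] of [A], then both components of the complement
    are at the lower end of [A]. By boundedness either the upper end is compact,
    so that [T] attains its supremum, or the lower one is. In the second case a
    thin sublevel set is covered by disjoint neighbourhoods of [E0] and [E1] and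
    meets both, though it is connected. *)
Lemma one_ended_ring_absurd A (E0 E1 : set C) (T : C -> R) (al be : R) :
  open A -> closed E0 -> closed E1 -> E0 !=set0 -> E1 !=set0 ->
  (forall z, [\/ A z, E0 z | E1 z]) ->
  (forall z, E0 z -> ~ E1 z) -> (forall z, A z -> ~ E0 z /\ ~ E1 z) ->
  (forall z, A z -> {for z, continuous T}) ->
  (forall z, A z -> al < T z < be) ->
  (forall rho, al < rho < be -> exists2 z, A z & T z = rho) ->
  (forall rho, al < rho < be -> connected [set z | A z /\ T z < rho]) ->
  (forall rho, al < rho < be -> open [set z | ~ A z \/ T z < rho]) ->
  (forall rho, al < rho < be ->
    (exists M : R, forall z, ~ A z \/ T z < rho -> cabs z <= M) \/
    (exists M : R, forall z, A z -> rho < T z -> cabs z <= M)) ->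
  al < be -> False.
Proof.
move=> oA cE0 cE1 nE0 nE1 cover disj dA cT Tab surj conn opn bdd ab.
have inw (x y : R) : x < y -> x < (x + y) / 2 < y by lra.
pose rho := (al + be) / 2; have rhoab : al < rho < be := inw _ _ ab.
have /andP[r1 r2] := rhoab.
(* The upper end is bounded: [T] attains a maximum on [K]. *)
have [[M hM]|[M hM]] := bdd rho rhoab; last first.
  pose rho' := (rho + be) / 2; have r'ab : rho < rho' < be := inw _ _ r2.
  have r'ab' : al < rho' < be by lra.
  pose K := [set z | A z /\ rho' <= T z].
  have KE : K = ~` [set z | ~ A z \/ T z < rho'].
    apply/seteqP; split=> [z /= [Az rT] [//|]|z /= h].
      by apply/negP; rewrite -leNgt.
    split; first by apply: contrapT => nA; apply: h; left.
    by rewrite leNgt; apply/negP => Tz; apply: h; right.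
  have cK : compact K.
    apply: (@bounded_closed_compact_plane _ _ M).
      by rewrite KE; apply: open_closedC; exact: opn.
    by move=> z [Az rT]; apply: hM => //; lra.
  have [||z /set_mem [Az rz] zmax] := @compact_EVT_max _ R T K _ cK.
  - by have [z Az Tz] := surj _ r'ab'; exists z; split=> //; rewrite Tz.
  - by apply: continuous_in_subspaceT => z /set_mem [Az _]; exact: cT.
  have /andP[z1 z2] := Tab _ Az.
  have [w Aw Tw] : exists2 w, A w & T w = (T z + be) / 2 by apply: surj; lra.
  have : w \in K by rewrite inE; split=> //; rewrite Tw; lra.
  by move=> /zmax; rewrite Tw; lra.
(* The points that are closer to [E] than to [E'], in a form that makes
   disjointness immediate. *)
pose sep (E E' : set C) := [set z | exists x (e : R), [/\ E x, cabs (z - x) < e / 2 &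
  forall y, E' y -> e <= cabs (y - x)]].
have osep E E' : open (sep E E').
  apply/openP_plane => z [x [e [Ex zx he]]]; exists (e / 2 - cabs (z - x)).
    by rewrite subr_gt0.
  move=> w; rewrite ltrBrDr => wz; exists x, e; split=> //.
  exact: le_lt_trans (cabs_trianB _ _ _) wz.
have subsep (E E' : set C) : closed E' -> (forall z, E z -> ~ E' z) -> E `<=` sep E E'.
  move=> /closedP_plane cE' dE z Ez; have [e e0 he] := cE' z (dE z Ez).
  exists z, e; split; rewrite ?subrr ?cabs0 //; first by lra.
  by move=> y E'y; rewrite leNgt; apply/negP => /he.
have disj' z : E1 z -> ~ E0 z by move=> h1 h0; exact: disj h0 h1.
have dsep z : sep E0 E1 z -> sep E1 E0 z -> False.
  move=> [x [e [Ex zx he]]] [x' [e' [Ex' zx' he']]].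
  have h1 := he _ Ex'; have h2 := he' _ Ex; rewrite (cabsB x x') in h2.
  by have h3 := cabs_trianB x' z x; rewrite (cabsB x' z) in h3; lra.
pose rho1 := (al + rho) / 2; have r1ab : al < rho1 < rho := inw _ _ r1.
(* Compactness of [L] gives a sublevel set that misses it. *)
pose L := [set z | [/\ ~ A z \/ T z <= rho1, ~ sep E0 E1 z & ~ sep E1 E0 z]].
have LA z : L z -> A z.
  by move=> [_ n0 n1]; have [//|/(subsep _ _ cE1 disj)|/(subsep _ _ cE0 disj')] := cover z.
have cL : compact L.
  apply: (@bounded_closed_compact_plane _ _ M); last first.
    move=> z Lz; have [h _ _] := Lz; apply: hM.
    by case: h => [|h]; [left|right; lra].
  apply/closedP_plane => z nL.
  have [s0|n0] := pselect (sep E0 E1 z).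
    have /openP_plane /(_ _ s0)[d d0 hd] := osep E0 E1.
    by exists d => // w /hd h [_ + _]; apply.
  have [s1|n1] := pselect (sep E1 E0 z).
    have /openP_plane /(_ _ s1)[d d0 hd] := osep E1 E0.
    by exists d => // w /hd h [_ _]; apply.
  have [Az Tz] : A z /\ rho1 < T z.
    split; first by apply: contrapT => nA; apply: nL; split=> //; left.
    by rewrite ltNge; apply/negP => Tz; apply: nL; split=> //; right.
  have /openP_plane /(_ _ Az)[d d0 hd] := oA.
  have /cts_planeR cTz := cT _ Az; have [|k k0 hk] := cTz (T z - rho1); first by rewrite subr_gt0.
  exists (Num.min d k); first by rewrite lt_min d0.
  move=> w; rewrite lt_min => /andP[/hd Aw /hk]; rewrite ltr_norml => /andP[Tw _].
  by move=> [[//|h] _ _]; lra.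
have [rho2 r2ab hr2] : exists2 rho2, al < rho2 < be & forall z, A z -> T z < rho2 ->
    sep E0 E1 z \/ sep E1 E0 z.
  have [Le|Le] := pselect (L !=set0); last first.
    exists rho1; first by lra.
    move=> z Az Tz; have [s0|n0] := pselect (sep E0 E1 z); first by left.
    have [s1|n1] := pselect (sep E1 E0 z); first by right.
    by exfalso; apply: Le; exists z; split=> //; right; exact: ltW.
  have [|z /set_mem Lz zmin] := @compact_EVT_min _ R T L Le cL.
    by apply: continuous_in_subspaceT => z /set_mem /LA /cT.
  have /andP[az zb] := Tab _ (LA _ Lz).
  exists (Num.min (T z) rho1).
    rewrite lt_min az /=; move: r1ab => /andP[-> r1r] /=.
    by apply: le_lt_trans zb; rewrite ge_min lexx.
  move=> w Aw; rewrite lt_min => /andP[Tw Tw1].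
  have [s0|n0] := pselect (sep E0 E1 w); first by left.
  have [s1|n1] := pselect (sep E1 E0 w); first by right.
  have : w \in L by rewrite inE; split=> //; right; exact: ltW.
  by move=> /zmin; rewrite leNgt Tw.
have touch (E E' : set C) : closed E -> E !=set0 -> E' !=set0 ->
    (forall z, E z -> ~ A z) -> (forall z, E z -> ~ E' z) -> closed E' ->
    (forall z, [\/ A z, E z | E' z]) ->
    exists z, [/\ A z, T z < rho2 & sep E E' z].
  move=> cE nE [y E'y] EA dE cE' cov.
  have [|e [Ee he]] := @frontier_point E cE nE; first by exists y => /dE.
  have /openP_plane /(_ e)[] := opn _ r2ab; first by left; exact: EA.
  move=> d d0 hd.
  have /openP_plane /(_ _ (subsep _ _ cE' dE _ Ee))[k k0 hk] := osep E E'.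
  have /closedP_plane /(_ _ (dE _ Ee))[l l0 hl] := cE'.
  have [|z [nEz]] := he (Num.min d (Num.min k l)); first by rewrite !lt_min d0 k0.
  rewrite !lt_min => /andP[/hd h /andP[/hk sz /hl nE'z]].
  have Az : A z by have [|/nEz|/nE'z] := cov z.
  by exists z; split=> //; case: h.
have [|z0 [Az0 Tz0 sz0]] := touch E0 E1 cE0 nE0 nE1 _ disj cE1 cover.
  by move=> z E0z Az; have [] := dA z Az.
have [||z1 [Az1 Tz1 sz1]] := touch E1 E0 cE1 nE1 nE0 _ disj' cE0.
- by move=> z E1z Az; have [] := dA z Az.
- by move=> z; have [?|?|?] := cover z; [apply: Or31|apply: Or33|apply: Or32].
apply: (dsep z1) => //.
apply: (connected_ind (conn _ r2ab) (P := sep E0 E1) _ (conj Az0 Tz0) sz0 (conj Az1 Tz1)).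
move=> x [Ax Tx]; have [s0|s1] := hr2 _ Ax Tx.
  have /openP_plane /(_ _ s0)[d d0 hd] := osep E0 E1.
  by exists d => // y _ /hd.
have /openP_plane /(_ _ s1)[d d0 hd] := osep E1 E0.
by exists d => // y _ /hd h; split=> h'; exfalso; [exact: dsep h' s1|exact: dsep h' h].
Qed.

End PlaneTopology.

(** * Winding numbers of the images of circles *)

Section Winding.
Variable R : realType.
Local Notation C := (plane R).
Implicit Types (z w b c p q : C) (k : int) (rho : R).

Variables (A : set C) (f h : C -> C) (r s : R).
Hypothesis r0 : 0 < r.
Hypothesis oA : open A.
Hypothesis fA : forall p, A p -> r < cabs (f p) < s.
Hypothesis hA : forall z, r < cabs z < s -> A (h z).
Hypothesis hf : forall p, A p -> h (f p) = p.
Hypothesis fh : forall z, r < cabs z < s -> f (h z) = z.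
Hypothesis nf : forall p, A p -> holo f p.
Hypothesis nh : forall z, r < cabs z < s -> holo h z.

(** The logarithmic derivative of [h - p] along circles around 0: its mean is
    the winding number of the image circle around [p]. *)
Definition logder p z : C := z * cder h z / (h z - p).

(** The image under [h] of the circle of radius [rho] has winding number [k]
    around [p]. The radii [r'] and [s'] leave room for [p] to lie on the images
    of other circles. *)
Definition wnd rho p k := exists r' s' : R,
  [/\ r <= r', r' < rho < s', s' <= s, forall z, r' < cabs z < s' -> h z != p
    & cmean 0 r' s' (logder p) k%:~R].

Lemma holo_logder p z : r < cabs z < s -> h z != p -> holo (logder p) z.
Proof.
move=> zr hz; apply: holoF; first by rewrite subr_eq0.
  by apply: holoM (holo_id _) _; apply: holo_cder; exact: nh.
by apply: holoB (holo_cst _ _); exact: nh.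
Qed.

(** [(h - p) * exp (- G)] is constant for a primitive [G], so the increment of
    [G] over a period is a multiple of 2 pi i. *)
Lemma wnd_int p (r' s' : R) rho : r <= r' -> s' <= s -> r' < rho < s' ->
  (forall z, r' < cabs z < s' -> h z != p) ->
  exists k, cmean 0 r' s' (logder p) k%:~R.
Proof.
move=> rr ss /andP[rho1 rho2] hp.
have in_rs x : r' < x < s' -> r < x < s by lra.
have [m [G hG]] : exists m, cmean 0 r' s' (logder p) m.
  apply: cmean_ex => z; rewrite subr0 => zr.
  by apply: holo_logder; [exact: in_rs|exact: hp].
have rho0 : 0 < rho by have := r0; lra.
pose x : C := (ln rho)%:C.
have xr : r' < expR (Re x) < s' by rewrite ReC lnK // rho1.
have xtr : r' < expR (Re (x + tpi R)) < s' by rewrite ReD Re_tpi addr0.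
pose D z := (h (cexp z) - p) * cexp (- G z).
have dD z : r' < expR (Re z) < s' -> cderiv D z 0.
  move=> zr; have ez : r' < cabs (cexp z) < s' by rewrite cabs_cexp.
  have hz : h (cexp z) - p != 0 by rewrite subr_eq0; exact: hp.
  have [dG _] := hG z zr.
  have dh := cderiv_cder (nh (in_rs _ ez)).
  have d1 := cderivB (cderiv_comp (cderiv_cexp z) dh) (cderiv_cst p z).
  have d2 := cderiv_comp (cderivN dG) (cderiv_cexp (- G z)).
  apply: cderiv_eq (cderivM d1 d2) _.
  by rewrite /logder add0r; field.
have := strip_cst dD xr xtr; rewrite /D cexp_period.
have hx : h (cexp x) - p != 0.
  by rewrite subr_eq0; apply: hp; rewrite cabs_cexp.
move=> /(mulfI hx) e.
have [_ Gx] := hG x xr.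
have [k hk] : exists k : int, tpi R * m = k%:~R * tpi R.
  apply: cexp_eq1; have -> : tpi R * m = - G x - - G (x + tpi R) by rewrite Gx; ring.
  by rewrite cexpB e divff // cexp_neq0.
exists k; rewrite -(_ : m = k%:~R); first by exists G.
by apply: (mulfI (tpi_neq0 R)); rewrite hk mulrC.
Qed.

Lemma wnd_uniq rho p k k' : wnd rho p k -> wnd rho p k' -> k = k'.
Proof.
move=> [r1 [s1 [rr1 /andP[a1 b1] ss1 _ m1]]] [r2 [s2 [rr2 /andP[a2 b2] ss2 _ m2]]].
have rho0 : 0 < rho by have := r0; lra.
have m1' : cmean 0 (Num.max r1 r2) (Num.min s1 s2) (logder p) k%:~R.
  by apply: cmean_sub m1 _ _; rewrite ?le_max ?ge_min lexx.
have m2' : cmean 0 (Num.max r1 r2) (Num.min s1 s2) (logder p) k'%:~R.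
  by apply: cmean_sub m2 _ _; rewrite ?le_max ?ge_min lexx orbT.
apply: (@intr_inj C); apply: cmean_uniq rho0 _ m1' m2'.
by rewrite gt_max lt_min a1 a2 b1 b2.
Qed.

Lemma compact_circle rho : compact [set z : C | cabs z = rho].
Proof.
apply: (@bounded_closed_compact_plane _ _ rho) => [|z /= ->//].
apply/closedP_plane => z /= zr.
exists `|cabs z - rho|; first by rewrite normr_gt0 subr_eq0; apply/eqP.
move=> w wz /= wr; move: wz; rewrite ltNge => /negP; apply.
rewrite -wr (cabsB w) ler_norml cabs_dist andbT lerNl opprB (cabsB z).
exact: cabs_dist.
Qed.

Lemma circle_neq0 rho : 0 < rho -> [set z : C | cabs z = rho] !=set0.
Proof. by move=> h0; exists rho%:C; rewrite /= cabsR ger0_norm // ltW. Qed.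

Lemma circle_num_bound rho : r < rho < s -> exists2 B : R, 0 < B &
  forall z, cabs z = rho -> cabs (z * cder h z) <= B.
Proof.
move=> rr; have rho0 : 0 < rho by have := r0; lra.
have [|z _ zmax] := @compact_EVT_max _ R (fun z => cabs (z * cder h z)) _
   (circle_neq0 rho0) (@compact_circle rho).
  apply: continuous_in_subspaceT => z /set_mem /= zr.
  have [cz _] : holo (fun z => z * cder h z) z.
    by apply: holoM (holo_id z) _; apply/holo_cder/nh; rewrite zr.
  exact: (@cts_cabs_comp _ (fun z => z * cder h z) z cz).
exists (cabs (z * cder h z) + 1); first by have := cabs_ge0 (z * cder h z); lra.
move=> w wr; have : w \in [set z : C | cabs z = rho] by rewrite inE.
by move=> /zmax; lra.
Qed.

Lemma circle_gap rho p : r < rho < s -> (forall z, cabs z = rho -> h z != p) ->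
  exists2 d : R, 0 < d & forall z, cabs z = rho -> d <= cabs (h z - p).
Proof.
move=> rr hp; have rho0 : 0 < rho by have := r0; lra.
have [|z /set_mem /= zr zmin] := @compact_EVT_min _ R (fun z => cabs (h z - p)) _
   (circle_neq0 rho0) (@compact_circle rho).
  apply: continuous_in_subspaceT => z /set_mem /= zr.
  have [cz _] : holo (fun z => h z - p) z.
    by apply: holoB (holo_cst p z); apply: nh; rewrite zr.
  exact: (@cts_cabs_comp _ (fun z => h z - p) z cz).
exists (cabs (h z - p)); first by rewrite cabs_gt0 subr_eq0 hp.
by move=> w wr; apply: zmin; rewrite inE.
Qed.

Lemma wnd_bound rho p k (B : R) : wnd rho p k ->
  (forall z, cabs z = rho -> cabs (logder p z) <= B) -> `|k|%:~R <= B.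
Proof.
move=> [r' [s' [rr /andP[a b] ss _ m]]] hB.
have rho0 : 0 < rho by have := r0; lra.
rewrite intr_norm -cabsR rmorph_int.
by apply: (cmean_bound m rho0) => [|z]; rewrite ?a // subr0; exact: hB.
Qed.

(** The mean is an integer that tends to 0 as [p] tends to infinity. *)
Lemma wnd_inf rho : r < rho < s -> exists M : R, forall p, M < cabs p ->
  forall k, wnd rho p k -> k = 0.
Proof.
move=> rr; have rho0 : 0 < rho by have := r0; lra.
have [B B0 hB] := circle_num_bound rr.
have [|z _ zmax] := @compact_EVT_max _ R (fun z => cabs (h z)) _
   (circle_neq0 rho0) (@compact_circle rho).
  apply: continuous_in_subspaceT => z /set_mem /= zr.
  have [cz _] : holo h z by apply: nh; rewrite zr.
  exact: (@cts_cabs_comp _ h z cz).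
exists (cabs (h z) + B + 1) => p pM k kp.
have : (`|k|%:~R : R) <= B / (B + 1).
  apply: (wnd_bound kp) => w wr; rewrite cabs_div.
  have hw : cabs (h w) <= cabs (h z) by apply: zmax; rewrite inE.
  have hwp : B + 1 <= cabs (h w - p).
    by have := cabs_dist p (h w); rewrite (cabsB p); lra.
  apply: ler_pM; rewrite ?invr_ge0 ?cabs_ge0 ?hB //.
  by rewrite lef_pV2 ?posrE //; lra.
have B1 : B / (B + 1) < 1 by rewrite ltr_pdivrMr; lra.
move=> /le_lt_trans /(_ B1).
rewrite -[1]/(1%:~R) ltr_int => k1; apply/eqP; rewrite -normr_eq0.
by move: k1; case: (`|k|) (normr_ge0 k) => [[|n]|n].
Qed.

Lemma wnd_out p : ~ A p -> r < s -> exists k, forall rho, r < rho < s -> wnd rho p k.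
Proof.
move=> nA rs.
have hp z : r < cabs z < s -> h z != p.
  by move=> zr; apply/negP => /eqP hz; apply: nA; rewrite -hz; exact: hA.
have rr : r < (r + s) / 2 < s by lra.
have [k hk] := wnd_int (lexx r) (lexx s) rr hp.
by exists k => rho hrho; exists r, s; split.
Qed.

Lemma cder_h_neq0 z : r < cabs z < s -> cder h z != 0.
Proof.
move=> zr; have d1 := cderiv_cder (nh zr); have d2 := cderiv_cder (nf (hA zr)).
have := cderiv_comp d1 d2 => d3.
have d4 : cderiv (fun w => f (h w)) z 1.
  apply: cderiv_near (cderiv_id z); apply/near_plane.
  exists (Num.min (cabs z - r) (s - cabs z)).
    by rewrite lt_min !subr_gt0.
  move=> w; rewrite lt_min => /andP[w1 w2]; rewrite fh //.
  have := cabs_dist z w; have := cabs_dist w z; rewrite (cabsB z w).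
  by move: zr => /andP[? ?] ? ?; apply/andP; split; lra.
have := cderiv_uniq d3 d4; apply: contra_eq_neq => ->.
by rewrite mulr0 eq_sym oner_neq0.
Qed.

(** With [h z - h z0 = (z - z0) * u z], the logarithmic derivative is the sum of
    [z / (z - z0)], of mean 1 over circles larger than the one through [z0] and
    0 over smaller ones, and of that of [u], which has no zeros, so that its
    mean is the same over all circles. *)
Lemma wnd_in z0 : r < cabs z0 < s -> exists k,
  (forall rho, cabs z0 < rho < s -> wnd rho (h z0) k) /\
  (forall rho, r < rho < cabs z0 -> wnd rho (h z0) (k - 1)).
Proof.
move=> zr; have /andP[zr1 zr2] := zr.
pose u := dquot h z0.
have nu z : r < cabs z < s -> holo u z by move=> /nh; apply: holo_dquot; exact: nh.
have hz0 z : z != z0 -> r < cabs z < s -> h z != h z0.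
  move=> zz0 zs; apply/negP => /eqP e; move/eqP: zz0; apply.
  by rewrite -(fh zs) e fh.
have hE z : h z = h z0 + (z - z0) * u z by exact: dquotE.
have u0 z : r < cabs z < s -> u z != 0.
  move=> zs; have [->|zz0] := eqVneq z z0.
    by rewrite /u /dquot eqxx cder_h_neq0.
  apply: contra_neq (hz0 z zz0 zs) => uz; by rewrite (hE z) uz mulr0 addr0.
have dh z : r < cabs z < s -> cder h z = u z + (z - z0) * cder u z.
  move=> zs; apply: cderE.
  apply: cderiv_ext (_ : (fun w => h z0 + (w - z0) * u w) =1 h) _.
    by move=> w; rewrite (hE w).
  apply: cderiv_eq.
    apply: cderivD (cderiv_cst _ _) _.
    apply: cderivM (cderivB (cderiv_id z) (cderiv_cst z0 z)) _.
    exact: cderiv_cder (nu _ zs).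
  by rewrite add0r subr0 mulr1 addrC.
have [m hm] : exists m, cmean 0 r s (fun z => z * cder u z / u z) m.
  apply: cmean_ex => z; rewrite subr0 => zs.
  apply: holoF (u0 _ zs) _ (nu _ zs).
  by apply: holoM (holo_id _) _; apply: holo_cder; exact: nu.
have key z : z != z0 -> r < cabs z < s ->
    z / (z - z0) + z * cder u z / u z = logder (h z0) z.
  move=> zz0 zs; rewrite /logder (dh z zs) (hE z) [h z0 + _]addrC addrK.
  by field; rewrite u0 // subr_eq0.
have mp : cmean 0 (cabs z0) s (logder (h z0)) (1 + m).
  have hk : cmean 0 (cabs z0) s (fun z => (z - 0) / (z - z0)) 1.
    by have := @cmean_kernel _ 0 z0 s; rewrite subr0; apply.
  have := cmeanD hk (cmean_sub hm (ltW zr1) (lexx s)).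
  move=> /cmean_eq; apply => z; rewrite subr0 => /andP[z1 z2].
  apply: key; last by rewrite z2 (lt_trans zr1).
  by apply/negP => /eqP e; rewrite e ltxx in z1.
have mm : cmean 0 r (cabs z0) (logder (h z0)) m.
  have nk z : cabs z < cabs z0 -> holo (fun z => (z - 0) / (z - z0)) z.
    move=> zz; apply: holoF (holo_subr _ _) (holo_subr _ _).
    by rewrite subr_eq0; apply/negP => /eqP e; rewrite e ltxx in zz.
  have z00 : 0 < cabs z0 by have := r0; lra.
  have [m' hm'] : exists m, cmean 0 0 (cabs z0) (fun z => (z - 0) / (z - z0)) m.
    by apply: cmean_ex => z; rewrite subr0 => /andP[_]; exact: nk.
  have e0 : m' = 0.
    have [c0 _] : holo (fun z => (z - 0) / (z - z0)) 0 by apply: nk; rewrite cabs0.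
    by rewrite (cmean_center z00 c0 hm') subrr mul0r.
  rewrite e0 in hm'.
  have := cmeanD (cmean_sub hm' (ltW r0) (lexx _)) (cmean_sub hm (lexx r) (ltW zr2)).
  rewrite add0r => /cmean_eq; apply => z; rewrite subr0 => /andP[z1 z2].
  apply: key; last by rewrite z1 (lt_trans z2).
  by apply/negP => /eqP e; rewrite e ltxx in z2.
have hpp z : cabs z0 < cabs z < s -> h z != h z0.
  move=> /andP[z1 z2]; apply: hz0; last by rewrite z2 (lt_trans zr1).
  by apply/negP => /eqP e; rewrite e ltxx in z1.
have hpm z : r < cabs z < cabs z0 -> h z != h z0.
  move=> /andP[z1 z2]; apply: hz0; last by rewrite z1 (lt_trans z2).
  by apply/negP => /eqP e; rewrite e ltxx in z2.
have rp : cabs z0 < (cabs z0 + s) / 2 < s by lra.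
have [k hk] := wnd_int (ltW zr1) (lexx s) rp hpp.
have km : k%:~R = 1 + m.
  have rp0 : 0 < (cabs z0 + s) / 2 by have := r0; lra.
  exact: cmean_uniq rp0 rp hk mp.
exists k; split=> rho hr.
  by exists (cabs z0), s; split=> //; exact: ltW.
exists r, (cabs z0); split=> //; first exact: ltW.
by rewrite intrB km addrC addKr.
Qed.

Lemma wnd_ex rho p : r < rho < s -> (forall z, cabs z = rho -> h z != p) ->
  exists k, wnd rho p k.
Proof.
move=> /andP[rr rs] hp.
have [Ap|nA] := pselect (A p); last first.
  by have [|k hk] := wnd_out nA; [lra|exists k; apply: hk; rewrite rr].
have zr := fA Ap.
have [k [k1 k2]] := wnd_in zr; rewrite hf // in k1 k2.
have [e|e|e] := ltgtP (cabs (f p)) rho.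
- by exists k; apply: k1; rewrite e.
- by exists (k - 1); apply: k2; rewrite rr.
- by have := hp (f p) e; rewrite hf // eqxx.
Qed.

(** The mean depends continuously on [p] and takes integer values. *)
Lemma wnd_loc rho p0 : r < rho < s -> (forall z, cabs z = rho -> h z != p0) ->
  exists2 e : R, 0 < e & forall p, cabs (p - p0) < e ->
    (forall z, cabs z = rho -> h z != p) /\ forall k, wnd rho p0 k -> wnd rho p k.
Proof.
move=> rr hp0; have [B B0 hB] := circle_num_bound rr.
have [d d0 hd] := circle_gap rr hp0.
(* The integrands differ by at most [B * cabs (p - p0) / (d * (d / 2))], which
   this choice makes at most 1 / 2. *)
pose e := Num.min (d / 2) (d * d / (4 * B)).
have e0 : 0 < e by rewrite lt_min !divr_gt0 ?mulr_gt0.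
exists e => // p; rewrite lt_min => /andP[p1 p2].
have hp z : cabs z = rho -> d / 2 <= cabs (h z - p).
  by move=> /hd h1; have := cabs_trianB (h z) p p0; lra.
have hpn z : cabs z = rho -> h z != p.
  by move=> /hp h1; rewrite -subr_eq0 -cabs_gt0; lra.
split=> // k0 wk0.
have [k wk] := wnd_ex rr hpn.
suff -> : k0 = k by [].
move: wk wk0 => [r1 [s1 [rr1 /andP[a1 b1] ss1 _ m1]]] [r2 [s2 [rr2 /andP[a2 b2] ss2 _ m2]]].
have rho0 : 0 < rho by have := r0; lra.
have m1' : cmean 0 (Num.max r1 r2) (Num.min s1 s2) (logder p) k%:~R.
  by apply: cmean_sub m1 _ _; rewrite ?le_max ?ge_min lexx.
have m2' : cmean 0 (Num.max r1 r2) (Num.min s1 s2) (logder p0) k0%:~R.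
  by apply: cmean_sub m2 _ _; rewrite ?le_max ?ge_min lexx orbT.
have hm := cmeanB m2' m1'.
have rin : Num.max r1 r2 < rho < Num.min s1 s2 by rewrite gt_max lt_min a1 a2 b1 b2.
have := cmean_bound (B := 1 / 2) hm rho0 rin.
suff H : forall z, cabs (z - 0) = rho -> cabs (logder p0 z - logder p z) <= 1 / 2.
  move=> /(_ H); rewrite -intrB -(rmorph_int (real_complex R)) cabsR -intr_norm => h1.
  have : (`|k0 - k|%:~R : R) < 1%:~R by apply: le_lt_trans h1 _; lra.
  rewrite ltr_int => h2; apply/eqP; rewrite -subr_eq0 -normr_eq0.
  by move: h2; case: (`|k0 - k|) (normr_ge0 (k0 - k)) => [[|n]|n].
move=> z; rewrite subr0 => zr.
have n0 : h z - p0 != 0 by rewrite subr_eq0 hp0.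
have n1 : h z - p != 0 by rewrite subr_eq0 hpn.
have -> : logder p0 z - logder p z =
   (z * cder h z) * (p0 - p) / ((h z - p0) * (h z - p)).
  by rewrite /logder; field; rewrite n0 n1.
rewrite cabs_div !(cabsM _ (h z - p)) (cabsM _ (p0 - p)) (cabsB p0).
have dd : d * (d / 2) <= cabs (h z - p0) * cabs (h z - p).
  by apply: ler_pM; rewrite ?hd ?hp //; lra.
have dd0 : 0 < d * (d / 2) by rewrite mulr_gt0 // divr_gt0.
rewrite ler_pdivrMr; last exact: lt_le_trans dd.
apply: (@le_trans _ _ (1 / 2 * (d * (d / 2)))); last by rewrite ler_wpM2l.
apply: (@le_trans _ _ (B * (d * d / (4 * B)))).
  by apply: ler_pM; rewrite ?cabs_ge0 ?hB // ltW.
by rewrite le_eqVlt; apply/orP; left; apply/eqP; field; lra.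
Qed.

(** The number given by [wnd_in] is locally constant in [z0], which runs
    through a connected set. *)
Lemma wnd_A : r < s -> exists N, forall p rho, A p ->
  (cabs (f p) < rho < s -> wnd rho p N) /\
  (r < rho < cabs (f p) -> wnd rho p (N - 1)).
Proof.
move=> rs.
have /choice[K hK] : forall z, exists k, r < cabs z < s ->
    (forall rho, cabs z < rho < s -> wnd rho (h z) k) /\
    (forall rho, r < rho < cabs z -> wnd rho (h z) (k - 1)).
  move=> z; have [zr|nzr] := pselect (r < cabs z < s); last by exists 0 => /nzr.
  by have [k hk] := wnd_in zr; exists k.
pose a : C := ((r + s) / 2)%:C.
have ar : r < cabs a < s.
  by rewrite cabsR ger0_norm; have := r0; [lra|move: rs; lra].
have cA : connected [set z : C | r < cabs z < s].
  have := @annulus_connected R 0 r s (ltW r0).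
  by rewrite (_ : [set z | _] = [set z | r < cabs z < s]) //; apply/seteqP; split=> z /=; rewrite subr0.
have Kc z : r < cabs z < s -> K a = K z.
  apply: (connected_ind cA (P := fun z => K a = K z) _ ar) => // {}z /= zr.
  have /andP[zr1 zr2] := zr.
  pose rho := (cabs z + s) / 2.
  have rr : cabs z < rho < s by rewrite /rho; lra.
  have rr' : r < rho < s by lra.
  have [|e e0 he] := @wnd_loc rho (h z) rr'.
    move=> w wr; apply/negP => /eqP hw; have := fh zr; rewrite -hw fh ?wr // => wz.
    by move: rr; rewrite -wr wz ltxx.
  have [/cts_plane /(_ _ e0)[d d0 hd] _] := nh zr.
  exists (Num.min d (rho - cabs z)); first by rewrite lt_min d0 subr_gt0; case/andP: rr.
  move=> y yr; rewrite lt_min => /andP[/hd /he[_ hy] y2].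
  suff -> : K z = K y by [].
  have yrho : cabs y < rho < s by have := cabs_dist y z; case/andP: rr => *; apply/andP; split; lra.
  have [h1 _] := hK z zr; have [h2 _] := hK y yr.
  exact: wnd_uniq (hy _ (h1 _ rr)) (h2 _ yrho).
exists (K a) => p rho Ap; have fp := fA Ap.
by have [h1 h2] := hK _ fp; rewrite -(Kc _ fp) hf // in h1 h2; split; [exact: h1|exact: h2].
Qed.

(** Off [A] no image of a circle is met, so the winding number is locally
    constant. *)
Lemma wnd_E (E : set C) : r < s -> connected E -> (forall p, E p -> ~ A p) ->
  E !=set0 -> exists k, forall p rho, E p -> r < rho < s -> wnd rho p k.
Proof.
move=> rs cE EA [a Ea].
have /choice[K hK] : forall p, exists k, ~ A p -> forall rho, r < rho < s -> wnd rho p k.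
  move=> p; have [Ap|nA] := pselect (A p); first by exists 0.
  by have [k hk] := wnd_out nA rs; exists k.
have rr : r < (r + s) / 2 < s by lra.
exists (K a) => p rho Ep hr; have -> : K a = K p; last exact: hK (EA _ Ep) _ hr.
apply: (connected_ind cE (P := fun z => K a = K z) _ Ea) => // x Ex.
have [|e e0 he] := @wnd_loc _ x rr.
  by move=> w wr; apply/negP => /eqP hw; apply: (EA x Ex); rewrite -hw; apply: hA; rewrite wr.
exists e => // y Ey /he[_ hy]; suff -> : K x = K y by [].
exact: wnd_uniq (hy _ (hK _ (EA _ Ex) _ rr)) (hK _ (EA _ Ey) _ rr).
Qed.

Section TwoComponents.
Variables E0 E1 : set C.
Hypotheses (cE0 : closed E0) (cE1 : closed E1).
Hypotheses (nE0 : E0 !=set0) (nE1 : E1 !=set0).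
Hypothesis cover : forall z, [\/ A z, E0 z | E1 z].
Hypothesis disj : forall z, E0 z -> ~ E1 z.
Hypothesis dA : forall z, A z -> ~ E0 z /\ ~ E1 z.

(** If points of the complement of [A] have the same winding number as the points
    of [A] on one side of each image circle, that side together with the
    complement is the set of all points with this winding number; it is open
    because winding numbers are locally constant. At least one of the two
    winding numbers is not 0, so one of the two sides is bounded. The function
    [g] is the identity or the opposite, according to the side. *)
Lemma common_winding_absurd (g : R -> R) (al be : R) (nu nu' : int) :
  involutive g -> continuous g -> al < be ->
  (forall x, (al < x < be) = (r < g x < s)) ->
  (forall rho, al < rho < be -> connected [set z : C | r < cabs z < s /\ g (cabs z) < rho]) ->
  (forall p rho, A p -> al < rho < be -> g (cabs (f p)) < rho -> wnd (g rho) p nu) ->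
  (forall p rho, A p -> al < rho < be -> rho < g (cabs (f p)) -> wnd (g rho) p nu') ->
  (forall p rho, ~ A p -> al < rho < be -> wnd (g rho) p nu) ->
  nu != nu' -> False.
Proof.
move=> gK cg ab gab conn lo hi out nn.
have Wn p rho : al < rho < be -> ~ A p \/ g (cabs (f p)) < rho -> wnd (g rho) p nu.
  move=> hr [nA|gr]; first exact: out.
  have [Ap|nA] := pselect (A p); [exact: lo|exact: out].
apply: (@one_ended_ring_absurd _ A E0 E1 (fun p => g (cabs (f p))) al be) => //.
- move=> p Ap; have [cf _] := nf Ap.
  exact: (@continuous_comp _ _ _ (fun p => cabs (f p)) g) (@cts_cabs_comp _ f p cf) (cg _).
- by move=> p /fA; rewrite gab gK.
- move=> rho; rewrite gab => hr.
  have gr : cabs ((g rho)%:C : C) = g rho.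
    by rewrite cabsR ger0_norm //; have := r0; lra.
  by exists (h (g rho)%:C); [apply: hA; rewrite gr|rewrite fh gr ?gK].
- move=> rho hr.
  rewrite (_ : [set z | _] = h @` [set z : C | r < cabs z < s /\ g (cabs z) < rho]).
    by apply: image_connected; [exact: conn|move=> z [/nh[]]].
  apply/seteqP; split=> [p [Ap h1]|_ [z [zr z1] <-]].
    by exists (f p); [split; [exact: fA|]|exact: hf].
  by split; [exact: hA|rewrite fh].
- move=> rho hr; apply/openP_plane => p hp.
  have hr' : r < g rho < s by rewrite -gab.
  have [|e e0 he] := @wnd_loc (g rho) p hr'.
    move=> w wr; apply/negP => /eqP hw.
    have wrs : r < cabs w < s by rewrite wr.
    case: hp => [|]; first by rewrite -hw => /(_ (hA wrs)).
    by rewrite -hw fh // wr gK ltxx.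
  exists e => // q /he[nq hq]; have [Aq|nAq] := pselect (A q); last by left.
  right; have [//|h1|h1] := ltgtP (g (cabs (f q))) rho.
    by move: nn; rewrite (wnd_uniq (hq _ (Wn _ _ hr hp)) (hi _ _ Aq hr h1)) eqxx.
  have fq : cabs (f q) = g rho by rewrite -h1 gK.
  by have := nq (f q) fq; rewrite hf // eqxx.
- move=> rho hr; have hr' : r < g rho < s by rewrite -gab.
  have [M hM] := wnd_inf hr'.
  have bM p k : wnd (g rho) p k -> k != 0 -> cabs p <= M.
    move=> w k0; rewrite leNgt; apply/negP => /hM /(_ _ w) k1.
    by rewrite k1 eqxx in k0.
  have [nu0|nu0] := eqVneq nu 0; [right|left]; exists M.
    move=> p Ap /(hi _ _ Ap hr) /bM; apply.
    by rewrite -nu0 eq_sym.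
  by move=> p /(Wn _ _ hr) /bM; apply.
Qed.

(** A frontier point of [E] is a limit of points of [A], whose winding numbers
    are [N] and [N - 1]. *)
Lemma frontier_winding (E E' : set C) N k : r < s -> closed E -> closed E' ->
  E !=set0 -> E' !=set0 -> (forall z, E z -> ~ E' z) -> (forall z, E z -> ~ A z) ->
  (forall z, [\/ A z, E z | E' z]) ->
  (forall p rho, A p -> (cabs (f p) < rho < s -> wnd rho p N) /\
    (r < rho < cabs (f p) -> wnd rho p (N - 1))) ->
  (forall p rho, E p -> r < rho < s -> wnd rho p k) -> k = N \/ k = N - 1.
Proof.
move=> rs cE cE' nE [y E'y] dE EA cov hN hk.
have [|e [Ee he]] := frontier_point cE nE; first by exists y => /dE.
have rr : r < (r + s) / 2 < s by lra.
have [|d d0 hd] := @wnd_loc _ e rr.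
  by move=> w wr; apply/negP => /eqP hw; apply: (EA e Ee); rewrite -hw; apply: hA; rewrite wr.
have /closedP_plane /(_ _ (dE _ Ee))[l l0 hl] := cE'.
have [|p [nEp]] := he (Num.min d l); first by rewrite lt_min d0.
rewrite lt_min => /andP[/hd[np hp] /hl nE'p].
have Ap : A p by have [|/nEp|/nE'p] := cov p.
have w := hp _ (hk _ _ Ee rr); have fp := fA Ap.
have [h1 h2] := hN p ((r + s) / 2) Ap.
have [e1|e1|e1] := ltgtP (cabs (f p)) ((r + s) / 2).
- by left; apply: wnd_uniq w (h1 _); rewrite e1 /=; case/andP: rr.
- by right; apply: wnd_uniq w (h2 _); rewrite e1 andbT; case/andP: rr.
- by have := np (f p) e1; rewrite hf // eqxx.
Qed.

Hypotheses (kE0 : connected E0) (kE1 : connected E1).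

(** Both winding numbers are [N] or [N - 1], and they cannot agree by
    [common_winding_absurd]. *)
Lemma winding_jump a b : r < s -> E0 a -> E1 b ->
  exists m : C, cmean 0 r s (fun z => logder a z - logder b z) m /\ 1 <= cabs m.
Proof.
move=> rs Ea Eb.
have E0A p : E0 p -> ~ A p by move=> h0 /dA[].
have E1A p : E1 p -> ~ A p by move=> h1 /dA[].
have disj' z : E1 z -> ~ E0 z by move=> h1 h0'; exact: disj h0' h1.
have cover' z : [\/ A z, E1 z | E0 z].
  by have [?|?|?] := cover z; [apply: Or31|apply: Or33|apply: Or32].
have [N hN] := wnd_A rs.
have [k0 hk0] := wnd_E rs kE0 E0A nE0.
have [k1 hk1] := wnd_E rs kE1 E1A nE1.
have f0 := frontier_winding rs cE0 cE1 nE0 nE1 disj E0A cover hN hk0.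
have f1 := frontier_winding rs cE1 cE0 nE1 nE0 disj' E1A cover' hN hk1.
have k01 : k0 <> k1.
  move=> e.
  have out p rho : ~ A p -> r < rho < s -> wnd rho p k0.
    by move=> nA hr; have [//|h0|h1] := cover p; [exact: hk0|rewrite e; exact: hk1].
  case: f0 => k0E.
    apply: (@common_winding_absurd id r s N (N - 1)) => //.
    - by move=> x; exact: cvg_id.
    - move=> rho hr.
      have := @annulus_connected R 0 r rho (ltW r0); congr connected.
      apply/seteqP; split=> z /=; rewrite subr0; first by move=> /andP[-> h2]; split=> //; lra.
      by move=> [/andP[-> _] ->].
    - by move=> p rho Ap /andP[_ h2] h1; have [H _] := hN p rho Ap; apply: H; rewrite h1.
    - by move=> p rho Ap /andP[h2 _] h1; have [_ H] := hN p rho Ap; apply: H; rewrite h2.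
    - by rewrite -k0E.
    - lia.
  apply: (@common_winding_absurd (@GRing.opp R) (- s) (- r) (N - 1) N) => //.
  - exact: opprK.
  - by move=> x; apply: (@continuousN R R R id); exact: cvg_id.
  - by rewrite ltrN2.
  - by move=> x; rewrite ltrNl ltrNr andbC.
  - move=> rho hr.
    have nr : 0 <= - rho by have := r0; lra.
    have := @annulus_connected R 0 (- rho) s nr; congr connected.
    apply/seteqP; split=> z /=; rewrite subr0; first by move=> /andP[h1 h2]; split; lra.
    by move=> [/andP[h1 h2] h3]; lra.
  - move=> p rho Ap /andP[h2 h3] h1; have [_ H] := hN p (- rho) Ap; apply: H; lra.
  - move=> p rho Ap /andP[h2 h3] h1; have [H _] := hN p (- rho) Ap; apply: H; lra.
  - by move=> p rho nA hr; rewrite -k0E; apply: out => //; lra.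
  - lia.
have rr : r < (r + s) / 2 < s by lra.
have w0 : forall z, r < cabs z < s -> h z != a.
  by move=> z /hA Az; apply/negP => /eqP e; apply: (E0A a Ea); rewrite -e.
have w1 : forall z, r < cabs z < s -> h z != b.
  by move=> z /hA Az; apply/negP => /eqP e; apply: (E1A b Eb); rewrite -e.
have [j0 hj0] := wnd_int (lexx r) (lexx s) rr w0.
have [j1 hj1] := wnd_int (lexx r) (lexx s) rr w1.
have e0 : j0 = k0.
  by apply: wnd_uniq (hk0 a _ Ea rr); exists r, s; split.
have e1 : j1 = k1.
  by apply: wnd_uniq (hk1 b _ Eb rr); exists r, s; split.
exists (j0%:~R - j1%:~R); split; first exact: cmeanB.
rewrite -intrB -(rmorph_int (real_complex R)) cabsR -intr_norm.
rewrite -[1]/(1%:~R) ler_int e0 e1; lia.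
Qed.

End TwoComponents.
End Winding.

(** * The modulus of a ring that misses a scale-perfect set *)

Section ModulusBound.
Variable R : realType.
Local Notation C := (plane R).
Implicit Types (z w p q : C) (A F : set C).

(** The metric form of uniform perfectness: up to the factor [c], each point of
    [F] sees other points of [F] at all distances up to the farthest one. *)
Definition scale_perfect F (c : R) := 0 < c < 1 /\
  forall a b (rho : R), F a -> F b -> 0 < rho <= cabs (a - b) ->
    exists k, F k /\ c * rho <= cabs (k - a) <= rho.

(** For [t <= 1] take a point [k] of [F] at distance about [t * cabs (a - b) / 2]
    from [a]; for larger [t] exchange [a] and [b]. *)
Lemma ratio_net F c a b (t : R) : scale_perfect F c -> F a -> F b -> a != b ->
  0 < t -> exists k, [/\ F k, k != a, k != b &
    c / 3 * t <= cabs (k - a) / cabs (k - b) <= 3 / c * t].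
Proof.
move=> [/andP[c0 c1] sp].
wlog t1 : a b t / t <= 1.
  move=> H Fa Fb ab t0; have [t1|t1] := leP t 1; first exact: H.
  have [|||||k [Fk kb ka /andP[h1 h2]]] := H b a t^-1; rewrite ?invr_gt0 //.
  - by rewrite invf_le1 // ltW.
  - by rewrite eq_sym.
  have p1 : 0 < cabs (k - a) by rewrite cabs_gt0 subr_eq0.
  have p2 : 0 < cabs (k - b) by rewrite cabs_gt0 subr_eq0.
  exists k; split=> //; have -> : cabs (k - a) / cabs (k - b) = (cabs (k - b) / cabs (k - a))^-1.
    by rewrite invf_div.
  have q0 : 0 < cabs (k - b) / cabs (k - a) by rewrite divr_gt0.
  have -> : c / 3 * t = (3 / c * t^-1)^-1 by rewrite invfM invrK invf_div.
  have -> : 3 / c * t = (c / 3 * t^-1)^-1 by rewrite invfM invrK invf_div.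
  by rewrite !lef_pV2 ?posrE ?h1 ?h2 ?mulr_gt0 ?invr_gt0 ?divr_gt0.
move=> Fa Fb ab t0.
pose d := cabs (a - b); have d0 : 0 < d by rewrite cabs_gt0 subr_eq0.
have rho0 : 0 < t * d / 2 <= d.
  by rewrite divr_gt0 ?mulr_gt0 //= ler_pdivrMr // mulrC ler_pM2l //; lra.
have [k [Fk /andP[k1 k2]]] := sp a b (t * d / 2) Fa Fb rho0.
have td : t * d <= d by rewrite ler_piMl // ltW.
have ka : 0 < cabs (k - a).
  by apply: lt_le_trans k1; rewrite mulr_gt0 // divr_gt0 // mulr_gt0.
have kb1 : d / 2 <= cabs (k - b).
  by have := cabs_trianB a k b; rewrite (cabsB a k) -/d; lra.
have kb2 : cabs (k - b) <= 3 / 2 * d.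
  by have := cabs_trianB k a b; rewrite -/d; lra.
have kb : 0 < cabs (k - b) by lra.
exists k; split; rewrite ?Fk //.
- by rewrite -subr_eq0 -cabs_gt0.
- by rewrite -subr_eq0 -cabs_gt0.
rewrite ler_pdivlMr // ler_pdivrMr //; apply/andP; split.
  apply: (@le_trans _ _ (c / 3 * t * (3 / 2 * d))).
    by rewrite ler_wpM2l // mulr_ge0 ?divr_ge0 // ltW.
  by apply: le_trans k1; rewrite le_eqVlt; apply/orP; left; apply/eqP; field.
apply: le_trans k2 _.
apply: (@le_trans _ _ (1 * t * (d / 2))); first by rewrite le_eqVlt; apply/orP; left; apply/eqP; field.
apply: ler_pM => //; [by lra|by lra|].
by rewrite ler_pM2r // ler_pdivlMr //; lra.
Qed.

(** The real part of a logarithm of [(k - a) / (k - b)] is controlled by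
    [ratio_net], its imaginary part by periodicity. *)
Lemma log_net F c a b v : scale_perfect F c -> F a -> F b -> a != b ->
  exists k q, [/\ F k, k != a, k != b, (k - a) / (k - b) = cexp q &
    cabs (v - q) <= ln (3 / c) + pi *+ 2].
Proof.
move=> sp Fa Fb ab; have [/andP[c0 c1] _] := sp.
have [k [Fk ka kb /andP[k1 k2]]] := ratio_net sp Fa Fb ab (expR_gt0 (Re v)).
have c3 : 0 < 3 / c by rewrite divr_gt0.
have [w hw] : exists w, (k - a) / (k - b) = cexp w.
  by apply: polar; rewrite mulf_neq0 ?invr_eq0 ?subr_eq0.
have p0 := pi2_gt0 R.
pose j := Num.floor ((Im v - Im w) / (pi *+ 2)).
have /andP[j1 j2] := floor_itv ((Im v - Im w) / (pi *+ 2)).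
rewrite -/j ler_pdivlMr // in j1.
rewrite -/j ltr_pdivrMr // intrD mulrDl mul1r in j2.
exists k, (w + j%:~R * tpi R); split; rewrite ?Fk ?cexp_periodz //.
apply: le_trans (cabs_le_ReIm _) _.
have jR : (j%:~R : C) = (j%:~R)%:C by rewrite rmorph_int.
rewrite jR !(Re_tpi, Im_tpi, ReImE).
rewrite !(mulr0, mul0r, subr0, addr0); apply: lerD; last first.
  by rewrite ger0_norm; lra.
have ew : expR (Re w) = cabs (k - a) / cabs (k - b).
  by rewrite -cabs_cexp -hw cabs_div.
rewrite -ew -[3 / c]lnK ?posrE // -expRD ler_expR in k2.
have e3 : c / 3 = expR (- ln (3 / c)) by rewrite expRN lnK ?posrE // invf_div.
rewrite -ew e3 -expRD ler_expR in k1.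
by rewrite ler_norml; lra.
Qed.

Lemma moebius_inj (a b x k : C) : a != b -> x != b -> k != b ->
  (x - a) / (x - b) = (k - a) / (k - b) -> x = k.
Proof.
move=> ab xb kb e.
have xb' : x - b != 0 by rewrite subr_eq0.
have kb' : k - b != 0 by rewrite subr_eq0.
have : (a - b) * (x - k) = 0.
  have -> : (a - b) * (x - k) =
     ((x - a) / (x - b) - (k - a) / (k - b)) * ((x - b) * (k - b)).
    by field; rewrite xb' kb'.
  by rewrite e subrr mul0r.
by move=> /eqP; rewrite mulf_eq0 !subr_eq0 (negbTE ab) /= => /eqP.
Qed.

Section Ring.
Variables (A E0 E1 F : set C) (f h : C -> C) (r s c : R) (a b : C).
Hypotheses (r0 : 0 < r) (rs : r < s) (oA : open A).
Hypothesis fA : forall p, A p -> r < cabs (f p) < s.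
Hypothesis hA : forall z, r < cabs z < s -> A (h z).
Hypothesis hf : forall p, A p -> h (f p) = p.
Hypothesis fh : forall z, r < cabs z < s -> f (h z) = z.
Hypothesis nf : forall p, A p -> holo f p.
Hypothesis nh : forall z, r < cabs z < s -> holo h z.
Hypotheses (cE0 : closed E0) (cE1 : closed E1).
Hypothesis cover : forall z, [\/ A z, E0 z | E1 z].
Hypothesis disj : forall z, E0 z -> ~ E1 z.
Hypothesis dA : forall z, A z -> ~ E0 z /\ ~ E1 z.
Hypotheses (kE0 : connected E0) (kE1 : connected E1).
Hypotheses (E0a : E0 a) (E1b : E1 b) (Fa : F a) (Fb : F b).
Hypothesis FA : forall p, F p -> ~ A p.
Hypothesis sp : scale_perfect F c.

(** On the strip [ln r < Re z < ln s] the function [Q z = (h (cexp z) - a) /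
    (h (cexp z) - b)] has a logarithm [V], which omits the net of [log_net]
    because [h] omits [F]. By [bloch] its derivative on the middle line is
    O(1 / (ln s - ln r)), while the mean of this derivative is the difference of
    the winding numbers around [a] and [b], at least 1 in modulus. *)
Lemma ring_modulus : ln s - ln r <= 768 * (ln (3 / c) + pi *+ 2).
Proof.
have ab : a != b by apply/negP => /eqP e; apply: (disj E0a); rewrite e.
pose lam z := logder h a z - logder h b z.
have hp p z : F p -> r < cabs z < s -> h z != p.
  by move=> Fp /hA Az; apply/negP => /eqP e; apply: (FA Fp); rewrite -e.
have nlam z : r < cabs z < s -> holo lam z.
  by move=> zr; apply: holoB; apply: (holo_logder nh zr); exact: hp.
have [m [hm m1]] : exists m : C, cmean 0 r s lam m /\ 1 <= cabs m.
  have nE0 : E0 !=set0 by exists a.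
  have nE1 : E1 !=set0 by exists b.
  exact: (winding_jump r0 oA fA hA hf fh nf nh cE0 cE1 nE0 nE1 cover disj dA
    kE0 kE1 rs E0a E1b).
have s0 : 0 < s by exact: lt_trans rs.
(* Discs of radius [L] centred on the middle line lie well inside the strip,
   whose width is [4 * L]. *)
pose L := (ln s - ln r) / 4; pose mu := (ln r + ln s) / 2.
have lrs : ln r < ln s by rewrite ltr_ln ?posrE.
have L0 : 0 < L by rewrite /L; lra.
have strip z : (r < expR (Re z) < s) = (ln r < Re z < ln s).
  by rewrite -{1}[r]lnK ?posrE // -{1}[s]lnK ?posrE // !ltr_expR.
have nH z : ln r < Re z < ln s -> holo (fun u => lam (0 + cexp u)) z.
  rewrite -strip => zr; apply: holo_comp_cexp; apply: nlam.
  by rewrite add0r cabs_cexp.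
have [V0 dV0] : exists V, forall z, r < expR (Re z) < s -> cderiv V z (lam (0 + cexp z)).
  apply: (@strip_primitive _ [set x | r < expR x < s]); first exact: radii_interval.
  by move=> z /= zr; apply: nH; rewrite -strip.
pose Q z := (h (cexp z) - a) / (h (cexp z) - b).
have dQ z : r < expR (Re z) < s -> cderiv (fun z => Q z * cexp (- V0 z)) z 0.
  move=> zr; have ez : r < cabs (cexp z) < s by rewrite cabs_cexp.
  have za : h (cexp z) - a != 0 by rewrite subr_eq0; exact: hp.
  have zb : h (cexp z) - b != 0 by rewrite subr_eq0; exact: hp.
  have dh := cderiv_comp (cderiv_cexp z) (cderiv_cder (nh ez)).
  have d1 := cderivB dh (cderiv_cst a z).
  have d2 := @cderivV _ (fun z => h (cexp z) - b) _ _ zb (cderivB dh (cderiv_cst b z)).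
  have d3 := cderiv_comp (cderivN (dV0 z zr)) (cderiv_cexp (- V0 z)).
  apply: cderiv_eq (cderivM (cderivM d1 d2) d3) _.
  by rewrite /lam /logder add0r; field; rewrite za zb.
pose x0 : C := mu%:C.
have x0r : r < expR (Re x0) < s by rewrite strip ReC /mu; lra.
have [d hd] : exists d, Q x0 * cexp (- V0 x0) = cexp d.
  apply: polar; rewrite mulf_neq0 ?cexp_neq0 //.
  have ez : r < cabs (cexp x0) < s by rewrite cabs_cexp.
  by rewrite mulf_neq0 ?invr_eq0 // subr_eq0; exact: hp.
pose V z := V0 z + d.
have QV z : r < expR (Re z) < s -> Q z = cexp (V z).
  move=> zr; rewrite /V cexpD -hd (strip_cst dQ x0r zr) cexpN.
  by rewrite mulrC divfK // cexp_neq0.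
have dV z : r < expR (Re z) < s -> cderiv V z (lam (0 + cexp z)).
  move=> zr; apply: cderiv_eq (cderivD (dV0 z zr) (cderiv_cst d z)) _.
  by rewrite addr0.
have nV z : r < expR (Re z) < s -> holo V z.
  move=> zr; apply: holo_of_derivable.
  have [e e0 he] := (radii_interval r s).1 _ zr.
  exists e => // w we; exists (lam (0 + cexp w)); apply: dV; apply: he.
  by apply: le_lt_trans we; rewrite -ReN -ReD; exact: Re_le_cabs.
have bound z : Re z = mu -> cabs (lam (0 + cexp z)) * L <= 192 * (ln (3 / c) + pi *+ 2).
  move=> zmu; have inS w : cabs (w - z) <= L -> r < expR (Re w) < s.
    move=> wz; rewrite strip; have := le_trans (Re_le_cabs _) wz.
    by rewrite ReD ReN zmu ler_norml /L /mu => /andP[h1 h2]; lra.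
  have zr : r < expR (Re z) < s by apply: inS; rewrite subrr cabs0 ltW.
  rewrite -(cderE (dV z zr)); apply: bloch => // [w /inS|v]; first exact: nV.
  have [k [q [Fk ka kb kq vq]]] := log_net v sp Fa Fb ab.
  exists q; split=> // w /inS wr; apply/negP => /eqP Vq.
  have ew : r < cabs (cexp w) < s by rewrite cabs_cexp.
  have := QV w wr; rewrite Vq -kq => /(moebius_inj ab (hp _ _ Fb ew) kb).
  by move/eqP; rewrite (negbTE (hp _ _ Fk ew)).
have mu0 := expR_gt0 mu.
have := cmean_bound (B := 192 * (ln (3 / c) + pi *+ 2) / L) hm mu0 x0r.
suff H : forall z, cabs (z - 0) = expR mu -> cabs (lam z) <= 192 * (ln (3 / c) + pi *+ 2) / L.
  move=> /(_ H) /(le_trans m1); rewrite ler_pdivlMr // /L; lra.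
move=> z; rewrite subr0 => zmu; rewrite ler_pdivlMr //.
have [|w hw] := @polar R z; first by rewrite -cabs_gt0 zmu.
rewrite hw -[cexp w]add0r; apply: bound.
by apply: (@expR_inj R); rewrite -zmu hw cabs_cexp.
Qed.

End Ring.

End ModulusBound.

(** * Conformal annuli and the metric form of uniform perfectness *)

Section ConformalAnnuli.
Variable R : realType.
Local Notation C := (plane R).
Implicit Types (z w p q : C) (A F : set C) (r s c : R).

Lemma card2P (T : Type) (S : set T) : (S #= `I_2)%card ->
  exists x y, [/\ S x, S y, x <> y & forall t, S t -> t = x \/ t = y].
Proof.
move=> /eq_cardSP[x Sx /eq_cardSP[y [Sy yx]]]; rewrite II0 card_eq0 => /eqP S0.
exists x, y; split=> //; first by move=> e; apply: yx; rewrite /= e.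
move=> t St; apply: contrapT => /not_orP[tx ty].
have : (S `\ x `\ y) t by [].
by rewrite S0.
Qed.

Lemma card2 (T : Type) (x y : T) (S : set T) : x <> y -> S x -> S y ->
  (forall t, S t -> t = x \/ t = y) -> (S #= `I_2)%card.
Proof.
move=> xy Sx Sy all; apply/eq_cardSP; exists x => //.
rewrite (_ : S `\ x = [set y]); first exact: card_set1.
apply/seteqP; split=> [t [St tx]|t ->]; last by split=> // e; apply: xy.
by have [/tx|] := all t St.
Qed.

Lemma round_annulusE w r s z : round_annulus w r s z = (r < cabs (z - w) < s) :> Prop.
Proof. by rewrite /round_annulus /= normcabs !ltcR. Qed.

Lemma holomorphic_holo (U : set C) (f : C -> C) : open U -> holomorphic_on U f ->
  forall z, U z -> holo f z.
Proof.
move=> /openP_plane oU hf z /oU[e e0 he]; apply: holo_of_derivable.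
by exists e => // w /he /hf /derivable_cderiv h; eexists; exact: h.
Qed.

Lemma open_annulus w r s : open (round_annulus w r s).
Proof.
apply/openP_plane => z; rewrite round_annulusE => /andP[z1 z2].
exists (Num.min (cabs (z - w) - r) (s - cabs (z - w))).
  by rewrite lt_min !subr_gt0 z1.
move=> u; rewrite lt_min round_annulusE => /andP[u1 u2].
have h1 := cabs_trianB z u w; rewrite (cabsB z u) in h1.
by have h2 := cabs_trianB u z w; apply/andP; split; lra.
Qed.

(** The inverse of the conformal map is analytic, and the two components of the
    complement of [A] are closed and connected. *)
Lemma conformal_modulus A m F c : conformal_annulus A m -> separates A F ->
  scale_perfect F c -> m <= 768 * (ln (3 / c) + pi *+ 2).
Proof.
move=> [[oA _ card] [w [r [s [f [r0 rs [hol bij] ->]]]]]] [FA sep] sp.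
have [E0 [E1 [C0 C1 E01 all]]] := card2P card.
have s0 : 0 < s by exact: lt_trans rs.
rewrite ln_div ?posrE //.
have [a [Fa Ea]] := sep _ C0; have [b [Fb Eb]] := sep _ C1.
have cAc : closed (~` A) by apply: open_closedC.
have comp E : components (~` A) E -> [/\ closed E, connected E, E `<=` ~` A &
   forall z, E z -> E = connected_component (~` A) z].
  move=> [x Ax <-]; split.
  - exact: component_closed.
  - exact: component_connected.
  - exact: connected_component_sub.
  - by move=> z; exact: same_connected_component.
have [cE0 kE0 E0A E0z] := comp _ C0; have [cE1 kE1 E1A E1z] := comp _ C1.
have [fun_f inj_f surj_f] := bij.
have fA p : A p -> r < cabs (f p - w) < s.
  by move=> Ap; rewrite -round_annulusE; exact: fun_f.
have /choice[h hh] : forall z, exists p, r < cabs z < s -> A p /\ f p - w = z.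
  move=> z; have [zr|] := pselect (r < cabs z < s); last by exists 0.
  have : round_annulus w r s (z + w) by rewrite round_annulusE addrK.
  by move=> /surj_f[p Ap fp]; exists p => _; rewrite fp addrK.
have hA z : r < cabs z < s -> A (h z) by move=> /hh[].
have fh z : r < cabs z < s -> f (h z) - w = z by move=> /hh[].
have hf p : A p -> h (f p - w) = p.
  move=> Ap; have fp := fA _ Ap; apply: inj_f; rewrite ?inE //; first exact: hA.
  by apply: (addIr (- w)); rewrite fh.
have nf p : A p -> holo (fun z => f z - w) p.
  by move=> Ap; apply: holoB (holo_cst _ _); exact: holomorphic_holo hol _ Ap.
have nh z : r < cabs z < s -> holo h z.
  move=> zr; rewrite -(fh z zr).
  by apply: (holo_inverse (f := fun z => f z - w) oA nf hf); exact: hA.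
apply: (@ring_modulus R A E0 E1 F (fun z => f z - w) h r s c a b) => //.
- move=> z; have [Az|nA] := pselect (A z); first exact: Or31.
  have Cz : components (~` A) (connected_component (~` A) z) by exists z.
  have zz : connected_component (~` A) z z by exact: connected_component_refl.
  have [e|e] := all _ Cz; rewrite e in zz; [exact: Or32|exact: Or33].
- by move=> z h0 h1; apply: E01; rewrite (E0z z h0) (E1z z h1).
- by move=> z Az; split=> [/E0A|/E1A].
- move=> p Fp Ap; have : (F `&` A) p by [].
  by rewrite FA.
Qed.

(** The components of the complement are the closed disc and the exterior of the
    larger open disc. *)
Lemma round_annulus_conformal w r s : 0 < r -> r < s ->
  conformal_annulus (round_annulus w r s) (ln (s / r)) /\
  forall F, (forall z, F z -> ~ round_annulus w r s z) -> F w ->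
   (exists2 z, F z & s <= cabs (z - w)) -> separates (round_annulus w r s) F.
Proof.
move=> r0 rs; have s0 : 0 < s by exact: lt_trans rs.
set A := round_annulus w r s.
pose D : set C := [set z | cabs (z - w) <= r].
pose O : set C := [set z | s <= cabs (z - w)].
have AE z : A z = (r < cabs (z - w) < s) :> Prop by exact: round_annulusE.
have DA : D `<=` ~` A by move=> z /= Dz; rewrite AE => /andP[h1 _]; rewrite ltNge Dz in h1.
have OA : O `<=` ~` A by move=> z /= Oz; rewrite AE => /andP[_ h1]; rewrite ltNge Oz in h1.
have AC z : ~ A z -> D z \/ O z.
  rewrite AE /D /O /= => /negP; rewrite negb_and -!leNgt => /orP[]; by [left|right].
have Dw : D w by rewrite /D /= subrr cabs0 ltW.
have Os : O (w + s%:C) by rewrite /O /= addrC addKr cabsR ler_norm.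
have DO z : D z -> ~ O z.
  by rewrite /D /O /= => h1 h2; have := le_trans h2 h1; rewrite leNgt rs.
have cD : connected D.
  apply: (@starlike_connected _ _ w) => // z t Dz /andP[t0 t1].
  rewrite /D /= addrC addKr cabsM cabsR ger0_norm //.
  by apply: le_trans Dz; rewrite ler_piMl ?cabs_ge0.
have cO : connected O.
  apply: (@radii_connected R w (fun x => s <= x)) => //.
  - by move=> x y t h1 _ /andP[h2 _]; apply: le_trans h1 _; rewrite ler_expR.
  - by apply/negP; rewrite -ltNge.
  - by move=> x h1; apply: le_trans h1; exact: ltW.
have loc z : ~ A z -> forall u, ~ A u -> cabs (u - z) < s - r -> (D z <-> D u).
  move=> nz u nu uz; have dz := cabs_trianB u z w.
  have du := cabs_trianB z u w; rewrite (cabsB z u) in du.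
  case: (AC z nz) => h1; case: (AC u nu) => h2; split=> // h3; exfalso.
  - by rewrite /D /O /= in h1 h2; lra.
  - by rewrite /D /O /= in h1 h2; lra.
  - by apply: (DO z).
  - by apply: (DO u).
have compD z : D z -> connected_component (~` A) z = D.
  move=> Dz; apply/seteqP; split; last exact: connected_component_max.
  move=> u hu; apply: (connected_ind (@component_connected _ (~` A) z) (P := D) _ _ Dz hu).
    move=> x hx; exists (s - r); first by rewrite subr_gt0.
    move=> y hy; exact: (loc _ (connected_component_sub hx) _ (connected_component_sub hy)).
  by apply: connected_component_refl; exact: DA.
have compO z : O z -> connected_component (~` A) z = O.
  move=> Oz; apply/seteqP; split; last exact: connected_component_max.
  have zz : connected_component (~` A) z z.
    by apply: connected_component_refl; exact: OA.
  move=> u hu; have nu := @connected_component_sub _ (~` A) z u hu.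
  have [Du|//] := AC u nu; exfalso; apply: (DO z) => //.
  apply: (connected_ind (@component_connected _ (~` A) z) (P := D) _ hu Du zz).
  move=> x hx; exists (s - r); first by rewrite subr_gt0.
  by move=> y hy; exact: (loc _ (connected_component_sub hx) _ (connected_component_sub hy)).
have allC E : components (~` A) E -> E = D \/ E = O.
  move=> [z /= nz <-]; have [/compD ->|/compO ->] := AC z nz; by [left|right].
have CD : components (~` A) D by exists w; [exact: DA|exact: compD].
have CO : components (~` A) O by exists (w + s%:C); [exact: OA|exact: compO].
split.
  split.
    split; first exact: open_annulus.
      have := @annulus_connected R w r s (ltW r0); congr connected.
      by apply/seteqP; split=> z /=; rewrite -AE.
    apply: (@card2 _ D O) => //.
    by move=> e; apply: (DO w) => //; rewrite -e.
  exists w, r, s, id; split=> //; split; last first.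
    by split=> // z zA; exists z.
  by move=> z _; exact: derivable_id.
move=> F FA Fw [z Fz zs]; split.
  by apply/seteqP; split=> // u [Fu Au]; exact: FA Fu Au.
by move=> E /allC[->|->]; [exists w|exists z].
Qed.

(** If a scale [rho] is missing at [a], the round annulus with centre [a] and
    radii [c * rho] and [rho] separates [F]; its modulus is [- ln c]. *)
Lemma uniformly_perfect_scale F : uniformly_perfect F ->
  exists c, scale_perfect F c.
Proof.
move=> [_ [z1 [z2 [Fz1 Fz2 z12]]] [M hM]].
pose c : R := expR (- (`|M| + 1)).
have c0 : 0 < c by exact: expR_gt0.
have c1 : c < 1.
  by rewrite /c -[ltRHS]expR0 ltr_expR oppr_lt0; have := normr_ge0 M; lra.
exists c; split; first by rewrite c0.
move=> a b rho Fa Fb /andP[rho0 rhoab].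
apply: contrapT => nk.
have cr : c * rho < rho by rewrite gtr_pMl.
have cr0 : 0 < c * rho by rewrite mulr_gt0.
have [ann sep] := round_annulus_conformal a cr0 cr.
have := hM _ _ ann; suff S : separates (round_annulus a (c * rho) rho) F.
  move=> /(_ S); rewrite invfM mulrA mulrAC divff ?gt_eqF // mul1r.
  rewrite lnV ?posrE // /c expRK opprK; have := ler_norm M; lra.
apply: sep => //.
  move=> z Fz; rewrite round_annulusE => /andP[h1 h2]; apply: nk.
  by exists z; rewrite !ltW.
by exists b; rewrite // cabsB.
Qed.

End ConformalAnnuli.

(** * Analytic maps at small scales *)

Section Images.
Variable R : realType.
Local Notation C := (plane R).
Implicit Types (z w p q a k : C) (F K : set C) (g : C -> C).

Lemma real_root (m : nat) (x : R) : 0 < x -> exists2 y, 0 < y & y ^+ m.+1 = x.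
Proof.
move=> x0; exists (expR (ln x / m.+1%:R)); first exact: expR_gt0.
by rewrite -expRM_natr divfK ?pnatr_eq0 // lnK.
Qed.

(** With [d] the distance from [a] to a point of multiplicity [m.+1],
    [g] is linear with slope [d ^+ m] at scales up to [ep * d], and a power at
    scales beyond [4 * d]. Radii [rho] that fall between the two regimes are
    served by the largest linear scale, at the cost of a factor that is
    independent of [d]. *)
Lemma two_regimes F g a (m : nat) (d al ep b1 b2 c t0 : R) :
  0 <= d -> 0 < al -> 0 < ep -> 0 < b1 -> 0 < b2 -> 0 < c < 1 -> 0 < t0 ->
  ep * d <= t0 ->
  (forall t, 0 < t <= t0 -> exists k, F k /\ c * t <= cabs (k - a) <= t) ->
  (forall k, F k -> cabs (k - a) <= ep * d ->
     al * d ^+ m * cabs (k - a) <= cabs (g k - g a) <= 3 * al * d ^+ m * cabs (k - a)) ->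
  (forall k, F k -> 4 * d <= cabs (k - a) <= t0 ->
     b1 * cabs (k - a) ^+ m.+1 <= cabs (g k - g a) <= b2 * cabs (k - a) ^+ m.+1) ->
  let c' := Num.min (c / 3)
     (Num.min (b1 * c ^+ m.+1 / b2) (c * al * ep * c ^+ m.+1 / (b2 * 4 ^+ m.+1))) in
  forall rho, 0 < rho <= b2 * t0 ^+ m.+1 ->
  exists k, F k /\ c' * rho <= cabs (g k - g a) <= rho.
Proof.
move=> d0 al0 ep0 b10 b20 /andP[c0 c1] t00 epd hF near far c' rho /andP[rho0 rho1].
have c'1 : c' <= c / 3 by rewrite ge_min lexx.
have c'2 : c' <= b1 * c ^+ m.+1 / b2 by rewrite !ge_min lexx !orbT.
have c'3 : c' <= c * al * ep * c ^+ m.+1 / (b2 * 4 ^+ m.+1) by rewrite !ge_min lexx !orbT.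
clearbody c'.
have nearT t : 0 < t <= ep * d -> exists k, F k /\
    al * d ^+ m * (c * t) <= cabs (g k - g a) <= 3 * al * d ^+ m * t.
  move=> /andP[tp te]; have [|k [Fk /andP[k1 k2]]] := hF t; first by rewrite tp (le_trans te).
  exists k; split=> //; have /andP[n1 n2] := near k Fk (le_trans k2 te).
  have P0 : 0 <= al * d ^+ m by rewrite mulr_ge0 ?exprn_ge0 // ltW.
  apply/andP; split.
    by apply: le_trans n1; rewrite ler_wpM2l.
  by apply: le_trans n2 _; rewrite ler_wpM2l // -mulrA mulr_ge0.
have [rA|rA] := leP rho (3 * al * ep * d ^+ m.+1).
  have dp : 0 < d.
    rewrite lt_neqAle d0 andbT; apply/negP => /eqP de.
    by move: rA; rewrite -de exprS mul0r mulr0 leNgt rho0.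
  have dm : 0 < d ^+ m by rewrite exprn_gt0.
  pose t := rho / (3 * al * d ^+ m).
  have q0 : 0 < 3 * al * d ^+ m by rewrite !mulr_gt0.
  have te : 0 < t <= ep * d.
    rewrite divr_gt0 //= ler_pdivrMr //; apply: le_trans rA _.
    by rewrite exprS le_eqVlt; apply/orP; left; apply/eqP; ring.
  have [k [Fk /andP[k1 k2]]] := nearT t te.
  exists k; split=> //; apply/andP; split.
    apply: le_trans k1.
    have -> : al * d ^+ m * (c * t) = c / 3 * rho.
      by rewrite /t; field; rewrite !gt_eqF.
    by rewrite ler_wpM2r // ltW.
  by apply: le_trans k2 _; rewrite /t mulrC divfK // gt_eqF.
have [|t tp tE] := @real_root m (rho / b2); first by rewrite divr_gt0.
have tt0 : t <= t0.
  rewrite -(@ler_pXn2r _ m.+1) ?nnegrE ?(ltW tp) ?(ltW t00) //.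
  by rewrite tE ler_pdivrMr // mulrC.
have cm : 0 < c ^+ m.+1 by rewrite exprn_gt0.
(* The power regime asks for points at distance between [c * t] and [t] from [a];
   it applies if these distances exceed [4 * d]. *)
have [tf|tf] := leP (4 * d) (c * t).
  have [|k [Fk /andP[k1 k2]]] := hF t; first by rewrite tp.
  have kr : 4 * d <= cabs (k - a) <= t0 by rewrite (le_trans tf k1) (le_trans k2).
  have /andP[f1 f2] := far k Fk kr.
  exists k; split=> //; apply/andP; split.
    apply: le_trans f1.
    apply: (@le_trans _ _ (b1 * c ^+ m.+1 / b2 * rho)); first by rewrite ler_wpM2r // ltW.
    have -> : b1 * c ^+ m.+1 / b2 * rho = b1 * (c * t) ^+ m.+1.
      by rewrite exprMn tE; field; rewrite gt_eqF.
    rewrite ler_pM2l // lerXn2r ?nnegrE ?cabs_ge0 //.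
    by rewrite mulr_ge0 // ltW.
  apply: le_trans f2 _; rewrite mulrC -ler_pdivlMr // -tE.
  by rewrite lerXn2r ?nnegrE ?cabs_ge0 // ltW.
have dp : 0 < d by have := mulr_gt0 c0 tp; lra.
(* Here [d] and [t] are comparable. *)
have [|k [Fk /andP[k1 k2]]] := nearT (ep * d); first by rewrite lexx mulr_gt0.
exists k; split=> //; apply/andP; split; last first.
  apply: le_trans k2 _; apply: le_trans (ltW rA).
  by rewrite exprS le_eqVlt; apply/orP; left; apply/eqP; ring.
apply: le_trans k1.
apply: (@le_trans _ _ (c * al * ep * c ^+ m.+1 / (b2 * 4 ^+ m.+1) * rho)).
  by rewrite ler_wpM2r // ltW.
have -> : rho = b2 * t ^+ m.+1 by rewrite tE mulrC divfK // gt_eqF.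
have p4 : 0 < (4 : R) ^+ m.+1 by rewrite exprn_gt0.
have -> : c * al * ep * c ^+ m.+1 / (b2 * 4 ^+ m.+1) * (b2 * t ^+ m.+1) =
  c * al * ep * ((c * t) ^+ m.+1 / 4 ^+ m.+1).
  by rewrite exprMn; move: (4 ^+ m.+1) p4 => x x0; field; rewrite !gt_eqF.
have -> : al * d ^+ m * (c * (ep * d)) = c * al * ep * d ^+ m.+1 by rewrite exprS; ring.
rewrite ler_wpM2l ?mulr_ge0 ?(ltW c0) ?(ltW al0) ?(ltW ep0) //.
rewrite ler_pdivrMr // -exprMn lerXn2r ?nnegrE //.
- by rewrite mulr_ge0 ?(ltW c0) ?(ltW tp).
- by rewrite mulr_ge0 ?(ltW dp).
- lra.
Qed.

Lemma near_one_pow (m : nat) : exists2 e : R, 0 < e &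
  forall w : C, cabs (w - 1) <= e -> cabs (w ^+ m - 1) <= 8^-1.
Proof.
have d := @cderivX R id 1 1 m (cderiv_id 1).
have e8 : 0 < (8 : R)^-1 by rewrite invr_gt0.
have /cts_plane /(_ _ e8)[e e0 he] := cderiv_cts d.
exists (e / 2); first by lra.
move=> w we; have /he : cabs (w - 1) < e by lra.
by rewrite /= expr1n => /ltW.
Qed.

Lemma near_value g p (e : R) : holo g p -> 0 < e -> exists2 d : R, 0 < d &
  forall z, cabs (z - p) < d -> holo g z /\ cabs (g z - g p) <= e.
Proof.
move=> ng e0; have [/cts_plane /(_ _ e0)[d d0 hd] _] := ng.
have [d' [B [d'0 _ hd']]] := holo_disc ng.
exists (Num.min d d'); first by rewrite lt_min d0.
by move=> z; rewrite lt_min => /andP[/hd/ltW h1 /hd'[h2 _]].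
Qed.

Lemma power_gap (T S U x y : R) : y <= T / 2 * (5 / 4 * U) ->
  T * (3 / 4 * U) <= x -> x <= S * (5 / 4 * U) -> 0 <= T * U -> T * U <= S * U ->
  U / 8 * T <= x - y /\ x + y <= 3 * U * S.
Proof. by move=> *; split; lra. Qed.

(** The local form [g z = g p + (z - p) ^+ m.+1 * u z] gives
    [g' z = (z - p) ^+ m * v z] with [v p != 0]. The derivative is almost
    constant on a disc around [a] that is small compared with [cabs (a - p)],
    and the power dominates when [k] is much farther from [p] than [a]. *)
Lemma local_regimes g p : holo g p -> ~ locally_cst g p ->
  exists (m : nat) (e al ep b1 b2 : R),
  [/\ 0 < e, 0 < al, 0 < ep <= 1, 0 < b1 /\ 0 < b2 &
  forall a k, cabs (a - p) < e -> cabs (k - p) < e ->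
   (cabs (k - a) <= ep * cabs (a - p) ->
     al * cabs (a - p) ^+ m * cabs (k - a) <= cabs (g k - g a)
        <= 3 * al * cabs (a - p) ^+ m * cabs (k - a)) /\
   (4 * cabs (a - p) <= cabs (k - a) ->
     b1 * cabs (k - a) ^+ m.+1 <= cabs (g k - g a) <= b2 * cabs (k - a) ^+ m.+1)].
Proof.
move=> ng nl; have [m [u [nu up gE]]] := local_form ng nl.
pose v z := m.+1%:R * u z + (z - p) * cder u z.
have nv : holo v p.
  apply: holoD; first exact: holoZ.
  by apply: holoM (holo_subr _ _) _; exact: holo_cder.
have vp : v p = m.+1%:R * u p by rewrite /v subrr mul0r addr0.
have kp : 0 < cabs (u p) by rewrite cabs_gt0.
have Vp : 0 < cabs (v p).
  by rewrite cabs_gt0 vp mulf_neq0 // pnatr_eq0.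
have [e1 e10 he1] := near_value nu (divr_gt0 kp (ltr0n R 4) : 0 < _).
have [e2 e20 he2] := near_value nv (divr_gt0 Vp (ltr0n R 8) : 0 < _).
have [ep ep0 hep] := near_one_pow m.
have dg z : cabs (z - p) < e1 -> cderiv g z ((z - p) ^+ m * v z).
  move=> ze; have [nz _] := he1 z ze.
  have d := cderivD (cderiv_cst (g p) z) (cderivM
     (cderivX m.+1 (cderivB (cderiv_id z) (cderiv_cst p z))) (cderiv_cder nz)).
  apply: cderiv_ext (_ : (fun w => g p + (w - p) ^+ m.+1 * u w) =1 g) _.
    by move=> w; rewrite (gE w).
  apply: cderiv_eq d _.
  by rewrite /v /= exprS; ring.
pose e := Num.min e1 e2.
have e0 : 0 < e by rewrite lt_min e10.
exists m, e, (cabs (v p) / 2), (Num.min ep 1), (cabs (u p) / 8 / 2 ^+ m.+1),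
  (3 * cabs (u p) * 2 ^+ m.+1).
split=> //.
- by rewrite divr_gt0.
- by rewrite lt_min ep0 ltr01 ge_min lexx orbT.
- by split; [rewrite !divr_gt0 // exprn_gt0|rewrite !mulr_gt0 // exprn_gt0].
move=> a k; rewrite !lt_min => /andP[ae1 ae2] /andP[ke1 ke2]; split=> hk.
  have [a0|a0] := eqVneq (a - p) 0.
    have ka : k - a = 0.
      apply/eqP; rewrite -cabs_eq0 eq_le cabs_ge0 andbT; apply: le_trans hk _.
      by rewrite a0 cabs0 mulr0.
    have -> : g k = g a by move/eqP: ka; rewrite subr_eq0 => /eqP ->.
    by rewrite ka subrr cabs0 !mulr0 lexx.
  have ap : 0 < cabs (a - p) by rewrite cabs_gt0.
  have seg t : 0 <= t <= 1 -> let z := a + t%:C * (k - a) in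
     [/\ cabs (z - p) < e1, cabs (z - p) < e2 & cabs (z - a) <= ep * cabs (a - p)].
    move=> /andP[t0 t1] z.
    have zE : z - p = (1 - t)%:C * (a - p) + t%:C * (k - p).
      by rewrite /z rmorphB /=; ring.
    have cz : cabs (z - p) <= (1 - t) * cabs (a - p) + t * cabs (k - p).
      rewrite zE; apply: le_trans (cabs_triangle _ _) _.
      by rewrite !cabsM !cabsR !ger0_norm // subr_ge0.
    have bnd x : cabs (a - p) < x -> cabs (k - p) < x -> cabs (z - p) < x.
      move=> h1 h2; apply: le_lt_trans cz _.
      have [->|t0'] := eqVneq t 0; first by rewrite subr0 mul1r mul0r addr0.
      have tp : 0 < t by rewrite lt_neqAle eq_sym t0'.
      have -> : x = (1 - t) * x + t * x by ring.
      by apply: ler_ltD; [rewrite ler_wpM2l ?subr_ge0 // ltW|rewrite ltr_pM2l].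
    split; [exact: bnd|exact: bnd|].
    rewrite /z addrC addKr cabsM cabsR ger0_norm //.
    apply: (@le_trans _ _ (cabs (k - a))); first by rewrite ler_piMl ?cabs_ge0.
    apply: le_trans hk _; rewrite ler_wpM2r ?cabs_ge0 //.
    by rewrite ge_min lexx.
  pose l := (a - p) ^+ m * v p.
  have lE : cabs l = cabs (a - p) ^+ m * cabs (v p) by rewrite /l cabsM cabsX.
  have : cabs ((g k - l * k) - (g a - l * a)) <= cabs l / 2 * cabs (k - a).
    apply: (segment_mvt (G := fun z => g z - l * z)
      (G' := fun z => (z - p) ^+ m * v z - l)) => t /seg[z1 z2 z3].
      apply: cderivB; first exact: dg.
      by apply: cderiv_eq (cderivZ _ (cderiv_id _)) _; rewrite mulr1.
    set z := a + _ in z1 z2 z3 *; pose w := (z - p) / (a - p).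
    have zw : z - p = (a - p) * w by rewrite /w mulrC divfK.
    have w1 : cabs (w - 1) <= ep.
      have -> : w - 1 = (z - a) / (a - p) by rewrite /w; field.
      by rewrite cabs_div ler_pdivrMr.
    have [_ vz] := he2 z z2; have wm := hep w w1.
    have -> : (z - p) ^+ m * v z - l =
       (a - p) ^+ m * ((w ^+ m - 1) * v z + (v z - v p)).
      by rewrite zw exprMn /l; ring.
    have -> : cabs l / 2 = cabs (a - p) ^+ m * (cabs (v p) / 2) by rewrite lE mulrA.
    rewrite cabsM cabsX ler_wpM2l ?exprn_ge0 ?cabs_ge0 //.
    apply: le_trans (cabs_triangle _ _) _; rewrite cabsM.
    have vz2 : cabs (v z) <= 9 / 8 * cabs (v p).
      by have := cabs_dist (v z) (v p); lra.
    have := ler_pM (cabs_ge0 _) (cabs_ge0 _) wm vz2; lra.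
  have -> : (g k - l * k) - (g a - l * a) = (g k - g a) - l * (k - a) by ring.
  move=> h.
  have h1 := cabs_dist (g k - g a) (l * (k - a)).
  have h2 := cabs_dist (l * (k - a)) (g k - g a).
  rewrite (cabsB (l * (k - a))) in h2; rewrite (cabsM l) in h1 h2.
  have -> : cabs (v p) / 2 * cabs (a - p) ^+ m * cabs (k - a) = cabs l / 2 * cabs (k - a).
    by rewrite lE; ring.
  have -> : 3 * (cabs (v p) / 2) * cabs (a - p) ^+ m * cabs (k - a) =
     3 / 2 * (cabs l * cabs (k - a)) by rewrite lE; ring.
  by lra.
have [na ua] := he1 a ae1; have [nk uk] := he1 k ke1.
set t := cabs (k - a) in hk *; have t0 : 0 <= t by exact: cabs_ge0.
have a4 : cabs (a - p) <= t / 4 by lra.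
have k1 : t / 2 <= cabs (k - p).
  by have := cabs_trianB k p a; rewrite (cabsB p) -/t; lra.
have k2 : cabs (k - p) <= 2 * t.
  by have := cabs_trianB k a p; rewrite -/t; lra.
have ua2 : cabs (u a) <= 5 / 4 * cabs (u p) by have := cabs_dist (u a) (u p); lra.
have uk2 : cabs (u k) <= 5 / 4 * cabs (u p) by have := cabs_dist (u k) (u p); lra.
have uk1 : 3 / 4 * cabs (u p) <= cabs (u k).
  by have := cabs_dist (u p) (u k); rewrite cabsB; lra.
have gka : g k - g a = (k - p) ^+ m.+1 * u k - (a - p) ^+ m.+1 * u a.
  by rewrite (gE k) (gE a); ring.
pose T := (t / 2) ^+ m.+1.
have T0 : 0 <= T by rewrite exprn_ge0 //; lra.
have P2 : 1 <= (2 : R) ^+ m by rewrite exprn_ege1 //; lra.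
have am : cabs (a - p) ^+ m.+1 <= T / 2.
  apply: (@le_trans _ _ ((t / 4) ^+ m.+1)).
    by rewrite lerXn2r ?nnegrE ?cabs_ge0 //; lra.
  have -> : t / 4 = t / 2 / 2 by lra.
  rewrite expr_div_n -/T ler_wpM2l // lef_pV2 ?posrE ?exprn_gt0 //.
  by rewrite exprS; lra.
have km1 : T <= cabs (k - p) ^+ m.+1.
  by rewrite /T lerXn2r ?nnegrE ?cabs_ge0 //; lra.
have km2 : cabs (k - p) ^+ m.+1 <= (2 * t) ^+ m.+1.
  by rewrite lerXn2r ?nnegrE ?cabs_ge0 //; lra.
have TT : T <= (2 * t) ^+ m.+1 := le_trans km1 km2.
have A1 : cabs ((a - p) ^+ m.+1 * u a) <= T / 2 * (5 / 4 * cabs (u p)).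
  by rewrite cabsM cabsX; apply: ler_pM; rewrite ?exprn_ge0 ?cabs_ge0.
have K1 : T * (3 / 4 * cabs (u p)) <= cabs ((k - p) ^+ m.+1 * u k).
  by rewrite cabsM cabsX; apply: ler_pM => //; rewrite mulr_ge0 // ltW.
have K2 : cabs ((k - p) ^+ m.+1 * u k) <= (2 * t) ^+ m.+1 * (5 / 4 * cabs (u p)).
  by rewrite cabsM cabsX; apply: ler_pM; rewrite ?exprn_ge0 ?cabs_ge0.
have -> : cabs (u p) / 8 / 2 ^+ m.+1 * t ^+ m.+1 = cabs (u p) / 8 * T.
  by rewrite /T expr_div_n; ring.
have -> : 3 * cabs (u p) * 2 ^+ m.+1 * t ^+ m.+1 = 3 * cabs (u p) * (2 * t) ^+ m.+1.
  by rewrite exprMn; ring.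
have TU := mulr_ge0 T0 (ltW kp).
have TU2 : T * cabs (u p) <= (2 * t) ^+ m.+1 * cabs (u p) by rewrite ler_wpM2r // ltW.
rewrite gka; have [low high] := power_gap A1 K1 K2 TU TU2; apply/andP; split.
  exact: le_trans low (cabs_dist _ _).
by apply: le_trans (cabs_triangle _ _) _; rewrite cabsN.
Qed.

End Images.

(** * Finite unions of analytic images *)

Section FiniteImages.
Variable R : realType.
Local Notation C := (plane R).
Implicit Types (z w p q a k : C) (F K : set C) (g : C -> C).

(** One integer bounds both the loss of scale and the largest radius, so a
    compactness argument over filters makes the two uniform at once. *)
Definition image_scale F g (n : nat) a := forall rho : R, 0 < rho <= n.+1%:R^-1 ->
  exists k, F k /\ n.+1%:R^-1 * rho <= cabs (g k - g a) <= rho.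

Lemma image_scale_near F g p (c D0 : R) : 0 < c < 1 -> 0 < D0 ->
  (forall a t, F a -> 0 < t <= D0 -> exists k, F k /\ c * t <= cabs (k - a) <= t) ->
  holo g p -> ~ locally_cst g p ->
  \forall a \near p & n \near \oo, F a -> image_scale F g n a.
Proof.
move=> c01 D00 hF ng nl.
have [m [e [al [ep [b1 [b2 [e0 al0 /andP[ep0 ep1] [b10 b20] reg]]]]]]] := local_regimes ng nl.
pose t0 := Num.min D0 (e / 4).
have t00 : 0 < t0 by rewrite lt_min D00 /=; lra.
have t0D : t0 <= D0 by rewrite ge_min lexx.
have t0e : t0 <= e / 4 by rewrite ge_min lexx orbT.
have /andP[c0 c1] := c01.
pose c' := Num.min (c / 3)
     (Num.min (b1 * c ^+ m.+1 / b2) (c * al * ep * c ^+ m.+1 / (b2 * 4 ^+ m.+1))).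
have c'0 : 0 < c'.
  by rewrite !lt_min !divr_gt0 ?mulr_gt0 ?exprn_gt0.
pose x := Num.min c' (b2 * t0 ^+ m.+1).
have x0 : 0 < x by rewrite lt_min c'0 mulr_gt0 // exprn_gt0.
have nx : \forall n \near \oo, n.+1%:R^-1 < x by exact: near_infty_natSinv_lt (PosNum x0).
exists ([set a | cabs (a - p) < t0], [set n : nat | n.+1%:R^-1 < x]).
  by split=> //=; apply/near_plane; exists t0.
move=> [a n] [/= ap]; rewrite lt_min => /andP[n1 n2] Fa rho /andP[rho0 rhon].
have rr : 0 < rho <= b2 * t0 ^+ m.+1.
  by rewrite rho0 /=; apply: le_trans rhon _; exact: ltW.
have epd : ep * cabs (a - p) <= t0.
  apply: (@le_trans _ _ (cabs (a - p))); last exact: ltW.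
  by rewrite ler_piMl ?cabs_ge0.
have ain : cabs (a - p) < e by lra.
have kin k : cabs (k - a) <= t0 -> cabs (k - p) < e.
  by move=> ka; have := cabs_trianB k a p; lra.
have [|||k [Fk /andP[k1 k2]]] := @two_regimes R F g a m (cabs (a - p)) al ep b1 b2 c t0
  (cabs_ge0 _) al0 ep0 b10 b20 c01 t00 epd _ _ _ rho rr.
- move=> t /andP[tp tt]; apply: hF => //; rewrite tp /=.
  exact: le_trans t0D.
- move=> k Fk ka; have [h _] := reg a k ain (kin k (le_trans ka epd)).
  exact: h.
- move=> k Fk /andP[k1 k2]; have [_ h] := reg a k ain (kin k k2).
  exact: h.
exists k; split=> //; rewrite k2 andbT; apply: le_trans k1.
by rewrite ler_wpM2r // ltW.
Qed.

(** Every point is at distance at least [cabs (z1 - z2) / 2] from [z1] or [z2]. *)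
Lemma scale_perfect_small F c z1 z2 : scale_perfect F c -> F z1 -> F z2 ->
  z1 != z2 -> forall a (t : R), F a -> 0 < t <= cabs (z1 - z2) / 2 ->
  exists k, F k /\ c * t <= cabs (k - a) <= t.
Proof.
move=> [_ sp] F1 F2 z12 a t Fa /andP[t0 t1].
have [h|h] := leP (cabs (z1 - z2) / 2) (cabs (a - z1)).
  by apply: (sp a z1) => //; rewrite t0 (le_trans t1).
apply: (sp a z2) => //; rewrite t0 (le_trans t1) //=.
by have := cabs_trianB z1 a z2; rewrite (cabsB z1 a); lra.
Qed.

Lemma near_finite (T : choiceType) (S : set T) (P : T -> nat -> Prop) : finite_set S ->
  (forall x, S x -> \forall n \near \oo, P x n) ->
  \forall n \near \oo, forall x, S x -> P x n.
Proof.
move=> /finite_seqP[s ->]; elim: s => [|x s IH] h; first by near=> n.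
have hx : \forall n \near \oo, P x n by apply: h; rewrite /= mem_head.
have hs : \forall n \near \oo, forall y, [set` s] y -> P y n.
  by apply: IH => y /= ys; apply: h; rewrite /= in_cons ys orbT.
near=> n; move=> y /=; rewrite in_cons => /orP[/eqP ->|ys].
  by near: n.
by move: y ys; near: n.
Unshelve. all: by end_near. Qed.

Lemma finite_images_compact (S : set (C -> C)) F : finite_set S -> compact F ->
  (forall g p, S g -> F p -> {for p, continuous g}) ->
  compact (\bigcup_(g in S) (g @` F)).
Proof.
move=> /finite_seqP[s ->] cF; elim: s => [|g s IH] h.
  rewrite (_ : \bigcup_(g in _) _ = set0); first exact: compact0.
  by apply/seteqP; split=> // z [].
rewrite (_ : \bigcup_(g0 in _) _ = g @` F `|` \bigcup_(g in [set` s]) (g @` F)).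
  apply: compactU.
    apply: continuous_compact => //; apply: continuous_in_subspaceT => p /set_mem Fp.
    by apply: h => //=; rewrite mem_head.
  by apply: IH => g' p sg'; apply: h; rewrite /= in_cons; apply/orP; right.
apply/seteqP; split=> [z [g' /=]|z [gz|[g' /= sg' gz]]].
- rewrite in_cons => /orP[/eqP ->|sg'] gz; [by left|by right; exists g'].
- by exists g => //=; rewrite mem_head.
- by exists g' => //=; rewrite in_cons sg' orbT.
Qed.

(** The local estimates [image_scale_near] hold with a common constant by
    compactness of [F] and finiteness of [S]. They reach up to a fixed radius;
    larger radii are rescaled to it, as [K] is bounded. *)
Lemma finite_images_perfect (S : set (C -> C)) F c : finite_set S -> S !=set0 ->
  compact F -> scale_perfect F c -> (exists z w, [/\ F z, F w & z <> w]) ->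
  (forall g p, S g -> F p -> holo g p /\ ~ locally_cst g p) ->
  let K := \bigcup_(g in S) (g @` F) in
  [/\ compact K, exists z w, [/\ K z, K w & z <> w] & exists c', scale_perfect K c'].
Proof.
move=> fS [g0 Sg0] cF spF [z1 [z2 [Fz1 Fz2 /eqP z12]]] hS K.
have cK : compact K.
  by apply: finite_images_compact => // g p Sg Fp; have [[]] := hS g p Sg Fp.
have [c01 _] := spF.
have D0 : 0 < cabs (z1 - z2) / 2 by rewrite divr_gt0 // cabs_gt0 subr_eq0.
have nearF : \forall n \near \oo, forall g, S g -> F `<=` (fun a => F a -> image_scale F g n a).
  apply: near_finite => // g Sg.
  move/compact_near_coveringP: cF => /(_ nat \oo (fun n a => F a -> image_scale F g n a)).
  apply => p Fp; have [ng nl] := hS g p Sg Fp.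
  exact: image_scale_near c01 D0 (scale_perfect_small spF Fz1 Fz2 z12) ng nl.
have [n hn] := filter_ex nearF.
pose x : R := n.+1%:R^-1.
have x0 : 0 < x by rewrite invr_gt0.
have x1 : x <= 1 by rewrite invf_le1 // ler1n.
have hK b rho : K b -> 0 < rho <= x -> exists k, K k /\ x * rho <= cabs (k - b) <= rho.
  move=> [g Sg [a Fa <-]] hr; have [k [Fk hk]] := hn g Sg a Fa Fa rho hr.
  by exists (g k); split=> //; exists g => //; exists k.
have K1 : K (g0 z1) by exists g0 => //; exists z1.
split=> //.
  have [|k [Kk /andP[k1 k2]]] := hK _ x K1; first by rewrite x0 lexx.
  exists k, (g0 z1); split=> // e; move: k1.
  by rewrite e subrr cabs0 leNgt mulr_gt0.
have [||z _ zmax] := @compact_EVT_max _ R (@cabs R) K _ cK.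
- by exists (g0 z1).
- by apply: continuous_subspaceT; exact: cts_cabs.
pose D := 2 * cabs z + 2.
have Dp : 1 < D by have := cabs_ge0 z; rewrite /D; lra.
have Dp0 : 0 < D by lra.
have bK a b : K a -> K b -> cabs (a - b) <= D.
  move=> Ka Kb; have := cabs_triangle a (- b); rewrite cabsN.
  have : cabs a <= cabs z by apply: zmax; rewrite inE.
  have : cabs b <= cabs z by apply: zmax; rewrite inE.
  rewrite /D; lra.
have xxD : x * (x / D) < 1.
  rewrite mulrA ltr_pdivrMr // mul1r.
  by apply: le_lt_trans Dp; rewrite mulr_ile1 // ltW.
(* The factor [x / D] maps the radii up to [D] into the radii up to [x]. *)
exists (x * (x / D)); split; first by rewrite xxD andbT mulr_gt0 // divr_gt0.
move=> a b rho Ka Kb /andP[rho0 rhoab].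
have rD : rho <= D by apply: le_trans rhoab (bK _ _ Ka Kb).
have r1 : x / D * rho <= rho.
  by rewrite ler_piMl ?(ltW rho0) // ler_pdivrMr // mul1r; lra.
have r2 : 0 < x / D * rho <= x.
  rewrite mulr_gt0 ?divr_gt0 //= mulrAC ler_pdivrMr //.
  by rewrite ler_pM2l.
have [k [Kk /andP[k1 k2]]] := hK a _ Ka r2.
exists k; split=> //; rewrite (le_trans k2 r1) andbT.
by apply: le_trans k1; rewrite -[leLHS]mulrA.
Qed.

End FiniteImages.

(** * Limit sets *)

Section LimitSets.
Variable R : realType.
Local Notation C := (plane R).
Implicit Types (z w p : C) (f g : C -> C).

Lemma holo_comp f g z : holo f z -> holo g (f z) -> holo (g \o f) z.
Proof.
move=> nf ng.
have [d [B [d0 _ hd]]] := holo_disc nf; have [e [B' [e0 _ he]]] := holo_disc ng.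
have [/cts_plane /(_ _ e0)[k k0 hk] _] := nf.
apply: holo_of_derivable; exists (Num.min d k); first by rewrite lt_min d0.
move=> w; rewrite lt_min => /andP[/hd[nw _] /hk /he[ngw _]].
by eexists; exact: cderiv_comp (cderiv_cder nw) (cderiv_cder ngw).
Qed.

Lemma isolated_not_locally_cst f z :
  (exists2 e : R, 0 < e & forall w, w != z -> cabs (w - z) < e -> f w != f z) ->
  ~ locally_cst f z.
Proof.
move=> [e e0 he] [d d0 hd].
pose x := Num.min e d / 2; have m0 : 0 < Num.min e d by rewrite lt_min e0.
have x0 : 0 < x by rewrite /x; lra.
have : cabs (z + x%:C - z) < Num.min e d.
  by rewrite addrC addKr cabsR ger0_norm ?(ltW x0) // /x; lra.
rewrite lt_min => /andP[/he h1 /hd h2].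
have zx : z + x%:C != z.
  by rewrite -subr_eq0 addrC addKr -cabs_eq0 cabsR gtr0_norm // gt_eqF.
by move: (h1 zx); rewrite h2 eqxx.
Qed.

(** Both maps take isolated values. *)
Lemma comp_not_locally_cst f g z : holo f z -> holo g (f z) ->
  ~ locally_cst f z -> ~ locally_cst g (f z) -> ~ locally_cst (g \o f) z.
Proof.
move=> nf ng lf lg; apply: isolated_not_locally_cst.
have [e e0 he] := isolated_value nf lf; have [d d0 hd] := isolated_value ng lg.
have [/cts_plane /(_ _ d0)[k k0 hk] _] := nf.
exists (Num.min e k); first by rewrite lt_min e0.
by move=> w wz; rewrite lt_min => /andP[/(he _ wz) h1 /hk]; exact: hd.
Qed.

Lemma id_not_locally_cst z : ~ locally_cst (idfun : C -> C) z.
Proof. by apply: isolated_not_locally_cst; exists 1 => // w. Qed.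

Section System.
Variables (U X : set C) (I : nat -> Type) (phi : forall j, I j -> C -> C).
Hypothesis sys : is_nifs U X phi.
Hypothesis ana : is_analytic U phi.

Lemma composites_cat j k l f : composites phi j (k + l) f <->
  exists g g', [/\ composites phi j k g, composites phi (j + k) l g' & f = g \o g'].
Proof.
elim: k j f => [|k IH] j f.
  rewrite add0n addn0; split=> [cf|[g [g' [-> cg' ->]]]]; last by [].
  by exists idfun, f.
rewrite addSn; split.
  move=> [i _ [h /IH[g [g' [cg cg' ->]]] <-]].
  exists (phi i \o g), g'; split=> //; first by exists i => //; exists g.
  by rewrite addnS -addSn.
move=> [g [g' [[i _ [h ch <-]] cg' ->]]]; exists i => //.
exists (h \o g') => //; apply/IH; exists h, g'; split=> //.
by rewrite addSnnS.
Qed.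

Lemma phi_holo j (i : I j) z : (0 < j)%N -> U z ->
  holo (phi i) z /\ ~ locally_cst (phi i) z.
Proof.
move=> j0 Uz.
have nph := holomorphic_holo (nifs_domain_open sys) (@ana j i j0).
split; first exact: nph.
apply: (nowhere_locally_cst (nifs_domain_connected sys) nph) => //.
by have [a [b ab]] := nifs_nonconstant sys i j0; exists a, b.
Qed.

Lemma composites_prop j k g : (0 < j)%N -> composites phi j k g ->
  forall z, U z -> [/\ U (g z), X z -> X (g z), holo g z & ~ locally_cst g z].
Proof.
elim: k j g => [|k IH] j g j0.
  move=> -> z Uz; split=> //; first exact: holo_id.
  exact: id_not_locally_cst.
move=> [i _ [h ch <-]] z Uz; have [Uh _ nh lh] := IH j.+1 h isT ch z Uz.
have Xp := nifs_maps sys i j0 Uh; have [np lp] := phi_holo i j0 Uh.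
split=> //; first exact: (nifs_sub sys).
- exact: holo_comp.
- exact: comp_not_locally_cst.
Qed.

Lemma composites_inhabited j k : (0 < j)%N -> exists g, composites phi j k g.
Proof.
elim: k j => [|k IH] j j0; first by exists idfun.
have [g cg] := IH j.+1 isT; case: (nifs_index_nonempty sys j0) => i.
by exists (phi i \o g); exists i => //; exists g.
Qed.

Lemma stage_set_sub j k : (0 < j)%N -> stage_set X phi j k `<=` X.
Proof.
move=> j0 _ [g cg [x Xx <-]].
by have [_ + _ _] := composites_prop j0 cg (nifs_sub sys Xx); apply.
Qed.

Lemma stage_set_decr j k l : (0 < j)%N ->
  stage_set X phi j (k + l) `<=` stage_set X phi j k.
Proof.
move=> j0 _ [f /composites_cat[g [g' [cg cg' ->]]] [x Xx <-]].
have jk : (0 < j + k)%N by rewrite addn_gt0 j0.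
have [_ Xg' _ _] := composites_prop jk cg' (nifs_sub sys Xx).
by exists g => //; exists (g' x); first exact: Xg'.
Qed.

Lemma limit_set_stage j z : limit_set_from X phi j z -> forall k, (0 < k)%N ->
  stage_set X phi j k z.
Proof. by move=> h k k0; exact: h. Qed.

(** A point [z] of the limit set is in the image of every stage, but the
    preimages found at different stages may differ. If no preimage of [z] lay in
    [limit_set_from X phi N.+1], each point of [X] would have a neighbourhood in
    which, from some stage on, no point of the stage is mapped to [z]: the
    preimages are isolated, and one outside of the limit set leaves the
    decreasing stages. By compactness of [X] and finiteness of the family some
    stage would then contain no preimage at all. *)
Lemma limit_set_image N z : finite_set [set g \_ U | g in composites phi 1 N] ->
  limit_set X phi z ->
  exists g y, [/\ composites phi 1 N g, limit_set_from X phi N.+1 y & g y = z].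
Proof.
move=> fin Jz; apply: contrapT => none.
pose S := [set g \_ U | g in composites phi 1 N].
have patchU g y : U y -> (g \_ U) y = g y by move=> Uy; rewrite patchE mem_set.
have : \forall k \near \oo, forall r, S r -> X `<=` (fun y => ~ (r y = z /\ stage_set X phi N.+1 k y)).
  apply: near_finite => // _ [g cg <-].
  have /compact_near_coveringP := nifs_compact sys.
  move=> /(_ nat \oo (fun k y => ~ ((g \_ U) y = z /\ stage_set X phi N.+1 k y))).
  apply=> y Xy; have Uy := nifs_sub sys Xy.
  have [_ _ ng lg] := composites_prop (isT : 0 < 1)%N cg Uy.
  have [u u0 hu] := iffLR (openP_plane U) (nifs_domain_open sys) y Uy.
  have [gz|gz] := eqVneq (g y) z; last first.
    have [/cts_plane cg' _] := ng.
    have gz0 : 0 < cabs (g y - z) by rewrite cabs_gt0 subr_eq0.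
    have [d d0 hd] := cg' _ gz0.
    exists ([set y' | cabs (y' - y) < Num.min d u], setT).
      split; last exact: filterT.
      by apply/near_plane; exists (Num.min d u); rewrite // lt_min d0.
    move=> [y' k] [/= ]; rewrite lt_min => /andP[/hd h1 /hu Uy'] _ [].
    by rewrite patchU // => e; move: h1; rewrite e cabsB ltxx.
  have [d d0 hd] := isolated_value ng lg.
  have [k0 [k00 nk0]] : exists k0, (0 < k0)%N /\ ~ stage_set X phi N.+1 k0 y.
    apply: contrapT => nk; apply: none; exists g, y; split=> // k /= k0.
    by apply: contrapT => ns; apply: nk; exists k.
  exists ([set y' | cabs (y' - y) < Num.min d u], [set k | (k0 <= k)%N]).
    split; last by exists k0.
    by apply/near_plane; exists (Num.min d u); rewrite // lt_min d0.
  move=> [y' k] [/= ]; rewrite lt_min => /andP[yd /hu Uy'] kk [].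
  rewrite patchU // => e st.
  have [yy|yy] := eqVneq y' y; last by have := hd y' yy yd; rewrite e gz eqxx.
  by apply: nk0; move: st; rewrite yy -(subnKC kk); exact: stage_set_decr.
move=> [k0 _ /(_ k0.+1 (leqnSn k0)) h].
have : stage_set X phi 1 (N + k0.+1) z by apply: limit_set_stage; rewrite // addnS.
move=> [f /composites_cat[g [g' [cg cg' ->]]] [x Xx gz]].
have st : stage_set X phi N.+1 k0.+1 (g' x) by exists g' => //; exists x.
have Xy := stage_set_sub (ltn0Sn N) st.
apply: (h (g \_ U) _ (g' x) Xy); first by exists g.
by split=> //; rewrite patchU //; apply: (nifs_sub sys).
Qed.

Lemma image_limit_set N g y : composites phi 1 N g ->
  limit_set_from X phi N.+1 y -> limit_set X phi (g y).
Proof.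
move=> cg Jy k /= k0.
have : stage_set X phi 1 (k + N) (g y).
  have [g' cg' [x Xx gx]] := Jy k k0; rewrite addnC.
  exists (g \o g'); last by exists x => //=; rewrite gx.
  by apply/composites_cat; exists g, g'.
exact: stage_set_decr.
Qed.

Lemma limit_set_from_sub j : (0 < j)%N -> limit_set_from X phi j `<=` X.
Proof. by move=> j0 z /limit_set_stage /(_ 1%N isT); exact: stage_set_sub. Qed.

(** The limit set is the union of the images by [limit_set_image] and
    [image_limit_set], and a finite union of images of the compact [F] is
    closed. The maps are restricted to [U], on which alone they are determined;
    near a point of the open set [U] this changes nothing. *)
Lemma closure_limit_set N :
  let F := closure (limit_set_from X phi N.+1) in
  let S := [set g \_ U | g in composites phi 1 N] in
  finite_set S -> compact F ->
  [/\ F `<=` U, S !=set0, forall g p, S g -> F p -> holo g p /\ ~ locally_cst g p &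
   closure (limit_set X phi) = \bigcup_(g in S) (g @` F)].
Proof.
move=> F S fS cF.
have cX : closed X by apply: compact_closed (nifs_compact sys); exact: norm_hausdorff.
have FX : F `<=` X.
  rewrite [X in _ `<=` X](iffLR (closure_id X) cX).
  by apply: closure_subset; exact: limit_set_from_sub.
have FU : F `<=` U by move=> z /FX; exact: (nifs_sub sys).
have patchU g y : U y -> (g \_ U) y = g y by move=> Uy; rewrite patchE mem_set.
have Sprop g p : S g -> F p -> holo g p /\ ~ locally_cst g p.
  move=> [g' cg' <-] /FU Up.
  have [_ _ ng lg] := composites_prop (isT : 0 < 1)%N cg' Up.
  have [u u0 hu] := iffLR (openP_plane U) (nifs_domain_open sys) p Up.
  split; first by apply: holo_near ng _; exists u => // w /hu Uw; rewrite patchU.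
  move=> [e e0 he]; apply: lg; exists (Num.min e u); first by rewrite lt_min e0.
  by move=> w; rewrite lt_min => /andP[/he + /hu Uw]; rewrite !patchU.
split=> //.
  by have [g cg] := composites_inhabited N (isT : 0 < 1)%N; exists (g \_ U), g.
apply/seteqP; split.
  have cK : closed (\bigcup_(g in S) (g @` F)).
    apply: compact_closed; first exact: norm_hausdorff.
    apply: (finite_images_compact fS cF) => g p Sg Fp.
  by have [[cg _] _] := Sprop g p Sg Fp; exact: cg.
  rewrite [X in _ `<=` X](iffLR (closure_id _) cK); apply: closure_subset => z Jz.
  have [g [y [cg Jy gy]]] := limit_set_image fS Jz.
  have Fy : F y by apply: subset_closure.
  exists (g \_ U); first by exists g.
  by exists y; rewrite // patchU //; exact: FU.
move=> _ [_ [g cg <-] [p Fp <-]].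
have [_ _ [/cts_plane cgp _] _] := composites_prop (isT : 0 < 1)%N cg (FU _ Fp).
rewrite patchU; last exact: FU.
move=> B /near_plane[e e0 he]; have [d d0 hd] := cgp _ e0.
have [|y [Jy /= yp]] := Fp [set y | cabs (y - p) < d].
  by apply/near_plane; exists d.
exists (g y); split; last by apply: he; exact: hd.
exact: (image_limit_set cg Jy).
Qed.

End System.
End LimitSets.

(** * Uniform perfectness of the limit set *)

Theorem theorem1p2 (R : realType) (U X : set (plane R)) (I : nat -> Type)
    (phi : forall j, I j -> plane R -> plane R) (n : nat)
    (nifs_phi : is_nifs U X phi)
    (analytic_phi : is_analytic U phi)
    (n_gt1 : (1 < n)%N)
    (perfect_n : uniformly_perfect (closure (limit_set_from X phi n)))
    (finite_family :
      finite_set [set g \_ U | g in composites phi 1 n.-1]) :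
  uniformly_perfect (closure (limit_set X phi)).
Proof.
case: n n_gt1 perfect_n finite_family => [//|N] _ perfect_n fS.
have [cF two _] := perfect_n; have [c spF] := uniformly_perfect_scale perfect_n.
have [_ nS Sprop ->] := closure_limit_set nifs_phi analytic_phi fS cF.
have [cK twoK [c' spK]] := finite_images_perfect fS nS cF spF two Sprop.
split=> //; exists (768 * (ln (3 / c') + pi *+ 2)) => A m annA sepA.
exact: conformal_modulus annA sepA spK.
Qed.
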